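(* There exists a constant $c>0$ such that for every integer $n\geq 1$, \[ \mathbb{P}_n\left[\max\{\lVert \gamma_k \rVert: 0\leq k\leq n\}\geq 10^{11}\cdot \frac{n}{\log(n+1)}\right]\leq \exp\left(-cn^{2/3}\right), \] where $\mathbb{P}_n$ is the uniform probability measure on self-avoiding walks $\gamma=(\gamma_0,\ldots,\gamma_n)$ of length $n$ on the hexagonal lattice starting from the origin.
   Context: The hexagonal lattice $\mathbb{H}$ is embedded in the plane $\mathbb{R}^2$ as the regular hexagonal (honeycomb) tiling graph in which every edge is a straight segment of length $\sqrt{3}/3$, positioned so that the origin is a vertex of $\mathbb{H}$. A self-avoiding walk of length $n$ from the origin is a sequence $(\gamma_0,\ldots,\gamma_n)$ of pairwise distinct vertices of $\mathbb{H}$ with $\gamma_0$ the origin and $\gamma_i,\gamma_{i+1}$ adjacent for every $0\le i<n$. $\lVert\cdot\rVert$ is the Euclidean norm and $\log$ is the natural logarithm. *)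

(* Defs.v *)
From mathcomp Require Import all_boot all_order all_algebra finmap.
From mathcomp Require Import all_classical all_reals all_analysis.
From mathcomp Require Import ring lra zify.

Set Implicit Arguments.
Unset Strict Implicit.
Unset Printing Implicit Defensive.

Import Order.TTheory GRing.Theory Num.Theory.

Local Open Scope classical_set_scope.
Local Open Scope ring_scope.

(* The vertices form two translates of the triangular lattice generated by    *)
(* e1 = (1, 0) and e2 = (1/2, sqrt 3 / 2):                                    *)
(*   (a, b, false) is the point a e1 + b e2,                                  *)
(*   (a, b, true)  is the point a e1 + b e2 + d,                              *)
(* where d = (e1 + e2) / 3 is the centre of the triangle 0, e1, e2.           *)
Definition hex_vertex : Type := (int * int * bool)%type.

Definition hex_origin : hex_vertex := (0, 0, false).

Definition hex_pos (R : realType) (v : hex_vertex) : R * R :=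
  let: (a, b, s) := v in
  (a%:~R + b%:~R / 2 + s%:R / 2,
   b%:~R * (Num.sqrt 3 / 2) + s%:R * (Num.sqrt 3 / 6)).

(* The library's norm on R * R is the sup norm, hence this definition. *)
Definition enorm (R : realType) (p : R * R) : R :=
  Num.sqrt (p.1 ^+ 2 + p.2 ^+ 2).

Definition hex_nbrs (v : hex_vertex) : seq hex_vertex :=
  let: (a, b, s) := v in
  if s then [:: (a, b, false); (a + 1, b, false); (a, b + 1, false)]
  else [:: (a, b, true); (a - 1, b, true); (a, b - 1, true)].

Definition hex_adj : rel hex_vertex := fun u v => v \in hex_nbrs u.

(* [sorted hex_adj] says that consecutive vertices are adjacent. *)
Definition hex_saw (n : nat) : set (n.+1.-tuple hex_vertex) :=
  [set g | [&& thead g == hex_origin, sorted hex_adj g & uniq g]].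

(* [fset_set] returns the empty set on infinite sets; [hex_saw n] is finite,  *)
(* see [finite_hex_saw].                                                      *)
Definition hex_saw_prob (R : realType) (n : nat)
    (E : set (n.+1.-tuple hex_vertex)) : R :=
  #|` fset_set (hex_saw (n := n) `&` E)|%:R / #|` fset_set (hex_saw (n := n))|%:R.

(* Norms are nonnegative, so the default value 0 does not affect the maximum. *)
Definition max_enorm (R : realType) (n : nat)
    (g : n.+1.-tuple hex_vertex) : R :=
  \big[Num.max/0]_(k < n.+1) enorm (hex_pos R (tnth g k)).

Lemma hex_norm_eq0 (i j : int) : i * i + i * j + j * j = 0 -> i = 0 /\ j = 0.
Proof.
move=> H; have A : 0 <= (i + 2 * j) * (i + 2 * j) by rewrite -expr2 sqr_ge0.
have B : 0 <= (j + 2 * i) * (j + 2 * i) by rewrite -expr2 sqr_ge0.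
have C : i * i <= 0 by nia.
have D : j * j <= 0 by nia.
by split; nia.
Qed.

Lemma hex_norm_eqD (i j : int) : i * i + i * j + j * j = i + j ->
  [\/ i = 0 /\ j = 0, i = 1 /\ j = 0 | i = 0 /\ j = 1].
Proof.
move=> H; have A : 0 <= (i + 2 * j - 1) * (i + 2 * j - 1) by rewrite -expr2 sqr_ge0.
have B : 0 <= (j + 2 * i - 1) * (j + 2 * i - 1) by rewrite -expr2 sqr_ge0.
have C : 3 * (i * i) <= 2 * i + 1 by nia.
have D : 3 * (j * j) <= 2 * j + 1 by nia.
have [i0|i1] : i = 0 \/ i = 1 by nia.
  have [j0|j1] : j = 0 \/ j = 1 by nia.
    by constructor 1.
  by constructor 3.
have [j0|j1] : j = 0 \/ j = 1 by nia.
  by constructor 2.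
by exfalso; rewrite i1 j1 in H; lia.
Qed.

Lemma hex_pos_origin (R : realType) : hex_pos R hex_origin = (0, 0).
Proof. by rewrite /hex_pos /= !mul0r !addr0. Qed.

Lemma sqr_enorm_hex_posB (R : realType) (u v : hex_vertex) :
  let i := v.1.1 - u.1.1 in let j := v.1.2 - u.1.2 in
  let s : int := (v.2 : nat)%:Z - (u.2 : nat)%:Z in
  3 * enorm (hex_pos R v - hex_pos R u) ^+ 2 =
  (3 * (i ^+ 2 + i * j + j ^+ 2 + s * (i + j)) + s ^+ 2)%:~R.
Proof.
case: u v => [[a b] s] [[a' b'] s'] /=.
rewrite /enorm sqr_sqrtr ?addr_ge0 ?sqr_ge0 //=.
set t := Num.sqrt 3; have t2 : t ^+ 2 = 3 by rewrite /t sqr_sqrtr.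
rewrite !(rmorphD, rmorphM, rmorphXn, rmorphB) /= -!pmulrn.
set x := a'%:~R; set y := a%:~R; set z := b'%:~R; set w := b%:~R.
set p := s'%:R; set q := s%:R.
have -> : (z * (t / 2) + p * (t / 6) - (w * (t / 2) + q * (t / 6))) ^+ 2
   = t ^+ 2 * (((z - w) / 2 + (p - q) / 6) ^+ 2) by field.
by rewrite t2; field.
Qed.

Lemma hex_adjP (R : realType) (u v : hex_vertex) :
  hex_adj u v <-> enorm (hex_pos R v - hex_pos R u) = Num.sqrt 3 / 3.
Proof.
have e : enorm (hex_pos R v - hex_pos R u) = Num.sqrt 3 / 3 <->
    3 * enorm (hex_pos R v - hex_pos R u) ^+ 2 = 1%:~R.
  have h : 3 * (Num.sqrt 3 / 3) ^+ 2 = 1%:~R :> R.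
    by rewrite expr_div_n sqr_sqrtr // mulr1z; field.
  split=> [->//|]; rewrite -h => /(mulfI _) h2; apply/eqP.
  rewrite -(@eqrXn2 _ 2) ?sqrtr_ge0 ?divr_ge0 ?sqrtr_ge0 //.
  by apply/eqP/h2.
rewrite e sqr_enorm_hex_posB; split=> [|/intr_inj]; rewrite /hex_adj.
  case: u v {e} => [[a b] []] [[a' b'] s'] /=; rewrite !inE !xpair_eqE => H;
  congr (_%:~R); case/or3P: H => /andP[/andP[/eqP -> /eqP ->] /eqP ->] /=; ring.
case: u v {e} => [[a b] s] [[a' b'] s'] /=; rewrite /in_mem /=.
have [i ->] : exists i, a' = a + i by exists (a' - a); ring.
have [j ->] : exists j, b' = b + j by exists (b' - b); ring.
have -> : a + i - a = i by ring.
have -> : b + j - b = j by ring.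
case: s s' => [] [] /= H; first by exfalso; lia.
- have K : i * i + i * j + j * j = i + j by move: H; rewrite !expr2; lia.
  by case: (hex_norm_eqD K) => -[-> ->]; rewrite /= !xpair_eqE ?addr0 !eqxx ?orbT.
- have K : - i * - i + - i * - j + - j * - j = - i + - j.
    by move: H; rewrite !expr2 !mulrNN; lia.
  have {}K := hex_norm_eqD K.
  have : [\/ i = 0 /\ j = 0, i = -1 /\ j = 0 | i = 0 /\ j = -1].
    by case: K => -[ie je]; [constructor 1|constructor 2|constructor 3]; lia.
  by case=> -[-> ->]; rewrite /= !xpair_eqE ?addr0 !eqxx ?orbT.
- by exfalso; lia.
Qed.

Lemma hex_pos_inj (R : realType) : injective (hex_pos R).
Proof.
move=> u v uv; have := sqr_enorm_hex_posB R u v.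
rewrite uv subrr /enorm /= !expr0n /= addr0 sqrtr0 expr0n /= mulr0.
move=> /esym/eqP; rewrite intr_eq0 => /eqP.
case: u v {uv} => [[a b] s] [[a' b'] s'] /=.
have [i ->] : exists i, a' = a + i by exists (a' - a); ring.
have [j ->] : exists j, b' = b + j by exists (b' - b); ring.
have -> : a + i - a = i by ring.
have -> : b + j - b = j by ring.
have K : i * i + i * j + j * j = 0 -> i = 0 /\ j = 0 by exact: hex_norm_eq0.
case: s s' => [] [] /=; rewrite !expr2 => H; try (exfalso; lia);
  by have [|-> ->] := K; [lia | rewrite !addr0].
Qed.

Lemma finite_hex_saw (n : nat) : finite_set (hex_saw (n := n)).
Proof.
have [s Hs] : exists s : seq (seq hex_vertex), forall p, size p = n ->
    path hex_adj hex_origin p -> p \in s.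
  elim: n hex_origin => [|n IH] x.
    by exists [:: [::]] => p /size0nil ->.
  have /choice [f Hf] := IH.
  exists (flatten [seq [seq y :: p | p <- f y] | y <- hex_nbrs x]).
  move=> [//|y p] /= [sp] /andP[xy yp]; apply/flatten_mapP.
  by exists y => //; apply/map_f/Hf.
apply: (@sub_finite_set _ _
  ((fun g : n.+1.-tuple hex_vertex => behead g) @^-1` [set` s]
   `&` [set g | thead g = hex_origin])).
  case/tupleP=> x g /=; rewrite /hex_saw /= theadE => /and3P[/eqP -> xg _].
  by split=> //; apply: Hs; rewrite ?size_tuple.
apply: (@sub_finite_set _ _ ((fun g : n.+1.-tuple hex_vertex => val g) @^-1`
   [set` [seq hex_origin :: p | p <- s]])).
  case/tupleP=> x g /= [gs]; rewrite theadE => ->.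
  exact: map_f.
apply: finite_preimage; last exact: finite_seq.
by move=> x y _ _; exact: val_inj.
Qed.

Lemma hex_saw_nonempty (n : nat) : hex_saw (n := n) !=set0.
Proof.
pose f (k : nat) : hex_vertex := (k./2%:Z, 0, odd k).
have fP k : hex_adj (f k) (f k.+1).
  rewrite /hex_adj /f /= uphalf_half.
  case: (odd k); rewrite !inE !xpair_eqE /=.
    by rewrite add1n -addn1 PoszD !eqxx !orbT.
  by rewrite add0n !eqxx.
have H m k : path hex_adj (f k) (map f (iota k.+1 m)).
  by elim: m k => [//|m IH] k; apply/andP; split; [exact: fP|exact: IH].
have sz : size (map f (iota 0 n.+1)) == n.+1 by rewrite size_map size_iota.
exists (Tuple sz); apply/and3P; split.
- by rewrite /thead (tnth_nth hex_origin).
- exact: H.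
- rewrite map_inj_uniq ?iota_uniq // => i j [ij o].
  by rewrite -(odd_double_half i) ij o odd_double_half.
Qed.

Lemma hex_saw_probT (R : realType) (n : nat) :
  hex_saw_prob R [set: n.+1.-tuple hex_vertex] = 1.
Proof.
rewrite /hex_saw_prob setIT divff // pnatr_eq0 cardfs_eq0.
apply/eqP => /(fset_set_set0 (finite_hex_saw _)) h.
by have [g] := hex_saw_nonempty n; rewrite h.
Qed.

(* Main.v *)
Require Import Defs.
From HB Require Import structures.
From mathcomp Require Import all_boot all_order all_algebra finmap.
From mathcomp Require Import all_classical all_reals all_analysis.
From mathcomp Require Import ring lra zify.

Set Implicit Arguments.
Unset Strict Implicit.
Unset Printing Implicit Defensive.

Import Order.TTheory GRing.Theory Num.Theory.

Local Open Scope ring_scope.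

(** Let x = 1 / (2 cos (pi / 8)).  There are at least a constant times x ^ -n self-avoiding
    walks of length n ([saws_ge1]), so it suffices to bound the generating function at the
    fugacity x of the walks that go far.

    Bridges are rare.  For walks that start on the base of a truncated triangle, the
    parafermionic observable of Duminil-Copin and Smirnov yields two linear relations between
    the weights of the walks that leave through the base, the left side, the right side and
    the top ([dom_identities]).  They hold because the walks that close a loop cancel in
    pairs, the two orientations of a loop having windings that differ by a fixed amount
    ([wind_loop], which rests on a discrete form of the theorem of Hopf on the turning of
    tangents, [hw_wind]), while the winding at an exit depends only on the side, and for the
    base on its half ([exits_wind]).  Let [esc d] be the weight of the walks that leave a
    symmetric triangle of size d other than through its base.  Unless [esc] is smaller at the
    size 2 D than at d by a fixed factor, in every domain with its left corner at distance d
    and its right corner at a distance between D and 2 D the walks lean to the right, and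
    leave through the right side with a weight of the order of [esc d] ([esc_step]).  Reversed
    and rotated, these exits through parallel sides become exits from triangles whose left
    corners are at the distances b = 0, ..., 2 d, so their total weight is, up to a factor, at
    most the sum of the [esc b] ([sum_exR], [exL_le_esc]).  This recursion gives
    [esc (1000 ^ j)] at most (9 / 10) ^ j ([esc_decay]), and the same bound for the walks that
    cross a strip of 3 * 1000 ^ j rows ([gf_crossup_decay]).

    Far walks pay for crossing strips.  Cut a walk of length n along parallel lines k rows
    apart, with the offset that minimizes the number of cuts; there are at most n / k of them
    ([exists_offset]).  A piece that crosses its strip has weight at most (9 / 10) ^ j, a
    piece that returns to the line where it started at most 3 ([gf_arcdown]), and the first
    and the last piece at most the weight of all walks in a strip, which by the argument of
    Hammersley and Welsh is at most exponential in k ([gf_instrip]).  A walk that gets J + 1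
    strips away crosses at least J strips, so that the walks that go this far have weight at
    most k 2 Q ^ 2 5 ^ (n / k) (9 / 10) ^ (j J), where Q = 60 * 2 ^ k ([far_bound]).

    Finally k = 3 * 1000 ^ j is chosen of the order of the cube root of n, so that k is at
    most a constant times A = n / k, and A is of the order of n ^ (2 / 3).  A distance of
    10 ^ 11 n / log (n + 1) makes j J larger than 20000 A ([steps_bound]), which beats the
    other factors ([exp_bounds]).  If log (n + 1) < 10 ^ 11, then no walk goes this far
    ([prob_far0]). *)

(** * Eisenstein integers *)

(** The pair [(x, y)] stands for x + y zeta, where zeta = exp (i pi / 3).  The alias keeps
    its ring structure apart from the componentwise one of [int * int]. *)
Definition eis : Type := (int * int)%type.

HB.instance Definition _ := GRing.Zmodule.copy eis (int * int)%type.

Definition eis_mul (p q : eis) : eis :=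
  (p.1 * q.1 - p.2 * q.2, p.1 * q.2 + p.2 * q.1 + p.2 * q.2).

Lemma eis_addE (p q : eis) : p + q = (p.1 + q.1, p.2 + q.2).
Proof. by []. Qed.

Lemma eis_oppE (p : eis) : - p = (- p.1, - p.2).
Proof. by []. Qed.

Fact eis_mulA : associative eis_mul.
Proof. by move=> [a b] [c d] [e f]; congr pair => /=; ring. Qed.

Fact eis_mulC : commutative eis_mul.
Proof. by move=> [a b] [c d]; congr pair => /=; ring. Qed.

Fact eis_mul1 : left_id ((1, 0) : eis) eis_mul.
Proof. by move=> [a b]; congr pair => /=; ring. Qed.

Fact eis_mulD : left_distributive eis_mul +%R.
Proof. by move=> [a b] [c d] [e f]; congr pair => /=; ring. Qed.

Fact eis_one_neq0 : ((1, 0) : eis) != 0.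
Proof. by []. Qed.

HB.instance Definition _ := GRing.Zmodule_isComNzRing.Build eis
  eis_mulA eis_mulC eis_mul1 eis_mulD eis_one_neq0.

Lemma eis_mulE (p q : eis) :
  p * q = (p.1 * q.1 - p.2 * q.2, p.1 * q.2 + p.2 * q.1 + p.2 * q.2).
Proof. by []. Qed.

Lemma eis_zeroE : 0 = (0, 0) :> eis. Proof. by []. Qed.

(** A left turn multiplies the heading by zeta, a right turn by its inverse. *)
Definition turn (b : bool) : eis := if b then (0, 1) else (1, -1).

Definition sgnb (b : bool) : int := if b then 1 else -1.

Definition unitv (k : int) : eis :=
  match `|(k %% 6)%Z|%N with
  | 0 => (1, 0) | 1 => (0, 1) | 2 => (-1, 1) | 3 => (-1, 0) | 4 => (0, -1)
  | _ => (1, -1)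
  end.

Lemma mod6P (k : int) : exists m, exists2 i : int, k = 6 * m + i &
  i \in [:: 0; 1; 2; 3; 4; 5].
Proof.
exists (k %/ 6)%Z; exists (k %% 6)%Z; first by rewrite mulrC -divz_eq.
have := modz_ge0 k (isT : 6 != 0 :> int); have := ltz_pmod k (isT : 0 < 6 :> int).
by rewrite !inE; lia.
Qed.

Lemma unitvD6 (m k : int) : unitv (6 * m + k) = unitv k.
Proof. by rewrite /unitv mulrC modzMDl. Qed.

Lemma unitv_turn (k : int) b : unitv (k + sgnb b) = turn b * unitv k.
Proof.
have [m [i -> Hi]] := mod6P k; rewrite -addrA !unitvD6.
by move: Hi; rewrite !inE => /or4P[|||/or3P[]] /eqP ->; case: b.
Qed.

(** * Walks as sequences of turns *)

(** A walk is encoded by its turns, the most recent first: it comes from -1 to the vertex 0 with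
    heading 1, and every turn is followed by a step.  Since no step goes straight on or back,
    the walk stays on one hexagonal lattice.  [wind h] counts the turns with signs, [pos h] is
    the end point, [dir h] the last step, and [vis h] lists the vertices before the end point,
    so that a walk with turns [h] is self-avoiding up to its end point if [vis h] is
    duplicate-free. *)
Fixpoint wind (h : seq bool) : int := if h is b :: h' then wind h' + sgnb b else 0.

Fixpoint dir (h : seq bool) : eis := if h is b :: h' then turn b * dir h' else 1.

Fixpoint pos (h : seq bool) : eis := if h is b :: h' then pos h' + dir h else 0.

Fixpoint vis (h : seq bool) : seq eis := if h is b :: h' then pos h' :: vis h' else [::].

Lemma dir_wind h : dir h = unitv (wind h).
Proof. by elim: h => //= b h ->; rewrite unitv_turn. Qed.

Lemma size_vis h : size (vis h) = size h.
Proof. by elim: h => //= b h ->. Qed.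

Lemma dir_cat l g : dir (l ++ g) = dir l * dir g.
Proof. by elim: l => [|b l /= ->]; rewrite ?mul1r // mulrA. Qed.

Lemma pos_cat l g : pos (l ++ g) = pos g + dir g * pos l.
Proof.
elim: l => [|b l IH] /=; first by rewrite mulr0 addr0.
by rewrite IH dir_cat; ring.
Qed.

Lemma vis_cat l g :
  vis (l ++ g) = [seq pos g + dir g * z | z <- vis l] ++ vis g.
Proof. by elim: l => //= b l ->; rewrite pos_cat. Qed.

(** Twice the coordinates in the directions 1, zeta and zeta ^ -1: the height above the base
    of a triangle and the distances towards its left and right sides. *)
Definition ht (p : eis) : int := 2 * p.1 + p.2.
Definition nl (p : eis) : int := p.1 + 2 * p.2.
Definition nr (p : eis) : int := p.1 - p.2.

(** The turns of the reversed walk. *)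
Definition rv (h : seq bool) : seq bool := rev (map negb h).

Lemma rvK : involutive rv.
Proof. by move=> h; rewrite /rv map_rev revK -map_comp map_id_in // => b _ /=; rewrite negbK. Qed.

Lemma size_rv h : size (rv h) = size h.
Proof. by rewrite size_rev size_map. Qed.

Lemma rv_cons b h : rv (b :: h) = rv h ++ [:: ~~ b].
Proof. by rewrite /rv /= rev_cons cats1. Qed.

Lemma turnV b : turn b * turn (~~ b) = 1.
Proof. by case: b. Qed.

Lemma dir_rv h : dir (rv h) * dir h = 1.
Proof.
elim: h => //= b h IH; rewrite rv_cons dir_cat /=.
have := turnV b; move: IH => /= H1 H2.
rewrite (_ : _ * _ = (dir (rv h) * dir h) * (turn b * turn (~~ b))); last by ring.
by rewrite H1 H2 mulr1.
Qed.

(** The isometry that carries the reversed walk, in its own frame, back onto [h]. *)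
Definition rvmap (h : seq bool) (z : eis) : eis := pos h - dir h - dir h * z.

Lemma rvmap_cons b h z : rvmap (b :: h) (turn (~~ b) + turn (~~ b) * z) = rvmap h z.
Proof.
rewrite /rvmap /=; have := turnV b; move: (turn b) (turn (~~ b)) => u v H.
transitivity (pos h - (u * v) * dir h - (u * v) * dir h * z); first by ring.
by rewrite H !mul1r.
Qed.

Lemma rvmap_pos h : rvmap h (pos (rv h)) = -1.
Proof.
elim: h => [|b h IH]; first by rewrite /rvmap /=; ring.
by rewrite rv_cons pos_cat /= add0r mulr1 rvmap_cons.
Qed.

Lemma rvmap_vis h : [seq rvmap h z | z <- vis (rv h)] = rev (vis h).
Proof.
elim: h => // b h IH; rewrite rv_cons vis_cat map_cat -map_comp /= add0r.
rewrite rev_cons -IH -cats1; congr (_ ++ _); last first.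
  by rewrite /rvmap /=; congr [:: _]; ring.
by apply: eq_map => z /=; rewrite mulr1 rvmap_cons.
Qed.

Lemma rvmap_inj h : injective (rvmap h).
Proof.
move=> y z /(congr1 (fun p => dir (rv h) * (pos h - dir h - p))).
rewrite /rvmap; set A := pos h - dir h; have := dir_rv h.
move: (dir (rv h)) (dir h) => u v H E.
have X t : u * (A - (A - v * t)) = u * v * t by ring.
by move: E; rewrite !X H !mul1r.
Qed.

Lemma uniq_vis_rv h : uniq (vis (rv h)) = uniq (vis h).
Proof. by rewrite -(map_inj_uniq (@rvmap_inj h)) rvmap_vis rev_uniq. Qed.

(** * Half-turns of a direction *)

(** The directions are divided into two halves by a cut perpendicular to the heading 1; of the two
    horizontal directions, the one with positive second coordinate counts as up. *)
Definition up (u : eis) : bool := (0 < ht u) || (ht u == 0) && (0 < u.2).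

Definition cr (u w : eis) : int := u.1 * w.2 - u.2 * w.1.

(** The half-turns, counted with signs, of a direction that moves from [u] to [w] by less than
    half a turn. *)
Definition hturn (u w : eis) : int :=
  if up u == up w then 0 else if 0 < cr u w then 1 else -1.

Lemma hturnN (u w : eis) : u != 0 -> w != 0 -> hturn (- u) (- w) = hturn u w.
Proof.
have upN z : z != 0 -> up (- z) = ~~ up z.
  by case: z => x y; rewrite /up /ht eis_oppE eis_zeroE xpair_eqE /=; lia.
have crN : cr (- u) (- w) = cr u w by rewrite /cr !eis_oppE /=; ring.
move=> u0 w0; rewrite /hturn !upN // crN.
by case: (up u); case: (up w).
Qed.

Definition unit6 (e : eis) := e \in [:: (1, 0); (0, 1); (-1, 1); (-1, 0); (0, -1); (1, -1)].

(** Within a half-plane that contains only one of the two horizontal directions, [hturn] is the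
    difference of the values of [dn] or of [- dn]. *)
Definition dn (u : eis) : int := if up u then 0 else 1.

Lemma hturn_left (u f : eis) : unit6 f -> 0 < u.2 -> 0 < (u + f).2 ->
  hturn u (u + f) = dn (u + f) - dn u.
Proof.
case: u => x y; rewrite /hturn /dn /up /cr /ht !eis_addE /unit6 !inE.
case/or4P=> [|||/or3P[]] /eqP -> /= H1 H2.
all: case: (boolP (_ || _)) => Ea; case: (boolP (_ || _)) => Eb => //=.
all: case: ifP => ?; lia.
Qed.

Lemma hturn_right (u f : eis) : unit6 f -> u.2 < 0 -> (u + f).2 < 0 ->
  hturn u (u + f) = dn u - dn (u + f).
Proof.
case: u => x y; rewrite /hturn /dn /up /cr /ht !eis_addE /unit6 !inE.
case/or4P=> [|||/or3P[]] /eqP -> /= H1 H2.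
all: case: (boolP (_ || _)) => Ea; case: (boolP (_ || _)) => Eb => //=.
all: case: ifP => ?; lia.
Qed.

Definition units : seq eis := [:: (1, 0); (0, 1); (-1, 1); (-1, 0); (0, -1); (1, -1)].

Definition cell_ok (u e f : eis) : bool :=
  [&& u != 0, u + f != 0, u - e != 0 & u - e + f != 0] ==>
  (hturn u (u + f) + hturn (u + f) (u - e + f) == hturn u (u - e) + hturn (u - e) (u - e + f)).

(** The vectors close to the origin; farther out a half-plane contains the whole cell. *)
Lemma cell_small : all (fun x : int => all (fun y : int => all (fun e => all (cell_ok (x, y) e) units) units)
   [:: -2; -1; 0; 1; 2]) [:: -3; -2; -1; 0; 1; 2; 3].
Proof. by vm_compute. Qed.

Lemma unit6_bnd e : unit6 e -> [/\ -1 <= e.2, e.2 <= 1, -2 <= ht e & ht e <= 2].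
Proof. by rewrite /unit6 /ht !inE; case/or4P=> [|||/or3P[]] /eqP ->. Qed.

Lemma unit6N e : unit6 e -> unit6 (- e).
Proof. by rewrite /unit6 !inE; case/or4P=> [|||/or3P[]] /eqP ->. Qed.

Lemma htD p q : ht (p + q) = ht p + ht q.
Proof. by rewrite /ht eis_addE /=; ring. Qed.

Lemma htN p : ht (- p) = - ht p.
Proof. by rewrite /ht eis_oppE /=; ring. Qed.

Lemma up_pos p : 0 < ht p -> up p.
Proof. by rewrite /up => ->. Qed.

Lemma up_neg p : ht p < 0 -> up p = false.
Proof. by rewrite /up; lia. Qed.

(** The direction of the difference of two points that move by unit steps makes no half-turn
    around a cell, provided that the difference vanishes at no corner. *)
Lemma hturn_cell (u e f : eis) : unit6 e -> unit6 f ->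
  u != 0 -> u + f != 0 -> u - e != 0 -> u - e + f != 0 ->
  hturn u (u + f) + hturn (u + f) (u - e + f) = hturn u (u - e) + hturn (u - e) (u - e + f).
Proof.
move=> ue uf u0 u1 u2 u3.
have [e1 e2 e3 e4] := unit6_bnd ue; have [f1 f2 f3 f4] := unit6_bnd uf.
have [big|sml] := ltP 4 `|ht u|.
  have [pos_u|neg_u] := leP 0 (ht u).
    by rewrite /hturn !up_pos // ?htD ?htN; lia.
  by rewrite /hturn !up_neg // ?htD ?htN; lia.
have uE : u - e + f = u + f - e by rewrite addrAC.
have [y3|y3] := ltP 2 u.2.
  have a1 : 0 < u.2 by lia.
  have a2 : 0 < (u + f).2 by rewrite eis_addE /=; lia.
  have a3 : 0 < (u - e).2 by rewrite eis_addE eis_oppE /=; lia.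
  have a4 : 0 < (u - e + f).2 by rewrite !eis_addE eis_oppE /=; lia.
  have E2 := @hturn_left (u + f) (- e) (unit6N ue); rewrite -uE in E2.
  by rewrite (@hturn_left u f) // E2 // (@hturn_left u (- e)) ?unit6N // (@hturn_left (u - e) f) //; ring.
have [y4|y4] := ltP u.2 (-2).
  have a1 : u.2 < 0 by lia.
  have a2 : (u + f).2 < 0 by rewrite eis_addE /=; lia.
  have a3 : (u - e).2 < 0 by rewrite eis_addE eis_oppE /=; lia.
  have a4 : (u - e + f).2 < 0 by rewrite !eis_addE eis_oppE /=; lia.
  have E2 := @hturn_right (u + f) (- e) (unit6N ue); rewrite -uE in E2.
  by rewrite (@hturn_right u f) // E2 // (@hturn_right u (- e)) ?unit6N // (@hturn_right (u - e) f) //; ring.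
have := cell_small; case: u sml y3 y4 u0 u1 u2 u3 {uE} => x y sml y3 y4 u0 u1 u2 u3.
have xin : x \in ([:: -3; -2; -1; 0; 1; 2; 3] : seq int).
  by move: sml y3 y4; rewrite /ht /= !inE; lia.
have yin : y \in ([:: -2; -1; 0; 1; 2] : seq int).
  by move: sml y3 y4; rewrite /ht /= !inE; lia.
move=> /allP/(_ _ xin)/allP/(_ _ yin)/allP/(_ _ ue)/allP/(_ _ uf).
by rewrite /cell_ok u0 u1 u2 u3 /= => /eqP.
Qed.

(** * The winding of a self-avoiding walk *)

(** The half-turns of the direction in which [p] sees a point that runs through [L], the last
    element of [L] first. *)
Fixpoint sweep (p : eis) (L : seq eis) : int :=
  if L is q :: L1 then
    (if L1 is q0 :: _ then hturn (q0 - p) (q - p) else 0) + sweep p L1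
  else 0.

Arguments sweep : simpl never.

Lemma sweep_cons p q q0 L :
  sweep p (q :: q0 :: L) = hturn (q0 - p) (q - p) + sweep p (q0 :: L).
Proof. by []. Qed.

Lemma sweep1 p q : sweep p [:: q] = 0.
Proof. by []. Qed.

Definition linked (L : seq eis) := sorted (fun a b => unit6 (a - b)) L.

Lemma unit6_unitv k : unit6 (unitv k).
Proof.
have [m [i -> Hi]] := mod6P k; rewrite unitvD6.
by move: Hi; rewrite !inE => /or4P[|||/or3P[]] /eqP ->.
Qed.

Lemma unit6_dir h : unit6 (dir h).
Proof. by rewrite dir_wind unit6_unitv. Qed.

(** Moving the observer by a unit step changes the count only at the two ends of the path. *)
Lemma sweep_edge w w' q L : unit6 (w' - w) -> linked (q :: L) ->
  w \notin q :: L -> w' \notin q :: L ->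
  sweep w' (q :: L) = sweep w (q :: L) + hturn (q - w) (q - w')
     - hturn (last q L - w) (last q L - w').
Proof.
move=> uw; elim: L q => [|q0 L IH] q; first by rewrite !sweep1 /= => _ _ _; ring.
rewrite !sweep_cons [last _ _]/= => /andP[uq lL]; rewrite !inE !negb_or => /and3P[n1 n2 n3] /and3P[n4 n5 n6].
rewrite IH ?inE ?negb_or ?n2 ?n5 //.
have := @hturn_cell (q0 - w) (w' - w) (q - q0) uw uq.
rewrite (_ : q0 - w + (q - q0) = q - w); last by ring.
rewrite (_ : q0 - w - (w' - w) = q0 - w'); last by ring.
rewrite (_ : q0 - w' + (q - q0) = q - w'); last by ring.
rewrite !subr_eq0 ![_ == w]eq_sym ![_ == w']eq_sym => /(_ n2 n1 n5 n4).
move: (hturn _ _) (hturn _ _) (hturn (q0 - w) _) (hturn (q0 - w') _) => a b c d.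
move=> H. lia.
Qed.

(** The half-turns of a heading that starts in the direction 1 and makes [k] sixths of a turn. *)
Definition hw (k : int) : int := ((k + 1) %/ 3)%Z.

Lemma hwD6 m k : hw (6 * m + k) = 2 * m + hw k.
Proof. by rewrite /hw; lia. Qed.

(** The direction u + u' interpolates between two consecutive steps u and u'. *)
Lemma hturn_turn k b :
  hturn (unitv k) (unitv k + unitv (k + sgnb b)) +
  hturn (unitv k + unitv (k + sgnb b)) (unitv (k + sgnb b)) = hw (k + sgnb b) - hw k.
Proof.
have [m [i -> Hi]] := mod6P k; rewrite -!addrA !unitvD6 !hwD6.
rewrite opprD [RHS]addrACA subrr add0r.
by move: Hi; rewrite !inE => /or4P[|||/or3P[]] /eqP ->; case: b.
Qed.

(** All vertices of the walk, the starting point -1 included. *)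
Definition trail (h : seq bool) := pos h :: vis h ++ [:: -1].

Lemma trail_cons b h : trail (b :: h) = pos (b :: h) :: trail h.
Proof. by []. Qed.

Lemma vis_prev h : vis h ++ [:: -1] = (pos h - dir h) :: behead (vis h ++ [:: -1]).
Proof. by case: h => [|b h] /=; rewrite ?sub0r // addrK. Qed.

Lemma linked_trail h : linked (trail h).
Proof.
elim: h => [|b h IH]; first by [].
rewrite trail_cons /linked /= -/(trail h); apply/andP; split; last exact: IH.
by rewrite addrC addKr; exact: (unit6_dir (b :: h)).
Qed.

Lemma linked_vis h : linked (vis h ++ [:: -1]).
Proof. by have := linked_trail h; rewrite /linked => /path_sorted. Qed.

Lemma unit6_neq0 e : unit6 e -> e != 0.
Proof. by rewrite /unit6 !inE; case/or4P=> [|||/or3P[]] /eqP ->. Qed.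

(** The direction from an earlier to a later vertex is defined on the triangle of pairs of
    times, and on each cell of this triangle [hturn_cell] holds.  Along the diagonal the
    direction follows the heading, along the other two sides it is seen from the first and from
    the last vertex.  Each new vertex adds one row of cells to the triangle. *)
Lemma hw_wind h : uniq (trail h) ->
  hw (wind h) = sweep (-1) (pos h :: vis h) + sweep (pos h) (vis h ++ [:: -1]).
Proof.
elim: h => [|b h IH] //; rewrite trail_cons cons_uniq => /andP[nw ut].
have {}IH := IH ut.
have Hd : unit6 (dir h) := unit6_dir h.
have Hd' : unit6 (dir (b :: h)) := unit6_dir (b :: h).
have ht' := hturn_turn (wind h) b.
move: ut; rewrite [trail h]/trail cons_uniq => /andP[nw0 _].
move: (nw); rewrite [trail h]/trail inE negb_or => /andP[nw1 nw2].
have lv := linked_vis h.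
rewrite [vis (b :: h)]/= cat_cons.
set w := pos h in IH nw0 nw1 nw *; set w' := pos (b :: h) in nw nw1 nw2 *.
have w'E : w' = w + dir (b :: h) by [].
have uw : unit6 (w' - w) by rewrite w'E addrC addKr.
set R := vis h ++ [:: -1] in IH nw0 nw2 lv *.
have RE : R = (w - dir h) :: behead R by exact: vis_prev.
rewrite sweep_cons {1}RE sweep_cons -RE.
have := @sweep_edge w w' (w - dir h) (behead R) uw; rewrite -RE => ->//.
have -> : last (w - dir h) (behead R) = -1.
  by have := congr1 (last w) RE; rewrite /= => <-; rewrite /R last_cat.
rewrite opprK.
have -> : sweep (-1) (pos h :: vis h) = hw (wind h) - sweep w R by rewrite IH addrK.
have -> : w - dir h - w' = - (dir h + dir (b :: h)) by rewrite w'E; ring.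
have -> : w - w' = - dir (b :: h) by rewrite w'E; ring.
have -> : w - dir h - w = - dir h by ring.
have s0 : dir h + dir (b :: h) != 0.
  rewrite !dir_wind /=; have [m [i -> Hi]] := mod6P (wind h); rewrite -addrA !unitvD6.
  by move: (Hi); rewrite !inE => /or4P[|||/or3P[]] /eqP ->; case: (b).
rewrite !hturnN ?s0 ?unit6_neq0 //.
have -> : -1 - w = - (w + 1) by ring.
have -> : -1 - w' = - (w' + 1) by ring.
have a1 : w + 1 != 0.
  rewrite addr_eq0; apply: contra nw0 => /eqP ->; by rewrite mem_cat inE eqxx orbT.
have a2 : w' + 1 != 0.
  rewrite addr_eq0; apply: contra nw2 => /eqP ->; by rewrite mem_cat inE eqxx orbT.
rewrite hturnN //.
have wE : wind h + sgnb b = wind (b :: h) by [].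
move: ht'; rewrite wE -!dir_wind => ht'.
by rewrite -[LHS](subrK (hw (wind h))) -ht'; ring.
Qed.

(** * The winding of a loop *)

Lemma sweep_cat p y A x B :
  sweep p (y :: A ++ x :: B) =
  sweep p (y :: A) + hturn (x - p) (last y A - p) + sweep p (x :: B).
Proof.
elim: A y => [|z A IH] y; first by rewrite /= sweep_cons sweep1 add0r.
by rewrite /= !sweep_cons -cat_cons IH !addrA.
Qed.

Lemma sweep_up p L : all (fun q => 0 < ht (q - p)) L -> sweep p L = 0.
Proof.
elim: L => [|y [|z L] IH] //; rewrite sweep_cons => H.
have /= /andP[h1 /andP[h2 _]] := H.
rewrite IH; last by have /= /andP[_] := H.
by rewrite addr0 /hturn !up_pos.
Qed.

(** The directions between the points of two disjoint paths make no half-turn around the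
    rectangle of pairs of times. *)
Lemma sweep_tail t T y Q : linked (t :: T) -> linked (y :: Q) ->
  (forall z, z \in t :: T -> z \notin y :: Q) ->
  sweep t (y :: Q) - sweep (last t T) (y :: Q) =
  sweep y (t :: T) - sweep (last y Q) (t :: T).
Proof.
elim: T t => [|t0 T IH] t; first by rewrite !sweep1 /=; move=> *; ring.
move=> /[dup] /path_sorted lT /=/andP[ut _] lQ dj.
have n0 : t0 \notin y :: Q by apply: dj; rewrite !inE eqxx orbT.
have n1 : t \notin y :: Q by apply: dj; rewrite !inE eqxx.
have := IH t0 lT lQ; rewrite !sweep_cons => H.
rewrite (sweep_edge ut lQ n0 n1) /=.
have {}H := H (fun z hz => dj z (mem_behead (s := t :: t0 :: T) hz)).
have nz a z : z \in y :: Q -> a \notin y :: Q -> z - a != 0.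
  by move=> hz; apply: contra; rewrite subr_eq0 => /eqP <-.
have ly : last y Q \in y :: Q by exact: mem_last.
have yy : y \in y :: Q by exact: mem_head.
rewrite -(@hturnN (t0 - y)) -?[t0 - y]opprB -?[t - y]opprB ?oppr_eq0 ?nz //.
rewrite -(@hturnN (t0 - last y Q)) -?[t0 - last y Q]opprB -?[t - last y Q]opprB ?oppr_eq0 ?nz //.
rewrite !opprK; move: H; set A := sweep t0 _; set B := sweep (last _ _) _.
set C := sweep y _; set D := sweep _ _ => H.
rewrite -[A in LHS](subrK B) H; ring.
Qed.

(** The lattice is bipartite, with the two kinds of vertices in rows of different heights modulo 3
    and headings of different parity. *)
Lemma ht_mod h : exists m, ht (pos h) = 3 * m + (wind h %% 2)%Z.
Proof.
elim: h => [|b h [m IH]]; first by exists 0.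
rewrite [pos _]/= htD IH -/(dir (b :: h)) dir_wind [wind (b :: h)]/=.
have [k [i -> Hi]] := mod6P (wind h).
rewrite -(addrA (6 * k)) unitvD6; move: Hi; rewrite !inE.
case/or4P=> [|||/or3P[]] /eqP ->; case: b; rewrite /unitv /sgnb /ht /=.
all: first [by exists m; lia | by exists (m + 1); lia | by exists (m - 1); lia ].
Qed.

Lemma hw_unitv_inj i j : unitv i = unitv j -> hw i = hw j -> i = j.
Proof.
have [m [a -> Ha]] := mod6P i; have [n [b -> Hb]] := mod6P j.
rewrite !unitvD6 !hwD6; move: Ha Hb; rewrite !inE.
case/or4P=> [|||/or3P[]] /eqP ->; case/or4P=> [|||/or3P[]] /eqP -> //= _;
rewrite /hw; lia.
Qed.

Lemma htM1 : ht (-1) = -2. Proof. by []. Qed.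

Lemma notin_vis_M1 L : all (fun z => 0 <= ht z) L -> -1 \notin L.
Proof. by move=> /allP H; apply/negP => /H. Qed.

Lemma pos_cons b h : pos (b :: h) = pos h + dir (b :: h).
Proof. by []. Qed.

Lemma turn_cases e0 e : (exists k m, e0 = unitv k /\ e = unitv (k + 2 * m)) ->
  [\/ e = e0, e = - (turn true * e0) | e = - (turn false * e0)].
Proof.
case=> k [m [-> ->]]; have [i [a -> Ha]] := mod6P k; have [j [b Eb Hb]] := mod6P (2 * m).
have {}Hb : b \in [:: 0; 2; 4].
  by move: Hb; rewrite !inE; lia.
rewrite Eb (_ : 6 * i + a + _ = 6 * i + (6 * j + (a + b))); last by ring.
rewrite !unitvD6; move: Ha Hb; rewrite !inE.
case/or4P=> [|||/or3P[]] /eqP ->; case/or3P=> /eqP ->;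
  first [by constructor 1 | by constructor 2 | by constructor 3].
Qed.

(** The three edges at a vertex make angles of 120 degrees, so a walk that returns to a
    vertex arrives along one of its three edges. *)
Lemma third_neighbour h g : pos h = pos g ->
  [\/ dir h = dir g, dir h = - (turn true * dir g) | dir h = - (turn false * dir g)].
Proof.
move=> E; apply: turn_cases; have [m Em] := ht_mod h; have [n En] := ht_mod g.
exists (wind g), ((wind h - wind g) %/ 2)%Z; rewrite !dir_wind; split=> //.
by congr unitv; rewrite E in Em; lia.
Qed.

(** The half-turns in the last corner of a loop, compared with the way from the first to the
    second edge of the corner through their sum. *)
Lemma turn_balance k b (A := unitv k) (B := unitv (k + sgnb b)) :
  hturn A (A + B) + hturn (A + B) B + hturn (- (A + B)) (- A) = hturn (- (A + B)) (- B).
Proof.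
rewrite {}/B {}/A; have [m [i -> Hi]] := mod6P k; rewrite -!addrA !unitvD6.
by move: Hi; rewrite !inE => /or4P[|||/or3P[]] /eqP ->; case: b.
Qed.

(** The half-turns along the sides of the triangle of pairs of times for a loop, at the vertex
    where the loop meets its tail. *)
Lemma loop_balance k b (e := unitv k) (f := turn b * e) (f' := turn (~~ b) * e) :
  hw (k - 4 * sgnb b) = hw k + 2 * (hturn (- e - f') (- f') + hturn (- e) (- e - f'))
    - (hturn (- e - f) (- f) + hturn (- e) (- e - f)) - hturn f (f - f') + hturn (- f') (f - f').
Proof.
rewrite {}/f {}/f' {}/e; have [m [i -> Hi]] := mod6P k; rewrite -addrA !unitvD6 !hwD6.
by move: Hi; rewrite !inE => /or4P[|||/or3P[]] /eqP ->; case: b; rewrite -!addrA; congr (_ + _).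
Qed.

Lemma unitv_loop k b : - (turn (~~ b) * unitv k) = unitv (k - 4 * sgnb b).
Proof.
have [m [i -> Hi]] := mod6P k; rewrite -addrA !unitvD6.
by move: Hi; rewrite !inE => /or4P[|||/or3P[]] /eqP ->; case: b.
Qed.

Lemma hturn_dn u w : ht u < 0 -> ht w < 0 -> hturn u w = 0.
Proof. by move=> h1 h2; rewrite /hturn !up_neg. Qed.

(** The tail comes from the boundary of a half-plane that contains the walk, so it lies outside
    of the loop.  Hence a loop that begins with a left turn runs clockwise and one that begins
    with a right turn runs counterclockwise.  The proof compares [hw_wind] for the tail and for
    the whole walk: points of the tail and of the loop are disjoint, so [sweep_tail] relates the
    views of the tail from the two ends of the loop. *)
Lemma wind_loop l b g : uniq (vis (l ++ b :: g)) ->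
  all (fun z => 0 <= ht z) (vis (l ++ b :: g)) -> pos (l ++ b :: g) = pos g ->
  wind (l ++ b :: g) = wind g - 4 * sgnb b /\
  dir (l ++ b :: g) = - (turn (~~ b) * dir g).
Proof.
set v := pos g; have vP : v = pos g by [].
case: l => [|c l']; first by
  rewrite /= -/v => _ _ /(canRL (addKr _)); rewrite addNr => E;
  have := unit6_neq0 (unit6_dir (b :: g)); rewrite /= E eqxx.
rewrite cat_cons; set h0 := l' ++ b :: g; set h := c :: h0 => uh ah hv.
have M1 : -1 \notin vis h by exact: notin_vis_M1.
have uh0 : uniq (trail h0).
  by rewrite /trail -cat_cons cats1 rcons_uniq; apply/andP; split.
set q := pos (b :: g); set e := dir g.
have qE : q = v + turn b * e by [].
have [a [Q [QE lQ]]] : exists a Q, vis h0 = a :: Q ++ v :: vis g /\ last a Q = q.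
  rewrite /h0; case: (l') @h0 @h uh ah hv {M1 uh0} => [|c' l1] /=.
    move=> _ _ /eqP; rewrite -/v -!addrA -[X in _ == X]addr0 (inj_eq (addrI _)).
    rewrite -{1}(mul1r (turn b * dir g)) -mulrDl dir_wind.
    have [k [i -> Hi]] := mod6P (wind g); rewrite unitvD6; move: Hi; rewrite !inE.
    by case/or4P=> [|||/or3P[]] /eqP ->; case: (b); case: (c).
  move=> _ _ _; rewrite vis_cat /=; eexists; eexists; split.
    by rewrite -/v -[v :: vis g]/(vis (b :: g)); reflexivity.
  elim: l1 => [|c1 l1 IH] /=; first by [].
  by rewrite -IH (pos_cat l1 (b :: g)).
set r := pos h0.
have thE : trail h0 = r :: a :: Q ++ v :: vis g ++ [:: -1].
  by rewrite /trail QE /= -catA.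
set R := vis g ++ [:: -1] in thE.
have [T [TE lT]] : exists T, R = (v - e) :: T /\ last (v - e) T = -1.
  exists (behead R); split; first exact: vis_prev.
  by have := congr1 (last v) (vis_prev g); rewrite /= last_cat /= => <-.
set p := v - e in TE lT.
have rE : r = v - dir h by rewrite -hv /h pos_cons addrK.
have rq : r != q.
  have := uh0; rewrite thE /= -lQ => /andP[/negP H _]; apply/eqP => E; apply: H.
  by rewrite E -cat_cons mem_cat mem_last.
have rp : r != p.
  have := uh0; rewrite thE TE /= => /andP[/negP H _]; apply/eqP => E; apply: H.
  by rewrite E inE mem_cat !inE eqxx !orbT.
(* The edges to the tail and to the first vertex of the loop are taken. *)
have dE : dir h = - (turn (~~ b) * e).
  have := third_neighbour hv; rewrite -/e => -[] E.
  - by move: rp; rewrite rE E eqxx.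
  - by case: (b) qE rq => // qE /eqP []; rewrite rE E qE opprK.
  - by case: (b) qE rq => // qE /eqP []; rewrite rE E qE opprK.
have zr : all (fun z => 0 < ht (z - -1)) (r :: vis h0).
  apply/allP => z; rewrite -[_ :: _]/(vis h) => /(allP ah) zh.
  by rewrite htD htN htM1; lia.
have vh0 : sweep (-1) (r :: vis h0) = 0 by exact: sweep_up.
have ut : forall z, z \in v :: R -> z \notin [:: r, a & Q].
  move=> z zR; apply/negP => zQ; have := uh0; rewrite thE -!cat_cons cat_uniq.
  by case/and3P=> _ /hasP H _; apply: H; exists z.
have vE : sweep v R = hw (wind g).
  have ug : uniq (trail g).
    by have := uh0; rewrite thE -!cat_cons cat_uniq => /and3P[].
  rewrite (hw_wind ug) [X in _ = X + _]sweep_up ?add0r //.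
  apply/allP => z zg; have zh : z \in vis h.
    by rewrite [vis h]/= QE -!cat_cons mem_cat [z \in v :: _]zg orbT.
  by have := allP ah z zh; rewrite htD htN htM1; lia.
have hM z : z \in vis h -> ht (-1 - z) < 0.
  by move=> /(allP ah); rewrite htD htN htM1; lia.
have vin : v \in vis h by rewrite [vis h]/= QE !(inE, mem_cat, eqxx, orbT).
have rin : r \in vis h by rewrite [vis h]/= -/r mem_head.
have qin : q \in vis h by rewrite [vis h]/= QE inE -!cat_cons mem_cat -lQ mem_last orbT.
have ntr z : z \in [:: r, a & Q] -> z \notin v :: R.
  by move=> zQ; apply/negP => /ut; rewrite zQ.
have qQ : q \in a :: Q by rewrite -lQ mem_last.
have rn : r \notin a :: Q.
  by have := uh0; rewrite thE -!cat_cons cat_uniq => /and3P[/= /andP[]].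
have vn : v \notin a :: Q.
  by have := ut v (mem_head _ _); rewrite inE negb_or => /andP[].
have vR : v \notin R.
  by have := uh0; rewrite thE -!cat_cons cat_uniq => /and3P[_ _ /= /andP[]].
have lk := linked_trail h0; rewrite thE -!cat_cons in lk.
have [lk1 lk2] : linked (r :: a :: Q) /\ linked (v :: R).
  by move: lk; rewrite /linked /= cat_path => /andP[-> /andP[-> /=]] /andP[].
have lR : linked R by exact: path_sorted lk2.
set f' := turn (~~ b) * e; set f := turn b * e.
have uf : unit6 f := unit6_dir (b :: g).
have uf' : unit6 f' := unit6_dir (~~ b :: g).
have rv : r - v = f' by rewrite rE dE opprK addrC addKr.
have qv : q - v = f by rewrite qE addrC addKr.
have nR z : z \in [:: r, a & Q] -> z \notin R.
  by move=> /ntr; rewrite inE negb_or => /andP[].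
(* The tail seen from the last vertex r and from the first vertex q of the loop, by moving the
   observer away from v. *)
have Sr : sweep r (v :: R) = hturn (- e - f') (- f') + hw (wind g) + hturn (- e) (- e - f').
  rewrite {1}TE sweep_cons -TE.
  have := @sweep_edge v r p T; rewrite -TE lT rv => ->//; last exact/nR/mem_head.
  rewrite (hturn_dn (hM _ vin) (hM _ rin)) vE /p -rv.
  rewrite (_ : v - e - r = - e - (r - v)); last by ring.
  rewrite (_ : v - r = - (r - v)); last by ring.
  rewrite (_ : v - e - v = - e); last by ring.
  ring.
have Sq : sweep q (v :: R) = hturn (- e - f) (- f) + hw (wind g) + hturn (- e) (- e - f).
  rewrite {1}TE sweep_cons -TE.
  have := @sweep_edge v q p T; rewrite -TE lT qv => ->//; last by apply: nR; rewrite inE qQ orbT.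
  rewrite (hturn_dn (hM _ vin) (hM _ qin)) vE /p -qv.
  rewrite (_ : v - e - q = - e - (q - v)); last by ring.
  rewrite (_ : v - q = - (q - v)); last by ring.
  rewrite (_ : v - e - v = - e); last by ring.
  ring.
have lvR : last v R = -1 by rewrite TE.
have M0 : sweep (-1) (r :: a :: Q) = 0.
  apply: sweep_up; apply/allP => z zQ; apply: (allP zr); rewrite QE.
  by rewrite -cat_cons -cat_cons mem_cat zQ.
have := sweep_tail lk2 lk1 ut; rewrite lvR M0 subr0 [last r _]/= lQ Sr Sq sweep_cons.
have h0w : hw (wind h0) = sweep r (a :: Q ++ v :: R).
  by rewrite (hw_wind uh0) vh0 add0r QE /= -catA.
move: h0w; rewrite sweep_cat lQ Sr.
have := @sweep_edge v r a Q; rewrite rv lQ => ->//; last exact: path_sorted lk1.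
have aE : a = r - dir h0.
  by have := vis_prev h0; rewrite QE => -[].
have := turn_balance (wind h0) c; rewrite -[wind h0 + sgnb c]/(wind h) -!dir_wind.
set A := dir h0 in aE *; set B := dir h in rE dE *.
have -> : a - v = - (A + B) by rewrite aE rE; ring.
have -> : a - r = - A by rewrite aE; ring.
have fB : f' = - B by rewrite dE opprK.
have -> : v - r = - f' by rewrite -rv; ring.
have -> : q - r = f - f' by rewrite -rv -qv; ring.
have := hturn_turn (wind h0) c; rewrite -[wind h0 + sgnb c]/(wind h) -!dir_wind -/A -/B.
have := loop_balance (wind g) b; rewrite -!dir_wind -/e -/f -/f' qv.
(* The views of the loop itself cancel; the rest are half-turns at v and the windings. *)
move=> LB HT TB H0 SV; split=> //.
apply: hw_unitv_inj; last first.
  cbv zeta in TB, LB; rewrite LB -/f -/f' fB; move: HT TB H0 SV; rewrite ?fB.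
  repeat match goal with |- context [hturn ?x ?y] =>
    let t := fresh in set t := hturn x y; move: t end.
  move: (hw (wind h)) (hw (wind h0)) (hw (wind g)) (sweep v (a :: Q)).
  clear; lia.
by rewrite -dir_wind -/B dE /f' /e dir_wind unitv_loop.
Qed.

(** * The winding at an exit *)

Lemma nlD p q : nl (p + q) = nl p + nl q.
Proof. by rewrite /nl eis_addE /=; ring. Qed.

Lemma nlN p : nl (- p) = - nl p.
Proof. by rewrite /nl eis_oppE /=; ring. Qed.

Lemma nrD p q : nr (p + q) = nr p + nr q.
Proof. by rewrite /nr eis_addE /=; ring. Qed.

Lemma nrN p : nr (- p) = - nr p.
Proof. by rewrite /nr eis_oppE /=; ring. Qed.

Lemma ht1 : ht 1 = 2. Proof. by []. Qed.

Lemma ht_nlr p : ht p = nl p + nr p.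
Proof. by rewrite /ht /nl /nr; ring. Qed.

(** As long as the directions stay in a region where [hturn] has a potential, only the two ends
    of the path count. *)
Lemma sweep_telescope (C : pred eis) (g : eis -> int) p q L :
  (forall u f, unit6 f -> C u -> C (u + f) -> hturn u (u + f) = g (u + f) - g u) ->
  linked (q :: L) -> all (fun z => C (z - p)) (q :: L) ->
  sweep p (q :: L) = g (q - p) - g (last q L - p).
Proof.
move=> H; elim: L q => [|q0 L IH] q; first by rewrite sweep1 /= subrr.
move=> /= /andP[uq lL] /and3P[c1 c2 c3]; rewrite sweep_cons IH //=; last by rewrite c2.
have := H (q0 - p) (q - q0) uq c2; rewrite (_ : q0 - p + (q - q0) = q - p); last by ring.
by move=> ->//; ring.
Qed.

Lemma hturn_nl u f : unit6 f -> nl u < 0 -> nl (u + f) < 0 ->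
  hturn u (u + f) = - dn (u + f) - - dn u.
Proof.
case: u => x y; rewrite /hturn /dn /up /cr /ht /nl !eis_addE /unit6 !inE.
case/or4P=> [|||/or3P[]] /eqP -> /= H1 H2.
all: case: (boolP (_ || _)) => Ea; case: (boolP (_ || _)) => Eb => //=.
all: case: ifP => ?; lia.
Qed.

Lemma hturn_nr u f : unit6 f -> nr u < 0 -> nr (u + f) < 0 ->
  hturn u (u + f) = dn (u + f) - dn u.
Proof.
case: u => x y; rewrite /hturn /dn /up /cr /ht /nr !eis_addE /unit6 !inE.
case/or4P=> [|||/or3P[]] /eqP -> /= H1 H2.
all: case: (boolP (_ || _)) => Ea; case: (boolP (_ || _)) => Eb => //=.
all: case: ifP => ?; lia.
Qed.

Lemma hturn_ht u f : unit6 f -> (0 <= ht u) && (u != 0) -> (0 <= ht (u + f)) && (u + f != 0) ->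
  hturn u (u + f) = - dn (u + f) - - dn u.
Proof.
case: u => x y; rewrite /hturn /dn /up /cr /ht !eis_addE eis_zeroE !xpair_eqE /unit6 !inE.
case/or4P=> [|||/or3P[]] /eqP -> /= H1 H2.
all: case: (boolP (_ || _)) => Ea; case: (boolP (_ || _)) => Eb => //=.
all: case: ifP => ?; lia.
Qed.

Lemma dn_neg u : ht u < 0 -> dn u = 1.
Proof. by move=> h; rewrite /dn up_neg. Qed.

Lemma dn_pos u : 0 < ht u -> dn u = 0.
Proof. by move=> h; rewrite /dn up_pos. Qed.

Lemma uniq_trail h : uniq (vis h) -> pos h \notin vis h -> pos h != -1 ->
  all (fun z => 0 <= ht z) (vis h) -> uniq (trail h).
Proof.
move=> u n n1 /notin_vis_M1 M; rewrite /trail -cat_cons cats1 rcons_uniq /= n u.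
by rewrite inE negb_or M eq_sym n1.
Qed.

Lemma last_vis_prev h : last (pos h - dir h) (behead (vis h ++ [:: -1])) = -1.
Proof. by have := congr1 (last 0) (vis_prev h); rewrite /= last_cat /= => <-. Qed.

(** The starting point sees the whole walk within a half-plane, so only the view from the end
    point counts. *)
Lemma hw_exit_high h : uniq (vis h) -> pos h \notin vis h ->
  all (fun z => 0 <= ht z) (vis h) -> 0 <= ht (pos h) ->
  hw (wind h) = sweep (pos h) (vis h ++ [:: -1]).
Proof.
move=> u n a hp; have n1 : pos h != -1 by apply: contraTneq hp => ->.
rewrite (hw_wind (uniq_trail u n n1 a)) [X in X + _]sweep_up ?add0r //.
by apply/allP => z; rewrite inE => /orP[/eqP->|/(allP a)]; rewrite htD htN htM1; lia.
Qed.

(** Seen from the end point the walk lies within a half-plane, so the half-turns are those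
    between the directions to its first and last vertices; they determine the winding, since
    the heading determines it modulo 6. *)
Lemma wind_left h : uniq (vis h) -> all (fun z => 0 <= ht z) (vis h) ->
  0 <= ht (pos h) -> 0 < nl (pos h) -> all (fun z => nl z < nl (pos h)) (vis h) ->
  dir h = unitv 1 -> wind h = 1.
Proof.
move=> u a hp np an de; apply: hw_unitv_inj; first by rewrite -dir_wind.
have n : pos h \notin vis h by apply/negP => /(allP an); rewrite ltxx.
rewrite hw_exit_high // vis_prev (@sweep_telescope (fun u => nl u < 0) (fun u => - dn u)).
- rewrite last_vis_prev de (_ : _ - _ - _ = - unitv 1); last by ring.
  by rewrite [dn (-1 - _)]dn_neg // htD !htN ht1; lia.
- exact: hturn_nl.
- by rewrite -vis_prev linked_vis.
- rewrite -vis_prev; apply/allP => z; rewrite mem_cat inE => /orP[/(allP an)|/eqP ->].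
    by rewrite nlD nlN; lia.
  by rewrite nlD !nlN (_ : nl 1 = 1) //; lia.
Qed.

Lemma wind_right h : uniq (vis h) -> all (fun z => 0 <= ht z) (vis h) ->
  0 <= ht (pos h) -> 0 < nr (pos h) -> all (fun z => nr z < nr (pos h)) (vis h) ->
  dir h = unitv (-1) -> wind h = -1.
Proof.
move=> u a hp np an de; apply: hw_unitv_inj; first by rewrite -dir_wind.
have n : pos h \notin vis h by apply/negP => /(allP an); rewrite ltxx.
rewrite hw_exit_high // vis_prev (@sweep_telescope (fun u => nr u < 0) dn).
- rewrite last_vis_prev de (_ : _ - _ - _ = - unitv (-1)); last by ring.
  by rewrite [dn (-1 - _)]dn_neg // htD !htN ht1; lia.
- exact: hturn_nr.
- by rewrite -vis_prev linked_vis.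
- rewrite -vis_prev; apply/allP => z; rewrite mem_cat inE => /orP[/(allP an)|/eqP ->].
    by rewrite nrD nrN; lia.
  by rewrite nrD !nrN (_ : nr 1 = 1) //; lia.
Qed.

Lemma wind_top h : uniq (vis h) -> all (fun z => 0 <= ht z) (vis h) ->
  0 <= ht (pos h) -> all (fun z => ht z < ht (pos h)) (vis h) ->
  dir h = unitv 0 -> wind h = 0.
Proof.
move=> u a hp an de; apply: hw_unitv_inj; first by rewrite -dir_wind.
have n : pos h \notin vis h by apply/negP => /(allP an); rewrite ltxx.
rewrite hw_exit_high // vis_prev (@sweep_telescope (fun u => ht u < 0) dn).
- rewrite last_vis_prev de (_ : _ - _ - _ = - unitv 0); last by ring.
  by rewrite [dn (-1 - _)]dn_neg // htD !htN ht1; lia.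
- by move=> u0 f _ h1 h2; rewrite hturn_dn // !dn_neg.
- by rewrite -vis_prev linked_vis.
- rewrite -vis_prev; apply/allP => z; rewrite mem_cat inE => /orP[/(allP an)|/eqP ->].
    by rewrite htD htN; lia.
  by rewrite htD !htN ht1; lia.
Qed.

(** Here the starting point and the end point are in the same row below the walk, and both views
    contribute half a turn or none according to their order in this row. *)
Lemma wind_bottom h : uniq (vis h) -> all (fun z => 0 <= ht z) (vis h) ->
  ht (pos h) = -2 -> pos h != -1 -> dir h = unitv 3 ->
  wind h = if 0 < (pos h).2 then 3 else -3.
Proof.
move=> u a hp n1 de.
have n : pos h \notin vis h by apply/negP => /(allP a); rewrite hp.
have vE : exists b h', h = b :: h' by case: (h) hp => [|b h'] //; eexists; eexists.
have E1 : sweep (-1) (pos h :: vis h) = - dn (pos h + 1).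
  have lv : linked (pos h :: vis h).
    by have := linked_trail h; rewrite /linked /trail /= cat_path => /andP[].
  case: vE => b [h' hE].
  rewrite (@sweep_telescope (fun u => (0 <= ht u) && (u != 0)) (fun u => - dn u)) //.
  - rewrite opprK [X in _ - - X]dn_pos; first by ring.
    have: last (pos h) (vis h) \in vis h by rewrite hE /= mem_last.
    by move=> /(allP a); rewrite htD ht1; lia.
  - exact: hturn_ht.
  - apply/allP => z; rewrite inE subr_eq0 => /orP[/eqP ->|/[dup] zv /(allP a) hz].
      by rewrite n1 htD htN htM1 hp.
    rewrite htD htN htM1; apply/andP; split; first by lia.
    by apply: contraTneq hz => ->.
have E2 : sweep (pos h) (vis h ++ [:: -1]) = dn (-1 - pos h).
  rewrite vis_prev (@sweep_telescope (fun u => (0 <= ht u) && (u != 0)) (fun u => - dn u)).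
  - rewrite last_vis_prev de (_ : _ - _ - _ = - unitv 3); last by ring.
    by rewrite [X in - X - _]dn_pos //; ring.
  - exact: hturn_ht.
  - by rewrite -vis_prev linked_vis.
  - rewrite -vis_prev; apply/allP => z; rewrite mem_cat inE subr_eq0 htD htN hp.
    move=> /orP[/[dup] zv /(allP a) hz|/eqP ->].
      apply/andP; split; first by lia.
      by apply: contraNneq n => <-.
    by rewrite htN ht1 eq_sym n1.
have H := hw_wind (uniq_trail u n n1 a); rewrite E1 E2 in H.
have y0 : (pos h).2 != 0.
  move: hp n1; rewrite /ht; case: (pos h) => x y; rewrite (_ : -1 = (-1, 0) :> eis) // xpair_eqE /=.
  by lia.
apply: hw_unitv_inj; first by rewrite -dir_wind de; case: ifP.
rewrite H (_ : -1 - pos h = - (pos h + 1)); last by ring.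
rewrite /dn /up !htN !htD ht1 hp eis_oppE eis_addE /=.
rewrite addr0 oppr_gt0 /hw; case: (ltgtP 0 (pos h).2) y0 => Hy //.
Qed.

(** * Exits from a truncated triangle *)

(** A triangle with a horizontal base, cut at height [k]; its left corner is at distance [d]
    from the origin and its right corner at distance [D]. *)
Definition dom (d D k : nat) (p : eis) : bool :=
  [&& 0 <= ht p, ht p < 3 * k%:Z, nl p <= 3 * d%:Z & nr p <= 3 * D%:Z].

Definition exits (P : pred eis) (h : seq bool) : bool :=
  [&& uniq (vis h), all P (vis h) & ~~ P (pos h)].

Definition outB (p : eis) : bool := ht p < 0.
Definition outL (d : nat) (p : eis) : bool := 3 * d%:Z < nl p.
Definition outR (D : nat) (p : eis) : bool := 3 * D%:Z < nr p.
Definition outT (k : nat) (p : eis) : bool := 3 * k%:Z <= ht p.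

Lemma ht_mod3 h : exists m, ht (pos h) = 3 * m \/ ht (pos h) = 3 * m + 1.
Proof. by have [m E] := ht_mod h; exists m; lia. Qed.

Lemma mem0_vis h : h != [::] -> 0 \in vis h.
Proof. by elim: h => [|b [|b' h] IH] // _; rewrite inE IH // orbT. Qed.

Lemma pos_neqM1 h : uniq (vis h) -> all (fun z => 0 <= ht z) (vis h) -> h != [::] ->
  pos h != -1.
Proof.
case: h => // b h u a _; apply/eqP => E.
have h0 : 0 <= ht (pos h) by case/andP: a.
have de : dir (b :: h) = -1.
  have := congr1 ht E; rewrite pos_cons htD htM1 => Eh.
  have : ht (dir (b :: h)) <= -2 by lia.
  have := unit6_dir (b :: h); rewrite /unit6 !inE.
  by case/or4P=> [|||/or3P[]] /eqP ->.
have p0 : pos h = 0 by move: E; rewrite pos_cons de => /(canRL (addrK _)) ->; rewrite subrr.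
case: h u a E h0 de p0 => [|b' h] u _ _ _ de p0; first by move: de; case: (b).
have M := @mem0_vis (b' :: h) isT.
by move: u; rewrite -[vis _]/(pos (b' :: h) :: vis (b' :: h)) cons_uniq p0 M.
Qed.

Lemma exits_dom d D k h : (0 < k)%N -> exits (dom d D k) h ->
  [\/ [/\ ht (pos h) = -2, dir h = unitv 3, ~~ outL d (pos h), ~~ outR D (pos h) & ~~ outT k (pos h)],
      [/\ nl (pos h) = 3 * d%:Z + 2, dir h = unitv 1, ~~ outB (pos h), ~~ outR D (pos h) & ~~ outT k (pos h)],
      [/\ nr (pos h) = 3 * D%:Z + 2, dir h = unitv (-1), ~~ outB (pos h), ~~ outL d (pos h) & ~~ outT k (pos h)]
    | [/\ ht (pos h) = 3 * k%:Z, dir h = unitv 0, ~~ outB (pos h), ~~ outL d (pos h) & ~~ outR D (pos h)]].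
Proof.
move=> k0 /and3P[u a n]; case: h u a n => [|b h] u.
  by rewrite /dom /nl /nr /ht /=; lia.
rewrite [all _ _]/= => /andP[dv _] n; have [m Em] := ht_mod3 h; have [m' Em'] := ht_mod3 (b :: h).
have := unit6_dir (b :: h); rewrite /unit6 !inE => ud.
move: n; rewrite !pos_cons in Em' *; case: (pos h) dv Em Em' => x y.
rewrite /dom /outB /outL /outR /outT /nl /nr /ht !eis_addE.
case/or4P: ud => [|||/or3P[]] /eqP -> /= dv Em Em' n.
- by constructor 4; split => //; lia.
- by constructor 2; split => //; lia.
- by exfalso; lia.
- by constructor 1; split => //; lia.
- by exfalso; lia.
- by constructor 3; split => //; lia.
Qed.

Lemma dom_ht d D k h : all (dom d D k) (vis h) -> all (fun z => 0 <= ht z) (vis h).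
Proof. by apply: sub_all => z /and4P[]. Qed.

Lemma dom_0 d D k : (0 < k)%N -> dom d D k 0.
Proof. by move=> k0; rewrite /dom /ht /nl /nr /=; lia. Qed.

Lemma exits_wind d D k h : (0 < k)%N -> exits (dom d D k) h ->
  wind h = if outB (pos h) then (if 0 < (pos h).2 then 3 else -3)
           else if outL d (pos h) then 1 else if outR D (pos h) then -1 else 0.
Proof.
move=> k0 ex; have /and3P[u a n] := ex; have a0 := dom_ht a.
case: (exits_dom k0 ex) => -[E de n1 n2 n3].
- rewrite /outB E /=; apply: wind_bottom => //; apply: pos_neqM1 => //.
  by apply: contraNneq n => ->; rewrite dom_0.
- rewrite (negbTE n1) (_ : outL _ _ = true); last by rewrite /outL E; lia.
  apply: wind_left => //; try by move: n1; rewrite /outB; lia.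
  by apply: sub_all a => z /and4P[_ _ h1 _]; lia.
- rewrite (negbTE n1) (negbTE n2) (_ : outR _ _ = true); last by rewrite /outR E; lia.
  apply: wind_right => //; try by move: n1; rewrite /outB; lia.
  by apply: sub_all a => z /and4P[_ _ _ h1]; lia.
- rewrite (negbTE n1) (negbTE n2) (negbTE n3).
  apply: wind_top => //; try by move: n1; rewrite /outB; lia.
  by apply: sub_all a => z /and4P[_ h1 _ _]; lia.
Qed.

(** * Sums over words *)

Fixpoint words (n : nat) : seq (seq bool) :=
  if n is n'.+1 then map (cons true) (words n') ++ map (cons false) (words n')
  else [:: [::]].

Fixpoint lwords (m : nat) : seq (seq bool) :=
  if m is m'.+1 then lwords m' ++ words m' else [::].

Lemma mem_words n h : (h \in words n) = (size h == n).
Proof.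
elim: n h => [|n IH] [|b h] //=.
  by rewrite mem_cat; apply/negbTE/negP => /orP[] /mapP[].
rewrite mem_cat eqSS -IH; apply/orP/idP => [[] /mapP[g gw [_ ->]] //|hw].
by case: b; [left|right]; apply: map_f.
Qed.

Lemma uniq_words n : uniq (words n).
Proof.
elim: n => // n IH /=; rewrite cat_uniq !map_inj_uniq ?IH ?andbT /=; try by move=> ? ? [].
by apply/hasP => -[h] /mapP[g _ ->] /mapP[].
Qed.

Lemma mem_lwords m h : (h \in lwords m) = (size h < m)%N.
Proof.
elim: m => // m IH; rewrite [lwords _]/= mem_cat IH mem_words ltnS.
by rewrite (leq_eqVlt (size h)) orbC.
Qed.

Lemma uniq_lwords m : uniq (lwords m).
Proof.
elim: m => // m IH; rewrite [lwords _]/= cat_uniq IH uniq_words andbT.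
apply/hasP => -[h]; rewrite mem_words => /eqP hs.
by rewrite /= mem_lwords hs ltnn.
Qed.

Lemma sum_wordsS (V : nmodType) n (F : seq bool -> V) :
  \sum_(h <- words n.+1) F h = \sum_(h <- words n) (F (true :: h) + F (false :: h)).
Proof. by rewrite [words _]/= big_cat /= !big_map big_split. Qed.

(** * Cancellation of loops *)

Definition looping (P : pred eis) (h : seq bool) : bool :=
  [&& uniq (vis h), all P (vis h) & pos h \in vis h].

(** The walk that runs around its final loop in the other direction. *)
Definition flip (h : seq bool) : seq bool :=
  let i := index (pos h) (vis h) in
  rv (take i h) ++ ~~ nth false h i :: drop i.+1 h.

Lemma looping_split P h : looping P h ->
  exists l b g, [/\ h = l ++ b :: g, pos h = pos g & size l = index (pos h) (vis h)].
Proof.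
case/and3P=> _ _ /[dup] hv; rewrite -index_mem size_vis => lt.
exists (take (index (pos h) (vis h)) h), (nth false h (index (pos h) (vis h))),
  (drop (index (pos h) (vis h)).+1 h).
rewrite -drop_nth // cat_take_drop size_take lt; split=> //.
have K i k : (i < size k)%N -> nth 0 (vis k) i = pos (drop i.+1 k).
  by elim: k i => // c k IH [|i] //=; [rewrite drop0|apply: IH].
by rewrite -K // nth_index.
Qed.

Lemma flip_cat l b g : uniq (vis (l ++ b :: g)) -> pos (l ++ b :: g) = pos g ->
  flip (l ++ b :: g) = rv l ++ ~~ b :: g.
Proof.
move=> u E; rewrite /flip E.
have -> : index (pos g) (vis (l ++ b :: g)) = size l.
  move: u; rewrite vis_cat cat_uniq index_cat => /and3P[_ /hasP H _].
  rewrite ifN ?size_map ?size_vis /= ?eqxx ?addn0 //.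
  by apply/negP => H'; apply: H; exists (pos g) => //; rewrite mem_head.
by rewrite take_size_cat // nth_cat ltnn subnn /= -(cat_rcons b) drop_size_cat ?size_rcons.
Qed.

(** Both orientations of the loop visit the same vertices, and [wind_loop] applies to both. *)
Lemma flip_facts (P : pred eis) l b g (h := l ++ b :: g) : (forall z, P z -> 0 <= ht z) ->
  uniq (vis h) -> all P (vis h) -> pos h = pos g ->
  [/\ looping P (rv l ++ ~~ b :: g), pos (rv l ++ ~~ b :: g) = pos g,
      wind h = wind g - 4 * sgnb b & wind (rv l ++ ~~ b :: g) = wind g + 4 * sgnb b].
Proof.
move=> PH u a E; have a0 : all (fun z => 0 <= ht z) (vis h).
  by apply: sub_all a => z; exact: PH.
have [w d] := wind_loop u a0 E.
have K z : pos (b :: g) + dir (b :: g) * rvmap l z =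
  pos (~~ b :: g) + dir (~~ b :: g) * z.
  move: E d; rewrite /h pos_cat dir_cat !pos_cons /rvmap.
  rewrite -[dir (~~ b :: g)]/(turn (~~ b) * dir g) => E d.
  rewrite -[turn (~~ b) * dir g]opprK -d.
  transitivity (pos g + dir (b :: g) + dir (b :: g) * pos l
     - dir l * dir (b :: g) - dir l * dir (b :: g) * z); first by ring.
  by rewrite E; ring.
have p' : pos (rv l ++ ~~ b :: g) = pos g.
  by rewrite pos_cat -K rvmap_pos pos_cons mulrN1 addrK.
have vE : vis (rv l ++ ~~ b :: g) =
    rev [seq pos (b :: g) + dir (b :: g) * z | z <- vis l] ++ vis (b :: g).
  rewrite vis_cat -map_rev -rvmap_vis -map_comp; congr (_ ++ _).
  by apply: eq_map => z /=; rewrite -K.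
have pe : perm_eq (vis (rv l ++ ~~ b :: g)) (vis h).
  by rewrite vE /h vis_cat perm_cat2r perm_rev.
have u' : uniq (vis (rv l ++ ~~ b :: g)) by rewrite (perm_uniq pe).
have a' : all P (vis (rv l ++ ~~ b :: g)) by rewrite (perm_all _ pe).
split=> //; first by rewrite /looping u' a' p' vE mem_cat inE eqxx orbT.
have a1 : all (fun z => 0 <= ht z) (vis (rv l ++ ~~ b :: g)).
  by apply: sub_all a' => z; exact: PH.
by have [-> _] := wind_loop u' a1 p'; case: (b) => /=; ring.
Qed.

(** A weight with opposite values at windings that differ by 8 cancels between a walk and its
    flipped walk. *)
Lemma loops_cancel (V : zmodType) (om : int -> V) (P : pred eis) n :
  (forall z, P z -> 0 <= ht z) ->
  (forall k, om (k + 4) = - om (k - 4)) ->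
  \sum_(h <- words n | looping P h) om (wind h) = \sum_(h <- words n | looping P h) - om (wind h).
Proof.
move=> PH omE; rewrite -[LHS]big_filter -[RHS]big_filter; set s := seq.filter _ _.
have fP h : h \in s -> [/\ flip h \in s, flip (flip h) = h & om (wind (flip h)) = - om (wind h)].
  rewrite mem_filter mem_words => /andP[lh /eqP sz].
  have /and3P[u a _] := lh; have [l [b [g [hE E _]]]] := looping_split lh.
  rewrite hE in lh u a E sz *; have [l' E' w w'] := flip_facts PH u a E.
  have /and3P[u' a' _] := l'.
  rewrite flip_cat // flip_cat // rvK negbK; split=> //.
    by rewrite mem_filter l' mem_words -sz !size_cat size_rv /= eqxx.
  by rewrite w w'; case: (b) => /=; rewrite ?mulrN1 ?mulr1 ?opprK ?omE ?opprK.
have pe : perm_eq s (map flip s).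
  have us : uniq s by rewrite filter_uniq ?uniq_words.
  have um : uniq (map flip s).
    rewrite map_inj_in_uniq // => y z /fP[_ yK _] /fP[_ zK _] yz.
    by rewrite -yK -zK yz.
  apply: uniq_perm => // h; apply/idP/mapP => [hs|[g /fP[gs _ _] ->] //].
  by have [h1 h2 _] := fP h hs; exists (flip h).
rewrite (perm_big _ pe) big_map /=.
by apply: eq_big_seq => h /fP[].
Qed.

(** * The observable identity *)

Definition arrives (P : pred eis) (h : seq bool) : bool :=
  uniq (pos h :: vis h) && all P (pos h :: vis h).

Lemma sum_eq_opp0 (F : numDomainType) (a : F) : a = - a -> a = 0.
Proof.
move=> /eqP; rewrite -addr_eq0 -mulr2n mulrn_eq0 /= => /eqP; exact.
Qed.

(** Each walk that ends at a fresh vertex of the domain is continued in two ways, and the weights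
    of the windings are such that the weight is preserved.  A continued walk leaves the domain,
    closes a loop or ends at a fresh vertex, and the loops cancel. *)
Lemma observable_step (F : realFieldType) (x : F) (om : int -> F) (P : pred eis) n :
  (forall z, P z -> 0 <= ht z) ->
  (forall k, om (k + 4) = - om (k - 4)) ->
  (forall k, x * (om (k + 1) + om (k - 1)) = om k) ->
  \sum_(h <- words n | arrives P h) om (wind h) =
  x * (\sum_(h <- words n.+1 | exits P h) om (wind h) +
       \sum_(h <- words n.+1 | arrives P h) om (wind h)).
Proof.
move=> PH om4 om1.
transitivity (x * \sum_(h <- words n.+1 | uniq (vis h) && all P (vis h)) om (wind h)).
  rewrite [in RHS]big_mkcond sum_wordsS big_mkcond mulr_sumr; apply: eq_bigr => h _ /=.
  by rewrite /arrives /=; case: ifP => _; rewrite ?om1 ?addr0 ?mulr0.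
congr (x * _); rewrite (bigID (fun h => P (pos h))) /= addrC; congr (_ + _).
  by apply: eq_bigl => h; rewrite /exits andbA.
rewrite (bigID (fun h => pos h \in vis h)) /=.
rewrite (eq_bigl (looping P)); last first.
  move=> h; rewrite /looping -andbA -andbA; case: (uniq _) => //=.
  case a: (all _ _) => //=; case v: (_ \in _); rewrite ?andbF ?andbT //.
  exact: (allP a).
have -> : \sum_(h <- words n.+1 | looping P h) om (wind h) = 0.
  by apply: sum_eq_opp0; rewrite {1}(loops_cancel n.+1 PH om4) sumrN.
rewrite add0r.
apply: eq_bigl => h; rewrite /arrives /=; case: (_ \in _); case: (P _); rewrite ?andbF ?andbT //=.
Qed.

Definition wsum (F : realFieldType) (x : F) (m : nat) (Q : pred (seq bool)) (f : seq bool -> F) : F :=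
  \sum_(h <- lwords m | Q h) f h * x ^+ size h.

Lemma wsumS (F : realFieldType) (x : F) m (Q : pred (seq bool)) f :
  wsum x m.+1 Q f = wsum x m Q f + (\sum_(h <- words m | Q h) f h) * x ^+ m.
Proof.
rewrite /wsum [lwords m.+1]/= big_cat /=; congr (_ + _).
rewrite big_seq_cond [in RHS]big_seq_cond mulr_suml.
by apply: eq_bigr => h /andP[]; rewrite mem_words => /eqP ->.
Qed.

Lemma observable (F : realFieldType) (x : F) (om : int -> F) (P : pred eis) m :
  (forall z, P z -> 0 <= ht z) -> P 0 ->
  (forall k, om (k + 4) = - om (k - 4)) ->
  (forall k, x * (om (k + 1) + om (k - 1)) = om k) ->
  wsum x m.+1 (exits P) (fun h => om (wind h)) +
    (\sum_(h <- words m | arrives P h) om (wind h)) * x ^+ m = om 0.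
Proof.
move=> PH P0 om4 om1; elim: m => [|m IH].
  by rewrite /wsum /= !big_cons !big_nil /exits /arrives /= P0 /= add0r mulr1 addr0.
by rewrite -IH (observable_step m PH om4 om1) wsumS exprS; ring.
Qed.

(** In a finite domain no walk is longer than the number of vertices. *)
Lemma observable_finite (F : realFieldType) (x : F) (om : int -> F) (P : pred eis)
    (s : seq eis) m :
  (forall z, P z -> 0 <= ht z) -> P 0 -> {subset P <= s} -> (size s < m)%N ->
  (forall k, om (k + 4) = - om (k - 4)) ->
  (forall k, x * (om (k + 1) + om (k - 1)) = om k) ->
  wsum x m (exits P) (fun h => om (wind h)) = om 0.
Proof.
move=> PH P0 Ps; case: m => // m sm om4 om1.
rewrite -(observable m PH P0 om4 om1) big1_seq ?mul0r ?addr0 //.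
move=> h /andP[/andP[u a]]; rewrite mem_words => /eqP hm.
have := uniq_leq_size u (fun z hz => Ps z (allP a z hz)).
by rewrite /= size_vis hm; lia.
Qed.

(** * Generating functions of sets of walks *)

(** Comparison of sums along an injection that does not decrease the terms. *)
Lemma ler_sum_inj (F : numDomainType) (T T' : eqType) (s : seq T) (s' : seq T')
    (P : pred T) (P' : pred T') (f : T -> F) (g : T' -> F) (phi : T -> T') :
  uniq s ->
  (forall t, t \in s -> P t -> [/\ phi t \in s', P' (phi t) & f t <= g (phi t)]) ->
  (forall t u, P t -> P u -> phi t = phi u -> t = u) ->
  (forall t', P' t' -> 0 <= g t') ->
  \sum_(t <- s | P t) f t <= \sum_(t' <- s' | P' t') g t'.
Proof.
move=> us H inj g0; rewrite -big_filter -[leRHS]big_filter.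
set r := seq.filter P s; set r' := seq.filter P' s'.
have ur : uniq (map phi r).
  rewrite map_inj_in_uniq ?filter_uniq // => t u.
  by rewrite !mem_filter => /andP[pt _] /andP[pu _]; exact: inj.
have sr : {subset map phi r <= r'}.
  by move=> _ /mapP[t + ->]; rewrite !mem_filter => /andP[pt ts]; have [-> -> _] := H t ts pt.
have gr t' : t' \in r' -> 0 <= g t' by rewrite mem_filter => /andP[/g0].
apply: (@le_trans _ _ (\sum_(t' <- map phi r) g t')).
  rewrite big_map [leLHS]big_seq [leRHS]big_seq; apply: ler_sum => t.
  by rewrite mem_filter => /andP[pt ts]; have [] := H t ts pt.
elim: (map phi r) r' ur sr gr => [|y q IH] r' /=.
  by move=> _ _ gr; rewrite big_nil big_seq; apply: sumr_ge0 => t /gr.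
case/andP=> yq uq sr gr; have yr : y \in r' by apply: sr; rewrite mem_head.
rewrite big_cons (perm_big _ (perm_to_rem yr)) /= big_cons lerD2l.
apply: IH => // t tq; last by apply: gr; exact: (mem_rem tq).
have : t \in r' by apply: sr; rewrite inE tq orbT.
rewrite (perm_mem (perm_to_rem yr)) inE => /orP[/eqP ty|//].
by move: yq; rewrite -ty tq.
Qed.

(** Truncated to walks shorter than [m], so that all sums are finite. *)
Definition gf (F : realFieldType) (x : F) (m : nat) (Q : pred (seq bool)) : F :=
  \sum_(h <- lwords m | Q h) x ^+ size h.

Lemma gf_ge0 (F : realFieldType) (x : F) m Q : 0 <= x -> 0 <= gf x m Q.
Proof. by move=> x0; apply: sumr_ge0 => h _; exact: exprn_ge0. Qed.

Lemma gf_inj (F : realFieldType) (x : F) m m' (Q Q' : pred (seq bool)) phi :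
  0 <= x -> (m <= m')%N ->
  (forall h, Q h -> Q' (phi h) /\ size (phi h) = size h) ->
  (forall h g, Q h -> Q g -> phi h = phi g -> h = g) ->
  gf x m Q <= gf x m' Q'.
Proof.
move=> x0 mm H inj; apply: (@ler_sum_inj _ _ _ _ _ _ _ _ _ phi) => //; first exact: uniq_lwords.
  move=> h; rewrite mem_lwords => hm qh; have [q' sz] := H h qh.
  by rewrite mem_lwords sz q' (leq_trans hm).
by move=> h _; exact: exprn_ge0.
Qed.

Lemma gf_sub (F : realFieldType) (x : F) m m' (Q Q' : pred (seq bool)) :
  0 <= x -> (m <= m')%N -> (forall h, Q h -> Q' h) -> gf x m Q <= gf x m' Q'.
Proof. by move=> x0 mm H; apply: (@gf_inj _ _ _ _ _ _ id) => // h /H. Qed.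

Lemma gf_or (F : realFieldType) (x : F) m (Q Q1 Q2 : pred (seq bool)) :
  0 <= x -> (forall h, Q h -> Q1 h || Q2 h) -> gf x m Q <= gf x m Q1 + gf x m Q2.
Proof.
move=> x0 H; rewrite /gf [in leRHS]big_mkcond [X in _ <= _ + X]big_mkcond -big_split /=.
rewrite big_mkcond; apply: ler_sum => h _; have X := exprn_ge0 (size h) x0.
case q: (Q h); last by apply: addr_ge0; case: ifP.
by have := H h q; case: (Q1 h); case: (Q2 h) => //= _; rewrite ?addr0 ?add0r ?lerDl.
Qed.

Lemma gf_disj (F : realFieldType) (x : F) m (Q Q1 Q2 : pred (seq bool)) :
  0 <= x -> (forall h, Q1 h -> Q h) -> (forall h, Q2 h -> Q h) ->
  (forall h, Q1 h -> ~~ Q2 h) -> gf x m Q1 + gf x m Q2 <= gf x m Q.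
Proof.
move=> x0 H1 H2 H; rewrite /gf big_mkcond [X in _ + X <= _]big_mkcond -big_split /=.
rewrite [leRHS]big_mkcond; apply: ler_sum => h _; have := exprn_ge0 (size h) x0.
case q1: (Q1 h); first by rewrite (H1 _ q1) (negbTE (H _ q1)) addr0.
by case q2: (Q2 h); rewrite ?(H2 _ q2) add0r //; case: ifP.
Qed.

(** A walk may split in several ways; the injection into pairs chooses the shortest first part. *)
Lemma gf_cat (F : realFieldType) (x : F) m (Q Q1 Q2 : pred (seq bool)) : 0 <= x ->
  (forall h, Q h -> exists l g, [/\ h = l ++ g, Q1 l & Q2 g]) ->
  gf x m Q <= gf x m Q1 * gf x m Q2.
Proof.
move=> x0 H.
pose ok h i := Q1 (take i h) && Q2 (drop i h).
pose phi h := let i := find (ok h) (iota 0 (size h).+1) in (take i h, drop i h).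
have phiP h : Q h -> Q1 (phi h).1 && Q2 (phi h).2.
  move=> /H[l [g [hE q1 q2]]].
  have hs : has (ok h) (iota 0 (size h).+1).
    apply/hasP; exists (size l); first by rewrite mem_iota add0n ltnS hE size_cat leq_addr.
    by rewrite /ok hE take_size_cat // drop_size_cat // q1 q2.
  have := nth_find 0 hs; rewrite nth_iota ?add0n //.
  by move: hs; rewrite has_find size_iota.
have catE h : (phi h).1 ++ (phi h).2 = h by rewrite cat_take_drop.
have -> : gf x m Q1 * gf x m Q2 =
  \sum_(p <- [seq (l, g) | l <- lwords m, g <- lwords m] | Q1 p.1 && Q2 p.2)
     x ^+ size p.1 * x ^+ size p.2.
  rewrite big_mkcond big_allpairs_dep /= /gf mulr_suml big_mkcond.
  apply: eq_bigr => l _; case: (Q1 l) => /=; last by rewrite big1.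
  by rewrite mulr_sumr big_mkcond.
apply: (@ler_sum_inj _ _ _ _ _ _ _ _ _ phi); first exact: uniq_lwords.
- move=> h; rewrite mem_lwords => hm /phiP ->; split=> //; last first.
    by rewrite -exprD -size_cat catE.
  have := congr1 size (catE h); rewrite size_cat => sz.
  by case: (phi h) sz => l g /= sz; apply: allpairs_f; rewrite mem_lwords (leq_ltn_trans _ hm) // -sz ?leq_addr ?leq_addl.
- by move=> h g _ _ E; rewrite -(catE h) E catE.
- by move=> p _; rewrite -exprD exprn_ge0.
Qed.

(** * The critical fugacity *)

(** The cosine and the sine of the angle that multiplies the winding in the weight [omC] or
    [omS] of a walk.  This angle satisfies [omC4] and [omS4], so that loops cancel, and it
    determines the fugacity [xc] through [omC1] and [omS1]. *)
Definition cs (R : realType) : R := cos (pi / 8).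
Definition sn (R : realType) : R := sin (pi / 8).
Definition xc (R : realType) : R := (2 * cs R)^-1.
Arguments cs {R}.
Arguments sn {R}.
Arguments xc {R}.

Definition omC (R : realType) (k : int) : R := cos (k%:~R * (pi / 8)).
Definition omS (R : realType) (k : int) : R := sin (k%:~R * (pi / 8)).

Lemma cs2Dsn2 (R : realType) : cs ^+ 2 + sn ^+ 2 = 1 :> R.
Proof. exact: cos2Dsin2. Qed.

Lemma cs_gt0 (R : realType) : 0 < cs :> R.
Proof. by apply: cos_gt0_pihalf; have := pi_gt0 R; lra. Qed.

Lemma sn_gt0 (R : realType) : 0 < sn :> R.
Proof. by apply: sin_gt0_pi; have := pi_gt0 R; lra. Qed.

(** (1 + sqrt 2 / 2) / 2 and (1 - sqrt 2 / 2) / 2 are the squares of [cs] and [sn]. *)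
Lemma cs2_sn2 (R : realType) : exists t : R, [/\ 0 < t, t ^+ 2 = 1 / 2,
  cs ^+ 2 = (1 + t) / 2 & sn ^+ 2 = (1 - t) / 2].
Proof.
exists (cos (pi / 4)).
have t0 : 0 < cos (pi / 4 : R) by apply: cos_gt0_pihalf; have := pi_gt0 R; lra.
have E1 : cos (pi / 4 : R) ^+ 2 *+ 2 - 1 = 0.
  by rewrite -cos_mulr2n -(cos_pihalf R); congr cos; rewrite -mulr_natr; field.
have E2 : cs ^+ 2 *+ 2 - 1 = cos (pi / 4 : R).
  by rewrite -cos_mulr2n; congr cos; rewrite -mulr_natr; field.
have E3 := cs2Dsn2 R; split=> //; lra.
Qed.

Lemma cs2_le (R : realType) : cs ^+ 2 <= 6 * sn ^+ 2 :> R.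
Proof. have [t [t0 t2 -> ->]] := cs2_sn2 R; nra. Qed.

Lemma cs2_ge (R : realType) : 17 / 20 <= cs ^+ 2 :> R.
Proof. have [t [t0 t2 -> _]] := cs2_sn2 R; nra. Qed.

Lemma sn2_ge (R : realType) : 1 / 9 <= sn ^+ 2 :> R.
Proof. have [t [t0 t2 _ ->]] := cs2_sn2 R; nra. Qed.

Lemma sn_ge (R : realType) : 1 / 3 <= sn :> R.
Proof. have := sn2_ge R; have := sn_gt0 R; nra. Qed.

Lemma cs_ge (R : realType) : 9 / 10 <= cs :> R.
Proof. have := cs2_ge R; have := cs_gt0 R; nra. Qed.

Lemma cs_le1 (R : realType) : cs <= 1 :> R.
Proof. exact: cos_le1. Qed.

Lemma xc_gt0 (R : realType) : 0 < xc :> R.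
Proof. by rewrite invr_gt0 mulr_gt0 ?cs_gt0. Qed.

Lemma xc_ge0 (R : realType) : 0 <= xc :> R.
Proof. exact/ltW/xc_gt0. Qed.

Lemma xc_le (R : realType) : xc <= 3 / 5 :> R.
Proof.
have := cs_ge R; have := cs_gt0 R => c0 c1.
by rewrite /xc invf_ple ?posrE ?mulr_gt0 //; lra.
Qed.

Lemma angle4 (R : realType) (k : int) : (k + 4)%:~R * (pi / 8) = k%:~R * (pi / 8) + pi / 2 :> R.
Proof. by rewrite intrD (_ : (4 : int)%:~R = 4 :> R) //; field. Qed.

Lemma angleN4 (R : realType) (k : int) : (k - 4)%:~R * (pi / 8) = k%:~R * (pi / 8) - pi / 2 :> R.
Proof. by rewrite intrB (_ : (4 : int)%:~R = 4 :> R) //; field. Qed.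

Lemma omC4 (R : realType) k : omC R (k + 4) = - omC R (k - 4).
Proof.
rewrite /omC (angle4 R k) (angleN4 R k).
by rewrite cosDpihalf cosBpihalf.
Qed.

Lemma omS4 (R : realType) k : omS R (k + 4) = - omS R (k - 4).
Proof.
rewrite /omS (angle4 R k) (angleN4 R k).
by rewrite sinDpihalf sinBpihalf opprK.
Qed.

Lemma omC1 (R : realType) k : xc * (omC R (k + 1) + omC R (k - 1)) = omC R k.
Proof.
rewrite /omC intrD intrB mulrDl mulrBl !mul1r cosD cosB /xc.
have := cs_gt0 R; rewrite /cs => c0; field; exact: lt0r_neq0.
Qed.

Lemma omS1 (R : realType) k : xc * (omS R (k + 1) + omS R (k - 1)) = omS R k.
Proof.
rewrite /omS intrD intrB mulrDl mulrBl !mul1r sinD sinB /xc.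
have := cs_gt0 R; rewrite /cs => c0; field; exact: lt0r_neq0.
Qed.

Lemma omC_values (R : realType) :
  [/\ omC R 0 = 1, omC R 1 = cs, omC R (-1) = cs, omC R 3 = sn & omC R (-3) = sn].
Proof.
have E3 : omC R 3 = sn.
  rewrite /omC (_ : (3 : int)%:~R = 3 :> R) // (_ : 3 * (pi / 8) = - (pi / 8 - pi / 2)); last by field.
  by rewrite cosN cosBpihalf.
split=> //; rewrite /omC ?mul0r ?cos0 ?mul1r ?mulrNz ?mulNr ?mul1r ?cosN //.
Qed.

Lemma omS_values (R : realType) :
  [/\ omS R 0 = 0, omS R 1 = sn, omS R (-1) = - sn, omS R 3 = cs & omS R (-3) = - cs].
Proof.
have E3 : omS R 3 = cs.
  rewrite /omS (_ : (3 : int)%:~R = 3 :> R) // (_ : 3 * (pi / 8) = - (pi / 8 - pi / 2)); last by field.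
  by rewrite sinN sinBpihalf opprK.
split=> //; rewrite /omS ?mul0r ?sin0 ?mul1r ?mulrNz ?mulNr ?mul1r ?sinN //.
by rewrite -E3.
Qed.

(** * The observable identity in truncated triangles *)

Definition exBl d D k h := [&& exits (dom d D k) h, outB (pos h) & 0 < (pos h).2].
Definition exBr d D k h := [&& exits (dom d D k) h, outB (pos h) & ~~ (0 < (pos h).2)].
Definition exL d D k h := exits (dom d D k) h && outL d (pos h).
Definition exR d D k h := exits (dom d D k) h && outR D (pos h).
Definition exT d D k h := exits (dom d D k) h && outT k (pos h).

Lemma wsum_exits (R : realType) (om : int -> R) m d D k : (0 < k)%N ->
  wsum xc m (exits (dom d D k)) (fun h => om (wind h)) =
    om 3 * gf xc m (exBl d D k) + om (-3) * gf xc m (exBr d D k) +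
    (om 1 * gf xc m (exL d D k) + om (-1) * gf xc m (exR d D k)) +
    om 0 * gf xc m (exT d D k).
Proof.
move=> k0.
have G Q : gf xc m Q = \sum_(h <- lwords m) (Q h)%:R * xc ^+ size h :> R.
  by rewrite /gf big_mkcond; apply: eq_bigr => h _; case: (Q h); rewrite ?mul1r ?mul0r.
rewrite !G /wsum big_mkcond !mulr_sumr -!big_split /=.
apply: eq_bigr => h _; rewrite /exBl /exBr /exL /exR /exT.
case ex: (exits _ h); last by rewrite /= !mul0r !mulr0 !addr0.
rewrite (exits_wind k0 ex).
case: (exits_dom k0 ex) => -[E _ n1 n2 n3].
- rewrite (negbTE n1) (negbTE n2) (negbTE n3) /outB E /=.
  by case: (0 < (pos h).2) => /=; ring.
- rewrite (negbTE n1) (negbTE n2) (negbTE n3) (_ : outL _ _ = true); last by rewrite /outL E; lia.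
  by rewrite /=; ring.
- rewrite (negbTE n1) (negbTE n2) (negbTE n3) (_ : outR _ _ = true); last by rewrite /outR E; lia.
  by rewrite /=; ring.
- rewrite (negbTE n1) (negbTE n2) (negbTE n3) (_ : outT _ _ = true); last by rewrite /outT E; lia.
  by rewrite /=; ring.
Qed.

(** An upper bound for the number of vertices. *)
Definition Mb (a : nat) : nat := (4 * a + 1) ^ 2.

Lemma dom_finite d D k : exists2 s : seq eis, {subset dom d D k <= s} & size s = Mb (d + D + k).
Proof.
set a := (d + D + k)%N.
pose r := [seq (i%:Z - (2 * a)%:Z) | i <- iota 0 (4 * a + 1)].
have rP (z : int) : `|z| <= (2 * a)%:Z -> z \in r.
  move=> hz; apply/mapP; exists `|(z + (2 * a)%:Z)%R|%N; last by lia.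
  by rewrite mem_iota; lia.
exists [seq (u, v) | u <- r, v <- r]; last by rewrite size_allpairs size_map size_iota.
move=> [u v]; rewrite unfold_in /dom /ht /nl /nr /= => H.
by apply: allpairs_f; apply: rP; lia.
Qed.

(** The real and the imaginary part of the observable identity, with the windings
    3, -3, 1, -1 and 0 at the left and right part of the base, at the two sides and at the top. *)
Lemma dom_identities (R : realType) m d D k : (0 < k)%N -> (Mb (d + D + k) < m)%N ->
  let Al := gf xc m (exBl d D k) in let Ar := gf xc m (exBr d D k) in
  let El := gf xc m (exL d D k) in let Er := gf xc m (exR d D k) in
  sn * (Al + Ar) + cs * (El + Er) + gf xc m (exT d D k) = 1 :> R /\
  cs * (Al - Ar) + sn * (El - Er) = 0 :> R.
Proof.
move=> k0 hm /=; have [s sd sz] := dom_finite d D k; rewrite -sz in hm.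
have PH z : dom d D k z -> 0 <= ht z by case/and4P.
have [C0 C1 C2 C3 C4] := omC_values R; have [S0 S1 S2 S3 S4] := omS_values R.
have := observable_finite PH (dom_0 d D k0) sd hm (@omC4 R) (@omC1 R).
have := observable_finite PH (dom_0 d D k0) sd hm (@omS4 R) (@omS1 R).
rewrite !wsum_exits // C0 C1 C2 C3 C4 S0 S1 S2 S3 S4 => H1 H2.
by split; [rewrite -H2|rewrite -H1]; ring.
Qed.

(** * Reflections of walks *)

(** Complex conjugation. *)
Definition mirror (p : eis) : eis := (p.1 + p.2, - p.2).

Lemma mirrorD p q : mirror (p + q) = mirror p + mirror q.
Proof. by rewrite /mirror !eis_addE /=; congr pair; ring. Qed.

Lemma mirrorM p q : mirror (p * q) = mirror p * mirror q.
Proof. by rewrite /mirror !eis_mulE /=; congr pair; ring. Qed.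

Lemma mirrorK : involutive mirror.
Proof. by case=> x y; rewrite /mirror /=; congr pair; ring. Qed.

Lemma dir_mirror h : dir (map negb h) = mirror (dir h).
Proof. by elim: h => //= b h ->; rewrite mirrorM; case: b. Qed.

Lemma pos_mirror h : pos (map negb h) = mirror (pos h).
Proof. by elim: h => // b h IH; rewrite map_cons !pos_cons IH mirrorD -dir_mirror. Qed.

Lemma vis_mirror h : vis (map negb h) = map mirror (vis h).
Proof. by elim: h => //= b h ->; rewrite pos_mirror. Qed.

Lemma dom_mirror d D k p : dom D d k (mirror p) = dom d D k p.
Proof. by case: p => x y; rewrite /dom /mirror /ht /nl /nr /=; lia. Qed.

Lemma exits_mirror d D k h : exits (dom D d k) (map negb h) = exits (dom d D k) h.
Proof.
rewrite /exits vis_mirror (map_inj_uniq (inv_inj mirrorK)) all_map pos_mirror dom_mirror.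
by congr [&& _, _ & _]; apply: eq_all => p; exact: dom_mirror.
Qed.

Lemma negbK_map : involutive (map negb).
Proof. by move=> h; rewrite -map_comp map_id_in // => b _; exact: negbK. Qed.

Lemma gf_mirror (F : realFieldType) (x : F) m (Q Q' : pred (seq bool)) : 0 <= x ->
  (forall h, Q h = Q' (map negb h)) -> gf x m Q = gf x m Q'.
Proof.
move=> x0 H; apply/eqP; rewrite eq_le; apply/andP; split; apply: (@gf_inj _ _ _ _ _ _ (map negb)) => //.
- by move=> h; rewrite H size_map.
- by move=> h g _ _ /(inv_inj negbK_map).
- by move=> h; rewrite H negbK_map size_map.
- by move=> h g _ _ /(inv_inj negbK_map).
Qed.

Lemma outB_mirror p : outB (mirror p) = outB p.
Proof. by case: p => x y; rewrite /outB /ht /mirror /=; lia. Qed.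

(** The only vertex of the row below the base that is fixed by the reflection is the starting
    point, which is never an exit. *)
Lemma exBlr_mirror d D k h : (0 < k)%N -> exBl d D k h = exBr D d k (map negb h).
Proof.
move=> k0; rewrite /exBl /exBr exits_mirror pos_mirror outB_mirror.
case ex: (exits _ h) => //=; case o: (outB _) => //=.
have /and3P[u a n] := ex; have a0 := dom_ht a.
have n1 : pos h != -1.
  by apply: pos_neqM1 => //; apply: contraNneq n => ->; rewrite dom_0.
have hE : ht (pos h) = -2 by case: (exits_dom k0 ex) o => -[] // E _; rewrite /outB => /negbTE ->.
case: (pos h) n1 hE => x y; rewrite (_ : -1 = (-1, 0) :> eis) // xpair_eqE /ht /=; lia.
Qed.

Lemma gf_exBl (R : realType) m d D k : (0 < k)%N -> gf xc m (exBl d D k) = gf xc m (exBr D d k) :> R.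
Proof. by move=> k0; apply: gf_mirror => [|h]; [exact: xc_ge0|exact: exBlr_mirror]. Qed.

Lemma gf_exT_mirror (R : realType) m d D k : gf xc m (exT d D k) = gf xc m (exT D d k) :> R.
Proof.
apply: gf_mirror => [|h]; first exact: xc_ge0.
rewrite /exT exits_mirror pos_mirror; congr (_ && _).
by case: (pos h) => x y; rewrite /outT /ht /mirror /=; lia.
Qed.

Lemma dom_sub d D k d' D' k' p : (d <= d')%N -> (D <= D')%N -> (k <= k')%N ->
  dom d D k p -> dom d' D' k' p.
Proof. by rewrite /dom; lia. Qed.

Lemma exBl_sub d D k d' D' k' h : (d <= d')%N -> (D <= D')%N -> (k <= k')%N ->
  exBl d D k h -> exBl d' D' k' h.
Proof.
move=> dd DD kk /and3P[/and3P[u a n] o y]; rewrite /exBl o y /exits u !andbT /=.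
apply/andP; split; first by apply: sub_all a => z; exact: dom_sub.
by move: o; rewrite /outB /dom; lia.
Qed.

Lemma gf_exBl_sub (R : realType) m d D k d' D' k' : (d <= d')%N -> (D <= D')%N -> (k <= k')%N ->
  gf xc m (exBl d D k) <= gf xc m (exBl d' D' k') :> R.
Proof. by move=> *; apply: gf_sub => //; [exact: xc_ge0|move=> h; exact: exBl_sub]. Qed.

(** * Polynomial decay of bridges *)

(** One half of the generating function of arcs in the symmetric domain. *)
Definition arcs (R : realType) m d k : R := gf xc m (exBl d d k).

(** By the first of the [dom_identities], the weight of the walks that leave the symmetric
    triangle other than through its base, with the exits through the sides weighted by [cs]. *)
Definition esc (R : realType) m d : R := 1 - 2 * sn * arcs R m d (2 * d + 1).

(** The height exceeds the size of the smaller base, so no top exit is within reach of both the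
    left and the right corner of the narrow domain. *)
Lemma top_disjoint (R : realType) m d D k : (2 * d < k)%N -> (d <= D)%N ->
  2 * gf xc m (exT d D k) <= gf xc m (exT D D k) :> R.
Proof.
move=> kd dD; rewrite mulr_natl mulr2n {2}gf_exT_mirror.
have E d1 D1 h : (d1 <= D)%N -> (D1 <= D)%N -> exT d1 D1 k h -> exT D D k h.
  move=> h1 h2 /andP[/and3P[u a n] o]; rewrite /exT o andbT /exits u /=.
  apply/andP; split; first by apply: sub_all a => z; exact: dom_sub.
  by move: o; rewrite /outT /dom; lia.
apply: gf_disj; first exact: xc_ge0.
- by move=> h; apply: E.
- by move=> h; apply: E.
- have k0 : (0 < k)%N by lia.
  move=> h /andP[/[dup] ex /(exits_dom k0) H o]; apply/negP => /andP[/(exits_dom k0) H' _].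
  have {H} H1 : ~~ outL d (pos h).
    by case: H => -[] //; rewrite o.
  have {H'} H2 : ~~ outR d (pos h).
    by case: H' => -[] //; rewrite o.
  by move: H1 H2 o; rewrite /outL /outR /outT ht_nlr; lia.
Qed.

Lemma leq_Mb a b : (a <= b)%N -> (Mb a <= Mb b)%N.
Proof. by move=> h; rewrite /Mb leq_sqr; lia. Qed.

(** The second relation turns the asymmetry of the arcs into an asymmetry of the exits through
    the sides, with the ratio of [cs] and [sn] as the factor. *)
Lemma esc_step_algebra (F : realFieldType) (s c A a l r L0 R0 T0 L R1 T : F) :
  0 < s -> 0 < c -> c ^+ 2 <= 6 * s ^+ 2 ->
  s * (A + A) + c * (L0 + R0) + T0 = 1 -> s * (l + r) + c * (L + R1) + T = 1 ->
  c * (l - r) + s * (L - R1) = 0 -> 2 * T <= T0 -> a <= l -> r <= A -> l <= A ->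
  0 <= L0 -> 0 <= R0 ->
  7 * (1 - 2 * s * A) <= 4 * c * R1 + 6 * (1 - 2 * s * a).
Proof.
move=> s0 c0 cs I0 I1 J1 T2 al rA lA L00 R00.
have P1 : s * l <= s * A by rewrite ler_pM2l.
have P2 : s * r <= s * A by rewrite ler_pM2l.
have P3 : 0 <= c * (L0 + R0) by rewrite mulr_ge0 ?addr_ge0 // ltW.
have H1 : s * (c * (L - R1)) = c ^+ 2 * (r - l).
  rewrite (_ : s * (c * (L - R1)) = c * (s * (L - R1))); last by ring.
  by rewrite (_ : s * (L - R1) = c * (r - l)); [ring|lra].
have H2 : c ^+ 2 * (r - l) <= c ^+ 2 * (A - a) by rewrite ler_pM2l ?exprn_gt0 //; lra.
have H3 : c ^+ 2 * (A - a) <= 6 * s ^+ 2 * (A - a) by rewrite ler_wpM2r //; lra.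
have H4 : c * (L - R1) <= 6 * s * (A - a).
  rewrite -(ler_pM2l s0) H1; apply: le_trans H2 (le_trans H3 _).
  by rewrite (_ : s * _ = 6 * s ^+ 2 * (A - a)) //; ring.
lra.
Qed.

(** By [top_disjoint] at least half of the weight that escapes through the top of the wide
    symmetric domain is lost in the domain with the close left side, and the lost weight must
    leave through the sides.  The second relation moves it to the right side up to the
    asymmetry of the arcs, which is at most [esc d]. *)
Lemma esc_step (R : realType) m d D : (d <= D)%N -> (Mb (4 * D + 1) < m)%N ->
  7 * (1 - 2 * sn * arcs R m D (2 * d + 1)) <=
  4 * cs * gf xc m (exR d D (2 * d + 1)) + 6 * esc R m d.
Proof.
move=> dD hm; set k := (2 * d + 1)%N; have k0 : (0 < k)%N by rewrite /k; lia.
have M1 : (Mb (d + D + k) < m)%N by apply: leq_ltn_trans hm; apply: leq_Mb; lia.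
have M0 : (Mb (D + D + k) < m)%N by apply: leq_ltn_trans hm; apply: leq_Mb; lia.
have [I0 _] := dom_identities R k0 M0; have [I1 J1] := dom_identities R k0 M1.
rewrite -(gf_exBl R m D D k0) in I0.
have T := @top_disjoint R m d D k (ltac:(rewrite /k; lia)) dD.
have Al : arcs R m d k <= gf xc m (exBl d D k) by apply: gf_exBl_sub.
have Ar : gf xc m (exBr d D k) <= arcs R m D k.
  by rewrite -gf_exBl //; apply: gf_exBl_sub.
have AL : gf xc m (exBl d D k) <= arcs R m D k by apply: gf_exBl_sub.
have e1 := @gf_ge0 R xc m (exL D D k) (xc_ge0 R).
have e2 := @gf_ge0 R xc m (exR D D k) (xc_ge0 R).
have e3 := @gf_ge0 R xc m (exR d D k) (xc_ge0 R).
exact: (esc_step_algebra (sn_gt0 R) (cs_gt0 R) (cs2_le R) I0 I1 J1 T Al Ar AL e1 e2).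
Qed.

Lemma rvmap_dir (h : seq bool) z : dir h = unitv (-1) ->
  rvmap h z = ((pos h).1 - 1 - z.1 - z.2, (pos h).2 + 1 + z.1).
Proof.
move=> de; rewrite /rvmap de; case: (pos h) z => a b [x y].
by rewrite (_ : unitv (-1) = (1, -1)) // !eis_addE !eis_oppE /=; congr pair; ring.
Qed.

(** Reversal and a rotation by 120 degrees turn an exit through the right side into an exit
    through the left side of a triangle whose left corner is as far from the origin as the
    first walk exits above the base. *)
Lemma exR_rv d D0 D k h : (D <= 2 * D0)%N -> (0 < k)%N -> exR d D k h ->
  exists b, [/\ (b < k)%N, ht (pos h) = 3 * b%:Z + 1 &
    exL b (d + 2 * D0) (k + (d + 2 * D0) + 1) (rv h)].
Proof.
move=> DD k0 /andP[/[dup] ex /(exits_dom k0) H o].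
have /and3P[u a n] := ex.
have [E de n1 n2 n3] : [/\ nr (pos h) = 3 * D%:Z + 2, dir h = unitv (-1), ~~ outB (pos h), ~~ outL d (pos h) & ~~ outT k (pos h)].
  by case: H o => -[] // E de n1 n2 n3; rewrite ?(negbTE n2) ?(negbTE n3).
have [c Ec] := ht_mod3 h.
have [b Eb bk] : exists2 b : nat, ht (pos h) = 3 * b%:Z + 1 & (b < k)%N.
  exists `|c|%N; move: E n1 n3; rewrite /outB /outT; move: Ec; rewrite /ht /nr; lia.
exists b; split=> //; have dv : forall z, z \in vis (rv h) -> dom d D k (rvmap h z).
  move=> z zv; apply: (allP a); rewrite -mem_rev -rvmap_vis; exact: map_f.
have w0 : 0 <= ht (pos h - dir h).
  have := @allP _ _ _ a (pos h - dir h).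
  case: (h) n => [|b' h'] //=; first by rewrite dom_0.
  by move=> _; rewrite addrK => /(_ (mem_head _ _)) /and4P[].
have pe := rvmap_pos h; rewrite (rvmap_dir _ de) in pe.
have oL : outL b (pos (rv h)).
  move: pe; rewrite /outL; case: (pos (rv h)) => x y; rewrite (_ : -1 = (-1, 0) :> eis) //.
  by move=> -[e1 e2]; move: Eb E; rewrite /ht /nr /nl /=; lia.
rewrite /exL oL andbT /exits uniq_vis_rv u /=; apply/andP; split; last first.
  by apply: contraL oL => /and4P[_ _ h1 _]; rewrite /outL; lia.
apply/allP => z /dv; rewrite (rvmap_dir _ de).
by move: Eb E; case: (pos h) z => p q [x y]; rewrite /dom /ht /nr /nl /=; lia.
Qed.

Lemma sum_gf (F : realFieldType) (x : F) m (s : seq nat) (Q : nat -> pred (seq bool)) :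
  \sum_(D <- s) gf x m (Q D) =
  \sum_(p <- [seq (D, h) | D <- s, h <- lwords m] | Q p.1 p.2) x ^+ size p.2.
Proof.
rewrite [RHS]big_mkcond big_allpairs_dep /=; apply: eq_bigr => D _.
by rewrite /gf big_mkcond.
Qed.

(** The distance [D] of the right side and the exit height [b] change roles under the injection
    of [exR_rv]; the reversed walk determines [D] since it ends on that side. *)
Lemma sum_exR (R : realType) m d D0 k : (0 < k)%N ->
  \sum_(D <- iota D0.+1 D0) gf xc m (exR d D k) <=
  \sum_(b <- iota 0 k) gf xc m (exL b (d + 2 * D0) (k + (d + 2 * D0) + 1)) :> R.
Proof.
move=> k0; rewrite !sum_gf.
pose phi (p : nat * seq bool) := (`|((ht (pos p.2) - 1) %/ 3)%Z|%N, rv p.2).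
have bnd D : D \in iota D0.+1 D0 -> (D <= 2 * D0)%N by rewrite mem_iota; lia.
apply: (@ler_sum_inj _ _ _ _ _ _ _ _ _ phi).
- by rewrite allpairs_uniq ?iota_uniq ?uniq_lwords // => -[? ?] [? ?].
- move=> _ /allpairsP[[D h] [Ds hs ->]] q; rewrite /= in Ds hs q.
  have [b [bk Eb ex]] := exR_rv (bnd _ Ds) k0 q.
  rewrite (_ : phi _ = (b, rv h)); last by rewrite /phi /= Eb; congr pair; lia.
  split=> //=; last by rewrite size_rv.
  by apply: allpairs_f; rewrite ?mem_iota ?add0n //; move: hs; rewrite !mem_lwords size_rv.
- move=> [D h] [D' h'] /= e1 e2 [_ /(inv_inj rvK) hh]; rewrite hh in e1 *; congr pair.
  have X D1 : exR d D1 k h' -> nr (pos h') = 3 * D1%:Z + 2.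
    by move=> /andP[/(exits_dom k0) H o]; case: H o => -[] // _ _ _ n2 n3; rewrite ?(negbTE n2) ?(negbTE n3).
  by have := X _ e1; rewrite (X _ e2); lia.
- by move=> [b h] _; rewrite exprn_ge0 ?xc_ge0.
Qed.

Lemma esc_anti (R : realType) m b d : (b <= d)%N -> esc R m d <= esc R m b.
Proof.
move=> bd; rewrite /esc lerD2l lerN2 ler_pM2l ?mulr_gt0 ?sn_gt0 //.
by apply: gf_exBl_sub; lia.
Qed.

Lemma esc_le1 (R : realType) m d : esc R m d <= 1.
Proof.
by rewrite /esc gerBl !mulr_ge0 ?(ltW (sn_gt0 R)) // gf_ge0 // xc_ge0.
Qed.

Lemma exits_le_esc (R : realType) m b d D k : (0 < k)%N -> (b <= d)%N -> (b <= D)%N ->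
  (2 * b < k)%N -> (Mb (d + D + k) < m)%N ->
  cs * (gf xc m (exL d D k) + gf xc m (exR d D k)) + gf xc m (exT d D k) <= esc R m b.
Proof.
move=> k0 bd bD bk hm; have [I _] := dom_identities R k0 hm.
have Al : arcs R m b (2 * b + 1) <= gf xc m (exBl d D k) by apply: gf_exBl_sub; lia.
have Ar : arcs R m b (2 * b + 1) <= gf xc m (exBr d D k).
  by rewrite -gf_exBl //; apply: gf_exBl_sub; lia.
have s0 := sn_gt0 R; rewrite /esc.
have : sn * (arcs R m b (2 * b + 1) + arcs R m b (2 * b + 1)) <=
  sn * (gf xc m (exBl d D k) + gf xc m (exBr d D k)) by rewrite ler_pM2l // lerD.
by move: I; lra.
Qed.

Lemma exL_le_esc (R : realType) m b Y K : (b <= Y)%N -> (2 * b < K)%N -> (Mb (b + Y + K) < m)%N ->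
  cs * gf xc m (exL b Y K) <= esc R m b.
Proof.
move=> bY bK hm; have k0 : (0 < K)%N by lia.
have := @exits_le_esc R m b b Y K k0 (leqnn b) bY bK hm.
have := @gf_ge0 R xc m (exR b Y K) (xc_ge0 R).
have := @gf_ge0 R xc m (exT b Y K) (xc_ge0 R).
by have := cs_gt0 R; nra.
Qed.

(** [esc_step] summed over the distances [D] from D0 + 1 to 2 D0. *)
Lemma esc_recursion (R : realType) m d D0 : (0 < D0)%N -> (d <= D0)%N -> (Mb (20 * D0) < m)%N ->
  7 * D0%:R * esc R m (2 * D0) <=
    4 * \sum_(b <- iota 0 (2 * d + 1)) esc R m b + 6 * D0%:R * esc R m d.
Proof.
move=> D00 dD hm; set k := (2 * d + 1)%N; have k0 : (0 < k)%N by rewrite /k; lia.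
have H1 : \sum_(D <- iota D0.+1 D0) 7 * esc R m (2 * D0) <=
    \sum_(D <- iota D0.+1 D0) (4 * cs * gf xc m (exR d D k) + 6 * esc R m d).
  rewrite big_seq [leRHS]big_seq; apply: ler_sum => D; rewrite mem_iota => hD.
  apply: le_trans (esc_step R (m := m) (d := d) (D := D) _ _); first last.
  - by apply: leq_ltn_trans hm; apply: leq_Mb; lia.
  - by lia.
  - rewrite ler_pM2l // /esc lerD2l lerN2 ler_pM2l ?mulr_gt0 ?sn_gt0 //.
    by apply: gf_exBl_sub; lia.
move: H1; rewrite big_split /= -!mulr_sumr !big_const_seq !count_predT !size_iota !iter_addr_0.
have H2 := sum_exR R m d D0 k0.
have H3 : cs * \sum_(b <- iota 0 k) gf xc m (exL b (d + 2 * D0) (k + (d + 2 * D0) + 1)) <=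
    \sum_(b <- iota 0 k) esc R m b.
  rewrite mulr_sumr big_seq [leRHS]big_seq; apply: ler_sum => b; rewrite mem_iota => hb.
  apply: exL_le_esc; try by (move: hb; rewrite /k; lia).
  by apply: leq_ltn_trans hm; apply: leq_Mb; move: hb; rewrite /k; lia.
have H4 : cs * \sum_(D <- iota D0.+1 D0) gf xc m (exR d D k) <= \sum_(b <- iota 0 k) esc R m b.
  by apply: le_trans H3; rewrite ler_pM2l ?cs_gt0.
move: H4; rewrite -(mulr_natl (esc R m (2 * D0))) -(mulr_natl (esc R m d)).
by move: (\sum_(_ <- _) gf _ _ _) => S; lra.
Qed.

(** With D0 = 500 q the recursion gains the factor (4 * 4 + 6 * 500) / (7 * 500) < 9 / 10, where
    4 q bounds the sum of 2 q + 1 terms.  The second claim feeds the next step. *)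
Lemma esc_decay (R : realType) m j : (Mb (10 * 1000 ^ j) < m)%N ->
  esc R m (1000 ^ j) <= (9 / 10) ^+ j /\
  \sum_(b <- iota 0 (1000 ^ j)) esc R m b <= 2 * (1000 ^ j)%:R * (9 / 10) ^+ j.
Proof.
have arith (q : nat) : [/\ (2 * (500 * q) = 1000 * q)%N, (2 * q + 1 = q + (q + 1))%N,
    (20 * (500 * q) = 10 * (1000 * q))%N, (q <= 500 * q)%N & (10 * q <= 10 * (1000 * q))%N].
  by split; lia.
elim: j => [|j IH] hm.
  have := esc_le1 R m 0; have := esc_le1 R m 1.
  by rewrite expn0 !expr0 /= big_seq1 => h1 h2; split; lra.
have q0 : (0 < 1000 ^ j)%N by rewrite expn_gt0.
have [|I1 I2] := IH; first by apply: leq_ltn_trans hm; apply: leq_Mb; rewrite expnS; case: (arith (1000 ^ j)%N).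
set q := (1000 ^ j)%N in q0 I1 I2.
have qS : (1000 ^ j.+1)%N = (1000 * q)%N by rewrite expnS.
set r := (9 / 10) ^+ j in I1 I2; have r0 : 0 < r by rewrite exprn_gt0 //; lra.
have Q0 : 0 < q%:R :> R by rewrite ltr0n.
have Q1 : 1 <= q%:R :> R by rewrite ler1n.
rewrite qS exprS -/r natrM.
have tail n : \sum_(b <- iota q n) esc R m b <= n%:R * r.
  apply: (@le_trans _ _ (\sum_(b <- iota q n) r)).
    rewrite big_seq [leRHS]big_seq; apply: ler_sum => b; rewrite mem_iota => /andP[hb _].
    exact: le_trans (esc_anti R m hb) I1.
  by rewrite big_const_seq count_predT size_iota iter_addr_0 mulr_natl.
have split n : \sum_(b <- iota 0 (q + n)) esc R m b <= 2 * q%:R * r + n%:R * r.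
  by rewrite iotaD big_cat /= add0n; apply: lerD.
split; last first.
  have := split (999 * q)%N; rewrite -mulSn natrM => h; apply: (le_trans h).
  by have := mulr_gt0 Q0 r0; nra.
have := @esc_recursion R m q (500 * q) _ _ _.
have [-> -> q20 q500 _] := arith q; rewrite q20 -qS => /(_ _ q500 hm).
rewrite muln_gt0 q0 => /(_ isT); have := split (q + 1)%N; rewrite natrD natrM.
set S := \sum_(_ <- _) _; set E := esc R m _; set e := esc R m _ in I1 * => h1 h2.
have p6 : 0 <= 6 * (500 * q%:R) :> R := mulr_ge0 (ler0n R 6) (mulr_ge0 (ler0n R 500) (ltW Q0)).
have h3 : 7 * (500 * q%:R) * E <= 4 * (2 * q%:R * r + (q%:R + 1) * r) + 6 * (500 * q%:R) * r :=
  le_trans h2 (lerD (ler_wpM2l (ler0n R 4) h1) (ler_wpM2l p6 I1)).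
rewrite -(ler_pM2l Q0); nra.
Qed.

(** * Lower bound for the number of self-avoiding walks *)

Definition saws (R : realType) n : R := \sum_(h <- words n | uniq (vis h)) xc ^+ n.

Lemma eis_affine_inj h : injective (fun z => pos h + dir h * z).
Proof.
move=> y z /addrI E; have := dir_rv h; move: E; move: (dir (rv h)) (dir h) => u v E uv.
by rewrite -[y]mul1r -[z]mul1r -uv -!mulrA E.
Qed.

Lemma uniq_vis_cat l g : uniq (vis (l ++ g)) -> uniq (vis l) /\ uniq (vis g).
Proof. by rewrite vis_cat cat_uniq => /and3P[/map_uniq -> _ ->]. Qed.

Lemma saws_ge0 (R : realType) n : 0 <= saws R n.
Proof. by apply: sumr_ge0 => h _; rewrite exprn_ge0 ?xc_ge0. Qed.

Lemma saws_submul (R : realType) n p : saws R (n + p) <= saws R n * saws R p.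
Proof.
rewrite /saws mulr_suml; under [leRHS]eq_bigr do rewrite mulr_sumr.
have -> : \sum_(l <- words n | uniq (vis l)) \sum_(g <- words p | uniq (vis g)) xc ^+ n * xc ^+ p =
  \sum_(q <- [seq (l, g) | l <- words n, g <- words p] | uniq (vis q.1) && uniq (vis q.2))
     xc ^+ n * xc ^+ p :> R.
  rewrite [RHS]big_mkcond big_allpairs_dep /= big_mkcond; apply: eq_bigr => l _.
  by case: (uniq (vis l)) => /=; [rewrite big_mkcond|rewrite big1].
apply: (@ler_sum_inj _ _ _ _ _ _ _ _ _ (fun h => (take n h, drop n h))).
- exact: uniq_words.
- move=> h; rewrite mem_words => /eqP sz u; rewrite -exprD; split=> //=.
    apply: allpairs_f; rewrite mem_words ?size_take ?size_drop sz; last by rewrite addKn.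
    by case: ltnP => //; lia.
  by apply/andP; apply: uniq_vis_cat; rewrite cat_take_drop.
- by move=> h g _ _ [e1 e2]; rewrite -(cat_take_drop n h) e1 e2 cat_take_drop.
- by move=> q _; rewrite -exprD exprn_ge0 ?xc_ge0.
Qed.

Lemma bernoulli (F : realFieldType) (u : F) n : -1 <= u -> 1 + n%:R * u <= (1 + u) ^+ n.
Proof.
move=> u1; elim: n => [|n IH]; first by rewrite mul0r addr0 expr0.
rewrite exprS -natr1; apply: (@le_trans _ _ ((1 + u) * (1 + n%:R * u))).
  by have := ler0n F n; nra.
by rewrite ler_wpM2l //; lra.
Qed.

Lemma geometric_small (R : realType) (r e : R) : 0 < r -> r < 1 -> 0 < e ->
  exists N, forall n, (N <= n)%N -> r ^+ n < e.
Proof.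
move=> r0 r1 e0; set u := r^-1 - 1.
have u0 : 0 < u by rewrite subr_gt0 invf_gt1.
exists (Num.truncn (e^-1 / u)).+1 => n nN.
have hn : e^-1 / u < n%:R.
  by apply: lt_le_trans (Num.Theory.truncnS_gt _) _; rewrite ler_nat.
have := @bernoulli _ u n; rewrite (_ : 1 + u = r^-1); last by rewrite /u; ring.
move=> /(_ ltac:(lra)) b; rewrite exprVn in b.
have : e^-1 < (r ^+ n)^-1.
  by apply: lt_le_trans b; move: hn; rewrite ltr_pdivrMr //; lra.
by rewrite ltf_pV2 ?posrE ?exprn_gt0.
Qed.

(** Submultiplicativity makes the sequence decay at a geometric rate once a term is below 1. *)
Lemma saws_geometric (R : realType) n0 : (0 < n0)%N -> saws R n0 < 1 ->
  exists K r : R, [/\ 0 < r, r < 1, 0 <= K & forall n, saws R n <= K * r ^+ n].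
Proof.
move=> n00; have := saws_ge0 R n0; have := @saws_submul R n0.
move: (saws R n0) => t sub t0 th.
have n0R : 0 < n0%:R :> R by rewrite ltr0n.
have n1R : 1 <= n0%:R :> R by rewrite ler1n.
have [v vn] : exists v, n0%:R * v = (1 - t) / 2.
  by exists ((1 - t) / 2 / n0%:R); rewrite mulrC divfK // lt0r_neq0.
have v0 : 0 < v by rewrite -(pmulr_rgt0 _ n0R) vn; lra.
have v1 : v <= 1 / 2.
  have : v <= n0%:R * v by rewrite ler_peMl // ltW.
  by rewrite vn; lra.
set r := 1 - v; have r0 : 0 < r by rewrite /r; lra.
have rt : t <= r ^+ n0.
  have := @bernoulli _ (- v) n0; rewrite mulrN vn => /(_ ltac:(lra)) b.
  by apply: le_trans b; lra.
have inv0 i : 0 <= saws R i / r ^+ i by rewrite divr_ge0 ?saws_ge0 // exprn_ge0 // ltW.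
exists (\sum_(i < n0) saws R i / r ^+ i), r; split=> //; first by rewrite /r; lra.
  by apply: sumr_ge0 => i _; exact: inv0.
elim/ltn_ind => n IH; have [small|big] := ltnP n n0.
  rewrite -ler_pdivrMr ?exprn_gt0 // (bigD1 (Ordinal small)) //= lerDl.
  by apply: sumr_ge0 => i _; exact: inv0.
rewrite -(subnKC big); apply: le_trans (sub _) _.
rewrite exprD mulrCA; apply: ler_pM; rewrite ?saws_ge0 //.
by apply: IH; lia.
Qed.

Definition longer (k : nat) (h : seq bool) := uniq (vis h) && (k <= size h)%N.

Lemma gf_longer (R : realType) (K r : R) m k : 0 < r -> r < 1 -> 0 <= K ->
  (forall n, saws R n <= K * r ^+ n) -> gf xc m (longer k) <= K / (1 - r) * r ^+ k.
Proof.
move=> r0 r1 K0 H.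
have r1' : 0 < 1 - r by lra.
have [mk|km] := leqP m k.
  rewrite /gf big1_seq; first by rewrite !mulr_ge0 ?invr_ge0 ?exprn_ge0 // ltW.
  move=> h /andP[/andP[_ kh]]; rewrite mem_lwords => hm.
  by have := leq_trans hm (leq_trans mk kh); rewrite ltnn.
suff: gf xc m (longer k) <= K / (1 - r) * (r ^+ k - r ^+ m).
  move=> X; apply: (le_trans X); rewrite ler_wpM2l ?divr_ge0 ?(ltW r1') //.
  by rewrite gerBl exprn_ge0 // ltW.
rewrite -(subnKC (ltnW km)); elim: (m - k)%N => [|p IH].
  rewrite addn0 subrr mulr0 /gf big1_seq //.
  move=> h /andP[/andP[_ kh]]; rewrite mem_lwords => hm.
  by have := leq_trans hm kh; rewrite ltnn.
rewrite addnS /gf [lwords _]/= big_cat /= -/(gf _ _ _).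
have -> : \sum_(h <- words (k + p) | longer k h) xc ^+ size h = saws R (k + p).
  rewrite /saws big_seq_cond [RHS]big_seq_cond; apply: eq_big => h.
    by rewrite mem_words /longer; case: eqP => //= ->; rewrite leq_addr andbT.
  by rewrite mem_words => /andP[/eqP ->].
apply: le_trans (lerD IH (H _)) _.
rewrite exprS le_eqVlt; apply/orP; left; apply/eqP; field.
by rewrite subr_eq0 gt_eqF.
Qed.

Lemma pos_bound h : [/\ `|ht (pos h)| <= 2 * (size h)%:Z, `|nl (pos h)| <= 2 * (size h)%:Z
  & `|nr (pos h)| <= 2 * (size h)%:Z].
Proof.
elim: h => [|b h [I1 I2 I3]]; first by [].
rewrite pos_cons htD nlD nrD [size _]/=.
have [d1 d2 d3] : [/\ `|ht (dir (b :: h))| <= 2, `|nl (dir (b :: h))| <= 2 & `|nr (dir (b :: h))| <= 2].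
  by have := unit6_dir (b :: h); rewrite /unit6 !inE; case/or4P=> [|||/or3P[]] /eqP ->.
by split; lia.
Qed.

Lemma first_exit (P : pred eis) h : ~~ all P (vis h) ->
  exists l g, [/\ h = l ++ g, all P (vis g), ~~ P (pos g) & pos g \in vis h].
Proof.
elim: h => // b h IH; rewrite [vis _]/= [all _ _]/= negb_and => H.
have [a|/IH [l [g [-> a n i]]]] := boolP (all P (vis h)); last first.
  by exists (b :: l), g; split=> //; rewrite inE i orbT.
exists [:: b], h; split=> //; last exact: mem_head.
by move: H; rewrite a orbF.
Qed.

Lemma dir_exT d D k g : (0 < k)%N -> exT d D k g -> dir g = 1 /\ ht (pos g) = 3 * k%:Z.
Proof.
move=> k0 /andP[/(exits_dom k0) H o].
by case: H => -[E -> _ _]; rewrite ?(negbTE o) ?o // => *; split.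
Qed.

(** An arc that needs one more row crosses the old top, and the remaining part must come back
    down to the base. *)
Lemma exBl_split d D k h : (0 < k)%N -> exBl d D k.+1 h -> ~~ exBl d D k h ->
  exists l g, [/\ h = l ++ g, longer k l & exT d D k g].
Proof.
move=> k0 /and3P[ex o y] n; have /and3P[u a np] := ex.
have {}n : ~~ all (dom d D k) (vis h).
  apply: contra n => a'; rewrite /exBl o y /exits u a' /= andbT.
  by move: o; rewrite /outB /dom; lia.
have [l [g [hE ag ng ig]]] := first_exit n; exists l, g.
have [ul ug] : uniq (vis l) /\ uniq (vis g) by apply: uniq_vis_cat; rewrite -hE.
have T : exT d D k g.
  rewrite /exT /exits ug ag ng /=; have := allP a _ ig; move: ng.
  by rewrite /dom /outT; lia.
split=> //; rewrite /longer ul /=; have [dg hg] := dir_exT k0 T.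
move: o; rewrite /outB hE pos_cat dg mul1r htD hg.
by have [] := pos_bound l; lia.
Qed.

Lemma exT_longer d D k h : (0 < k)%N -> exT d D k h -> longer k h.
Proof.
move=> k0 T; have /andP[/and3P[u _ _] _] := T; have [_ E] := dir_exT k0 T.
by rewrite /longer u /=; have [] := pos_bound h; lia.
Qed.

Lemma exL_longer d D k h : (0 < k)%N -> exL d D k h -> longer d h.
Proof.
move=> k0 /andP[/and3P[u _ _] o].
by rewrite /longer u /=; move: o; rewrite /outL; have [] := pos_bound h; lia.
Qed.

Lemma exR_longer d D k h : (0 < k)%N -> exR d D k h -> longer D h.
Proof.
move=> k0 /andP[/and3P[u _ _] o].
by rewrite /longer u /=; move: o; rewrite /outR; have [] := pos_bound h; lia.
Qed.

(** An explicit bridge, for a positive lower bound on the weight of the bridges. *)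
Fixpoint zigzag (k : nat) : seq bool := if k is k'.+1 then false :: true :: zigzag k' else [::].

Lemma zigzagP k : [/\ size (zigzag k) = (2 * k)%N, dir (zigzag k) = 1,
  pos (zigzag k) = (k%:Z, k%:Z), uniq (vis (zigzag k)) &
  all (fun z => [&& 0 <= ht z, ht z < 3 * k%:Z, nl z <= 3 * k%:Z & nr z <= 0]) (vis (zigzag k))].
Proof.
elim: k => // k [s d p u a].
have d1 : dir (true :: zigzag k) = (0, 1) by rewrite /= d mulr1.
have d2 : dir (zigzag k.+1) = 1 by rewrite -[dir _]/(turn false * dir (true :: zigzag k)) d1.
have p1 : pos (true :: zigzag k) = (k%:Z, k%:Z + 1).
  by rewrite pos_cons d1 p eis_addE /= addr0.
have p2 : pos (zigzag k.+1) = (k.+1%:Z, k.+1%:Z).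
  rewrite -[pos _]/(pos (true :: zigzag k) + dir (zigzag k.+1)) d2 p1 eis_addE /=; congr pair; lia.
have vE : vis (zigzag k.+1) = pos (true :: zigzag k) :: pos (zigzag k) :: vis (zigzag k) by [].
split=> //.
- by rewrite /= s; lia.
- rewrite vE !cons_uniq u andbT inE p1 p xpair_eqE; apply/andP; split.
    apply/negP => /orP[|/(allP a)]; first by lia.
    by rewrite /ht /=; lia.
  by apply/negP => /(allP a); rewrite /ht /=; lia.
- rewrite vE p1 p /ht /nl /nr /=; apply/and3P; split; [lia|lia|].
  by apply: sub_all a => z; rewrite /ht /nl /nr; lia.
Qed.

Lemma exT_zigzag D k : (0 < k)%N -> (k <= D)%N -> exT D D k (zigzag k).
Proof.
move=> k0 kD; have [_ _ p u a] := zigzagP k.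
rewrite /exT /exits u p /=; apply/andP; split; last by rewrite /outT /ht /=; lia.
apply/andP; split; last by rewrite /dom /ht /nl /nr /=; lia.
by apply: sub_all a => z; rewrite /dom; lia.
Qed.

Definition nonarc (R : realType) m H k : R := 1 - 2 * sn * arcs R m H k.

(** The complement of the arcs loses little weight from one height to the next if long walks
    are rare: a new arc consists of a bridge and of a long walk. *)
Lemma arcs_increment (R : realType) m H k (T : R) : (0 < k)%N -> (k <= H)%N ->
  (Mb (4 * H) < m)%N -> gf xc m (longer k) <= T ->
  nonarc R m H k - 2 * T * nonarc R m H k <= nonarc R m H k.+1.
Proof.
move=> k0 kH hm hT; set f := nonarc R m H.
have hm' : (Mb (H + H + k) < m)%N by apply: leq_ltn_trans hm; apply: leq_Mb; lia.
have [I _] := dom_identities R k0 hm'; rewrite -(gf_exBl R m H H k0) -/(arcs R m H k) in I.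
have e1 := @gf_ge0 R xc m (exL H H k) (xc_ge0 R).
have e2 := @gf_ge0 R xc m (exR H H k) (xc_ge0 R).
have e3 := @gf_ge0 R xc m (exT H H k) (xc_ge0 R).
have s1 : sn <= 1 :> R by exact: sin_le1.
have s0 := sn_gt0 R; have c0 := cs_gt0 R.
have fT : gf xc m (exT H H k) <= f k by rewrite /f /nonarc; move: I; nra.
have S : arcs R m H k.+1 <= arcs R m H k + T * gf xc m (exT H H k).
  apply: (@le_trans _ _ (gf xc m (exBl H H k) +
      gf xc m (fun h => exBl H H k.+1 h && ~~ exBl H H k h))).
    by apply: gf_or; [exact: xc_ge0|move=> h ->; case: (exBl H H k h)].
  rewrite lerD2l; apply: le_trans (ler_wpM2r e3 hT).
  apply: gf_cat; first exact: xc_ge0.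
  by move=> h /andP[h1 h2]; exact: exBl_split.
have T0 : 0 <= T by apply: le_trans hT; exact: gf_ge0 (xc_ge0 R).
have H1 : T * gf xc m (exT H H k) <= T * f k by rewrite ler_wpM2l.
have f0 : 0 <= T * f k by apply: le_trans H1; rewrite mulr_ge0.
have H2 : sn * arcs R m H k.+1 <= sn * (arcs R m H k + T * f k).
  by rewrite ler_pM2l //; lra.
have H3 : sn * (T * f k) <= 1 * (T * f k) by rewrite ler_wpM2r.
have fE i : f i = 1 - 2 * sn * arcs R m H i by [].
move: H2 H3; rewrite mulrDr -mulrA [f k.+1]fE; move: (T * f k) => Y h2 h3.
by rewrite fE; lra.
Qed.

Lemma leq_id_Mb a : (a <= Mb a)%N.
Proof. by rewrite /Mb expnS expn1; nia. Qed.

Lemma leq_HHk k H : (k <= H)%N -> (H + H + k <= 4 * H)%N.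
Proof. by lia. Qed.

Lemma gf_ge_walk (F : realFieldType) (x : F) m (Q : pred (seq bool)) h : 0 <= x ->
  Q h -> (size h < m)%N -> x ^+ size h <= gf x m Q.
Proof.
move=> x0 q sz; rewrite /gf (big_rem h) ?mem_lwords //= q lerDl.
by apply: sumr_ge0 => g _; exact: exprn_ge0.
Qed.

(** The critical fugacity is at least the inverse of the connective constant.  Otherwise long
    walks have exponentially small weight.  Then the weight of the walks that do not return to
    the base of a domain of width [H] decreases from one height to the next by factors whose
    product is bounded below, so at the height [H] it is still of order 1.  But these walks are
    longer than [H], a contradiction. *)
Lemma saws_ge1 (R : realType) n : 1 <= saws R n.
Proof.
case: n => [|n]; first by rewrite /saws /= big_cons big_nil /= expr0 addr0.
rewrite leNgt; apply/negP => /(saws_geometric (ltn0Sn n))[K [r [r0 r1 K0 HK]]].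
have r1' : 0 < 1 - r by lra.
have rn1 : 1 - r != 0 by rewrite gt_eqF.
set T := K / (1 - r); have T0 : 0 <= T by rewrite divr_ge0 // ltW.
have hT m k : gf xc m (longer k) <= T * r ^+ k by exact: gf_longer.
have [N HN] := @geometric_small R r ((1 - r) / (4 * (T + 1))) r0 r1
   (divr_gt0 r1' (mulr_gt0 (ltr0n _ 4) (ltr_wpDl T0 ltr01))).
have [k0 k0E k00] : exists2 k0, k0 = N.+1 & (0 < k0)%N by exists N.+1.
have rk0 : T * r ^+ k0 <= (1 - r) / 4.
  have := HN k0 (ltac:(rewrite k0E; exact: leqnSn)); rewrite ltr_pdivlMr; last by lra.
  by have : 0 <= r ^+ k0 by [rewrite exprn_ge0 // ltW]; nra.
have x0 := xc_gt0 R.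
have xk0 : 0 < xc ^+ (2 * k0) / (6 * (T + 1)) :> R.
  by rewrite divr_gt0 ?exprn_gt0 // mulr_gt0 //; lra.
have [N' HN'] := geometric_small r0 r1 xk0.
have [H HE] : exists H, H = (k0 + N')%N by eexists.
have [m hm] : exists m, (Mb (4 * H) < m)%N by exists (Mb (4 * H)).+1.
pose f := nonarc R m H.
have s0 := sn_gt0 R; have c0 := cs_gt0 R; have c1 := cs_le1 R.
(* A bound that does not depend on H. *)
have low : xc ^+ (2 * k0) <= f k0.
  have hm' : (Mb (H + H + k0) < m)%N by apply: leq_ltn_trans hm; apply: leq_Mb; rewrite leq_HHk // HE leq_addr.
  have [I _] := dom_identities R k00 hm'; rewrite -(gf_exBl R m H H k00) in I.
  have e1 := @gf_ge0 R xc m (exL H H k0) (xc_ge0 R).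
  have e2 := @gf_ge0 R xc m (exR H H k0) (xc_ge0 R).
  have : xc ^+ (2 * k0) <= gf xc m (exT H H k0) :> R.
    have [sz _ _ _ _] := zigzagP k0; rewrite -sz; apply: gf_ge_walk; first exact: xc_ge0.
      by apply: exT_zigzag; rewrite // HE leq_addr.
    by rewrite sz; apply: leq_ltn_trans hm; apply: leq_trans (leq_id_Mb _); rewrite leq_mul // HE leq_addr.
  rewrite /f /nonarc /arcs; move: I; nra.
have fanti i j : (i <= j)%N -> f j <= f i.
  by move=> ij; rewrite /f /nonarc lerD2l lerN2 ler_pM2l ?mulr_gt0 //; apply: gf_exBl_sub.
have fk0 : 0 <= f k0 by apply: le_trans low; rewrite exprn_ge0 // ltW.
(* The losses 2 T r ^ i of the increments from k0 on add up to a geometric series. *)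
have chain p : (p <= N')%N ->
    f k0 * (1 - 2 * T * (r ^+ k0 - r ^+ (k0 + p)) / (1 - r)) <= f (k0 + p)%N.
  elim: p => [|p IH] pN; first by rewrite addn0 subrr mulr0 mul0r subr0 mulr1.
  rewrite addnS; apply: le_trans (@arcs_increment R m H (k0 + p) (T * r ^+ (k0 + p)) _ _ hm (hT _ _)).
  - have rp : 0 <= r ^+ (k0 + p) by rewrite exprn_ge0 // ltW.
    have h1 : T * r ^+ (k0 + p) * f (k0 + p)%N <= T * r ^+ (k0 + p) * f k0.
      by apply: ler_wpM2l; [exact: mulr_ge0|apply: fanti; rewrite leq_addr].
    have h2 := IH (ltnW pN).
    have -> : f k0 * (1 - 2 * T * (r ^+ k0 - r ^+ (k0 + p).+1) / (1 - r)) =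
      f k0 * (1 - 2 * T * (r ^+ k0 - r ^+ (k0 + p)) / (1 - r)) - 2 * (T * r ^+ (k0 + p) * f k0).
      by rewrite exprS; field.
    rewrite -[nonarc R m H _]/(f _) -(mulrA 2 (T * _) (f _)).
    by apply: lerB; [exact: h2|rewrite ler_pM2l //; exact: h1].
  - by rewrite addn_gt0 k00.
  - by rewrite HE leq_add2l ltnW.
have half : f k0 / 2 <= f H.
  rewrite HE; apply: le_trans (chain N' (leqnn _)); rewrite ler_wpM2l //.
  have rH : 0 <= r ^+ (k0 + N') by rewrite exprn_ge0 // ltW.
  have : 2 * T * (r ^+ k0 - r ^+ (k0 + N')) / (1 - r) <= 1 / 2.
    by rewrite ler_pdivrMr //; nra.
  by move: (2 * T * _ / _) => z hz; lra.
(* At the height H every exit other than through the base is far from the origin. *)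
have up : f H <= 3 * (T * r ^+ H).
  have H0 : (0 < H)%N by rewrite HE addn_gt0 k00.
  have hm' : (Mb (H + H + H) < m)%N by apply: leq_ltn_trans hm; apply: leq_Mb; rewrite leq_HHk.
  have [I _] := dom_identities R H0 hm'; rewrite -(gf_exBl R m H H H0) in I.
  have e1 : gf xc m (exL H H H) <= T * r ^+ H.
    by apply: le_trans (hT m H); apply: gf_sub => //; [exact: ltW|move=> h; exact: exL_longer].
  have e2 : gf xc m (exR H H H) <= T * r ^+ H.
    by apply: le_trans (hT m H); apply: gf_sub => //; [exact: ltW|move=> h; exact: exR_longer].
  have e3 : gf xc m (exT H H H) <= T * r ^+ H.
    by apply: le_trans (hT m H); apply: gf_sub => //; [exact: ltW|move=> h; exact: exT_longer].
  have e4 := @gf_ge0 R xc m (exL H H H) (ltW x0).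
  have e5 := @gf_ge0 R xc m (exR H H H) (ltW x0).
  rewrite /f /nonarc /arcs; move: I e1 e2 e3 e4 e5; move: (gf _ _ (exL _ _ _)) (gf _ _ (exR _ _ _)) (gf _ _ (exT _ _ _)) (gf _ _ (exBl _ _ _)) (T * _) => a b c d e.
  by nra.
have := HN' H (ltac:(rewrite HE; exact: leq_addl)); rewrite ltr_pdivlMr; last by rewrite mulr_gt0 //; lra.
move=> h; have : T * r ^+ H <= (T + 1) * r ^+ H.
  by rewrite ler_wpM2r ?exprn_ge0 ?(ltW r0) //; lra.
have x2 : 0 < xc ^+ (2 * k0) :> R by exact: exprn_gt0.
move: h low half up; rewrite mulrCA [r ^+ H * _]mulrC; set Y := (T + 1) * _; set Z := T * _; lra.
Qed.

(** * Walks in strips *)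

Definition strip (k : nat) (p : eis) : bool := (0 <= ht p) && (ht p < 3 * k%:Z).
Definition instrip k h := uniq (vis h) && all (strip k) (vis h).
Definition crossup k h := exits (strip k) h && outT k (pos h).
Definition arcdown k h := exits (strip k) h && outB (pos h).

Lemma vis_pos z h : z \in vis h -> exists2 g, z = pos g & (size g <= size h)%N.
Proof.
elim: h => // b h IH; rewrite inE => /orP[/eqP ->|/IH [g -> gs]]; first by exists h.
by exists g => //; exact: leqW.
Qed.

(** Walks of bounded length do not feel the sides of a wide domain. *)
Lemma strip_dom k h D : (size h <= D)%N -> exits (strip k) h -> exits (dom D D k) h.
Proof.
move=> hD /and3P[u a n]; rewrite /exits u /=; apply/andP; split.
  apply/allP => z zh; have /andP[h1 h2] := allP a z zh; rewrite /dom h1 h2 /=.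
  by have [g zE gh] := vis_pos zh; have [_] := pos_bound g; rewrite -zE; lia.
by apply: contra n => /and4P[h1 h2 _ _]; rewrite /strip h1 h2.
Qed.

Lemma exits_strip k h : (0 < k)%N -> exits (strip k) h ->
  [/\ dir h = -1, ht (pos h) = -2, outB (pos h) & ~~ outT k (pos h)] \/
  [/\ dir h = 1, ht (pos h) = 3 * k%:Z, ~~ outB (pos h) & outT k (pos h)].
Proof.
move=> k0 ex; have ex' := strip_dom (leqnn _) ex; have /and3P[_ _ n] := ex.
case: (exits_dom k0 ex') => -[E -> n1 n2 n3].
- by left; split=> //; rewrite /outB E.
- by exfalso; move: n n1 n3; rewrite /strip /outB /outT; lia.
- by exfalso; move: n n1 n3; rewrite /strip /outB /outT; lia.
- by right; split=> //; rewrite /outT E.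
Qed.

Lemma gf_sub_size (F : realFieldType) (x : F) m m' (Q Q' : pred (seq bool)) :
  0 <= x -> (m <= m')%N -> (forall h, (size h < m)%N -> Q h -> Q' h) -> gf x m Q <= gf x m' Q'.
Proof.
move=> x0 mm H; apply: (@ler_sum_inj _ _ _ _ _ _ _ _ _ id) => //; first exact: uniq_lwords.
  by move=> h; rewrite !mem_lwords => hm q; split=> //; [exact: leq_trans mm|exact: H].
by move=> h _; exact: exprn_ge0.
Qed.

(** By the first relation the arcs have weight at most 1 / sin (pi / 8). *)
Lemma gf_arcdown (R : realType) m k : (0 < k)%N -> gf xc m (arcdown k) <= 3 :> R.
Proof.
move=> k0; set m' := maxn m (Mb (m + m + k)).+1.
have mm : (m <= m')%N by rewrite leq_maxl.
have hm : (Mb (m + m + k) < m')%N by rewrite leq_maxr.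
have [I _] := dom_identities R k0 hm.
have e1 := @gf_ge0 R xc m' (exL m m k) (xc_ge0 R).
have e2 := @gf_ge0 R xc m' (exR m m k) (xc_ge0 R).
have e3 := @gf_ge0 R xc m' (exT m m k) (xc_ge0 R).
have e4 : 0 <= cs * (gf xc m' (exL m m k) + gf xc m' (exR m m k)) :> R.
  by apply: mulr_ge0; [exact/ltW/cs_gt0|exact: addr_ge0].
have H : gf xc m (arcdown k) <= gf xc m' (exBl m m k) + gf xc m' (exBr m m k) :> R.
  apply: le_trans (gf_or (Q := fun h => (size h < m)%N && arcdown k h) _ (xc_ge0 R) _).
    by apply: gf_sub_size => //; [exact: xc_ge0|move=> h hm' ->; rewrite hm'].
  move=> h /andP[hs /andP[/(strip_dom (ltnW hs)) ex o]].
  by rewrite /exBl /exBr ex o; case: (0 < _).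
apply: (le_trans H); move: I e3 e4; set X := _ + gf _ _ (exBr _ _ _) => I e3 e4.
have h1 : sn * X <= 1 by lra.
by have := sn_ge R; nra.
Qed.

(** A wide domain of the height of the strip contains the triangle of size [b]. *)
Lemma gf_crossup (R : realType) m k b : (2 * b < k)%N ->
  exists2 m', (m <= m')%N /\ (Mb (10 * b) < m')%N & gf xc m (crossup k) <= esc R m' b.
Proof.
move=> bk; have k0 : (0 < k)%N by lia.
set D := maxn m b; exists (maxn (maxn m (Mb (10 * b)).+1) (Mb (D + D + k)).+1).
  by split; rewrite !leq_max ?leqnn ?orbT.
set m' := maxn _ _; have hm : (Mb (D + D + k) < m')%N by rewrite leq_maxr.
have := @exits_le_esc R m' b D D k k0 (leq_maxr _ _) (leq_maxr _ _) bk hm.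
have e1 := @gf_ge0 R xc m' (exL D D k) (xc_ge0 R).
have e2 := @gf_ge0 R xc m' (exR D D k) (xc_ge0 R).
have e4 : 0 <= cs * (gf xc m' (exL D D k) + gf xc m' (exR D D k)) :> R.
  by apply: mulr_ge0; [exact/ltW/cs_gt0|exact: addr_ge0].
have : gf xc m (crossup k) <= gf xc m' (exT D D k) :> R.
  apply: gf_sub_size; [exact: xc_ge0|by rewrite !leq_max leqnn|].
  move=> h hs /andP[ex o]; rewrite /exT o andbT; apply: strip_dom ex.
  by rewrite leq_max ltnW.
by lra.
Qed.

Lemma gf_crossup_le1 (R : realType) m k : (0 < k)%N -> gf xc m (crossup k) <= 1 :> R.
Proof.
move=> k0; have [m' _ H] := @gf_crossup R m k 0 k0.
exact: le_trans H (esc_le1 R m' 0).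
Qed.

Lemma gf_crossup_decay (R : realType) m j : gf xc m (crossup (3 * 1000 ^ j)) <= (9 / 10) ^+ j :> R.
Proof.
have q0 : (0 < 1000 ^ j)%N by rewrite expn_gt0.
have [|m' [_ hm] H] := @gf_crossup R m (3 * 1000 ^ j) (1000 ^ j); first by lia.
by apply: le_trans H _; have [] := esc_decay R hm.
Qed.

(** * All walks in a strip: the Hammersley-Welsh argument *)

(** The last step of the walk leads across the top line of the strip of [k] rows, upwards if [s]
    holds and downwards otherwise. *)
Definition crossing k (s : bool) (g : seq bool) : bool :=
  if g is _ :: g' then (outT k (pos g') == ~~ s) && (outT k (pos g) == s) else false.

(** Cut at the last crossing of the line, the walk stays on one side afterwards. *)
Lemma last_crossing k h : (0 < k)%N -> ~~ all (fun z => ~~ outT k z) (vis h) ->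
  exists l g s, [/\ h = l ++ g, l != [::], crossing k s g &
    all (fun z => outT k (pos g + dir g * z) == s) (vis l)].
Proof.
move=> k0; elim: h => // b h IH; rewrite [vis _]/= [all _ _]/= negb_and negbK.
have [a /= ot|/IH [l [g [s [-> l0 c al]]]] _] := boolP (all _ (vis h)).
  rewrite orbF in ot; exists [:: b], h, true; split=> //.
    case: (h) a ot => [|b' h'] /=; first by rewrite /outT /ht /=; lia.
    by move=> /andP[/negbTE -> _] ->.
  by rewrite /= mulr0 addr0 ot.
have [os|os] := boolP (outT k (pos (l ++ g)) == s).
  by exists (b :: l), g, s; split=> //=; rewrite -pos_cat os al.
exists [:: b], (l ++ g), (~~ s); split=> //; last first.
  by rewrite /= mulr0 addr0 andbT; move: os; case: (outT _ _); case: (s).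
case: (l) l0 al os => // c1 l1 _ /= /andP[ol _] os.
by rewrite -pos_cat in ol; rewrite negbK ol /=; move: os => /=; case: (outT _ _); case: (s).
Qed.

Lemma crossing_values k s g : crossing k s g ->
  if s then dir g = 1 /\ ht (pos g) = 3 * k%:Z
  else dir g = -1 /\ ht (pos g) = 3 * k%:Z - 2.
Proof.
case: g => // b g /andP[]; have [m Em] := ht_mod3 g; have [m' Em'] := ht_mod3 (b :: g).
have := unit6_dir (b :: g); rewrite /unit6 !inE => ud.
move: Em'; rewrite !pos_cons /outT htD; case: s.
all: case/or4P: ud => [|||/or3P[]] /eqP ->.
all: rewrite /ht /= => Em' h1 h2.
all: by first [split; [by []|rewrite /ht /= in Em; lia] | exfalso; rewrite /ht in Em; lia].
Qed.

Definition crossed k s g := instrip k.+1 g && crossing k s g.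

Lemma vis_mod3 z h : z \in vis h -> exists m, ht z = 3 * m \/ ht z = 3 * m + 1.
Proof. by move=> /vis_pos [g -> _]; exact: ht_mod3. Qed.

(** After the last crossing of the line between the two topmost rows of [k.+1], the walk stays in
    the top row or in the strip of [k] rows below, which it sees upside down in its own frame. *)
Lemma strip_split k h : (0 < k)%N -> instrip k.+1 h -> ~~ all (strip k) (vis h) ->
  exists l g s, [/\ h = l ++ g, l != [::], crossed k s g & if s then instrip 1 l else instrip k l]
   /\ all (fun z => outT k (pos g + dir g * z) == s) (vis l).
Proof.
move=> k0 /andP[u a] n.
have /(last_crossing k0)[l [g [s [hE l0 c al]]]] : ~~ all (fun z => ~~ outT k z) (vis h).
  apply: contra n => a'; apply/allP => z zh.
  by have := allP a z zh; have := allP a' z zh; rewrite /strip /outT; lia.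
exists l, g, s; rewrite hE in u a; split=> //.
have [ul ug] := uniq_vis_cat u.
move: (a); rewrite vis_cat all_cat all_map => /andP[a1 a2].
split=> //; first by rewrite /crossed /instrip ug a2 c.
have cv := crossing_values c; case: s c al cv => c al [d hp]; rewrite /instrip ul /=.
  apply/allP => z zl; have := allP a1 z zl; have := allP al z zl.
  by rewrite /= d mul1r /strip /outT htD hp; lia.
apply/allP => z zl; have := allP a1 z zl; have := allP al z zl.
have [m Em] := vis_mod3 zl.
by rewrite /= d mulN1r /strip /outT htD htN hp; lia.
Qed.

(** Shortening walks does not decrease their weights, as long as the fugacity is at most 1. *)
Lemma gf_inj_le (F : realFieldType) (x : F) m (Q Q' : pred (seq bool)) phi :
  0 <= x -> x <= 1 ->
  (forall h, Q h -> Q' (phi h) /\ (size (phi h) <= size h)%N) ->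
  (forall h g, Q h -> Q g -> phi h = phi g -> h = g) ->
  gf x m Q <= gf x m Q'.
Proof.
move=> x0 x1 H inj; apply: (@ler_sum_inj _ _ _ _ _ _ _ _ _ phi) => //; first exact: uniq_lwords.
  move=> h; rewrite !mem_lwords => hm q; have [q' sz] := H h q; split=> //.
    exact: leq_ltn_trans hm.
  exact: ler_wiXn2l.
by move=> h _; exact: exprn_ge0.
Qed.

Lemma xc_le1 (R : realType) : xc <= 1 :> R.
Proof. by have := xc_le R; lra. Qed.

(** The turn before a walk crosses the top line downwards could have been replaced by an exit
    through the top of the strip. *)
Lemma crossed_down_shape k g : (0 < k)%N -> crossed k false g ->
  exists c g2, g = [:: c, c & g2] /\ crossup k.+1 (~~ c :: g2).
Proof.
move=> k0 /andP[/andP[u a] /[dup] c /crossing_values[d hp]].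
case: g u a c d hp => // c1 [|c2 g2] u a; first by case: c1 {u a}.
move=> cr d hp; exists c1, g2.
have h1 : ht (pos (c2 :: g2)) = 3 * k%:Z.
  by move: hp; rewrite pos_cons d htD htM1; lia.
move: a; rewrite [vis _]/= [all _ _]/= -!/(vis _) => /and3P[s1 s2 a2].
have u2 : uniq (pos g2 :: vis g2) by move: u => /= /andP[].
have dc : dir (c2 :: g2) = - turn (~~ c1).
  have := congr1 (fun z => turn (~~ c1) * z) d; rewrite /= mulrA [turn (~~ c1) * turn c1]mulrC.
  by rewrite turnV mul1r mulrN1.
have h2 : ht (pos g2) = 3 * k%:Z + 1.
  by move: h1; rewrite pos_cons dc htD htN; case: (c1) => /=; rewrite /ht /=; lia.
have d2 : dir g2 = - (turn (~~ c1) * turn (~~ c2)).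
  have := congr1 (fun z => turn (~~ c2) * z) dc; rewrite /= mulrA [turn (~~ c2) * turn c2]mulrC.
  by rewrite turnV mul1r mulrN mulrC.
have n2 : dir g2 != -1.
  case: g2 {u u2 h1 s1 cr d hp dc d2} s2 h2 a2 => // b3 g3 s2 h2.
  rewrite [vis _]/= [all _ _]/= => /andP[s3 _]; apply/eqP => E.
  by move: s3 h2; rewrite /strip pos_cons E htD htM1; lia.
have cc : c2 = c1.
  by apply: contraNeq n2; rewrite d2; case: (c1); case: (c2).
have d3 : dir (~~ c1 :: g2) = 1 by rewrite /= d2 cc; case: (c1).
split; first by rewrite cc.
rewrite /crossup /exits [vis _]/= [all _ _]/= u2 s2 a2 /=.
rewrite -[pos g2 + _]/(pos (~~ c1 :: g2)).
have h3 : ht (pos (~~ c1 :: g2)) = 3 * k%:Z + 3 by rewrite pos_cons d3 htD ht1 h2; lia.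
by rewrite /strip /outT h3; lia.
Qed.

Lemma gf_crossed_down (R : realType) m k : (0 < k)%N -> gf xc m (crossed k false) <= 1 :> R.
Proof.
move=> k0; apply: le_trans (gf_crossup_le1 R m (ltn0Sn k)).
pose phi h := if h is c :: _ :: g then ~~ c :: g else [::].
apply: (@gf_inj_le _ _ _ _ _ phi (xc_ge0 R) (xc_le1 R)).
  by move=> h /(crossed_down_shape k0)[c [g [-> e]]].
by move=> h h' /(crossed_down_shape k0)[c [g [-> _]]] /(crossed_down_shape k0)[c' [g' [-> _]]] /= [/(congr1 negb)]; rewrite !negbK => -> ->.
Qed.

(** Either the walk stays in the lower strip until it leaves it for the first time, or what follows
    its last crossing downwards is an arc, seen upside down. *)
Lemma crossed_up_shape k g : (0 < k)%N -> crossed k true g -> crossup k g \/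
  exists l g1, [/\ g = l ++ g1, arcdown k l & crossed k false g1].
Proof.
move=> k0 /andP[ig cg]; have [d hp] := crossing_values cg; have /andP[u a] := ig.
have [ak|nk] := boolP (all (strip k) (vis g)).
  by left; rewrite /crossup /exits u ak /strip /outT hp /=; lia.
right; have [l [g1 [s [[gE l0 c1 i1] al]]]] := strip_split k0 ig nk.
have sF : s = false.
  move: cg al; rewrite gE; case: (l) l0 => // c' l' _ /= /andP[/eqP o _] /andP[/eqP + _].
  by rewrite -pos_cat o.
rewrite sF in c1 i1; exists l, g1; split=> //.
have /andP[_ /crossing_values [d1 h1]] := c1; have /andP[ul al'] := i1.
have hl : ht (pos l) = -2.
  by clear -hp gE d1 h1; move: hp; rewrite gE pos_cat d1 mulN1r htD htN h1; lia.
by rewrite /arcdown /exits ul al' /strip /outB hl.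
Qed.

(** A boolean form of the splittings in [gf_cat], so that such walks can be summed over. *)
Definition catp (Q1 Q2 : pred (seq bool)) (h : seq bool) : bool :=
  has (fun i => Q1 (take i h) && Q2 (drop i h)) (iota 0 (size h).+1).

Lemma catpI (Q1 Q2 : pred (seq bool)) l g : Q1 l -> Q2 g -> catp Q1 Q2 (l ++ g).
Proof.
move=> q1 q2; apply/hasP; exists (size l).
  by rewrite mem_iota add0n ltnS size_cat leq_addr.
by rewrite take_size_cat // drop_size_cat // q1 q2.
Qed.

Lemma gf_catp (F : realFieldType) (x : F) m (Q1 Q2 : pred (seq bool)) : 0 <= x ->
  gf x m (catp Q1 Q2) <= gf x m Q1 * gf x m Q2.
Proof.
move=> x0; apply: gf_cat => // h /hasP[i _ /andP[q1 q2]].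
by exists (take i h), (drop i h); rewrite cat_take_drop.
Qed.

Lemma gf_crossed_up (R : realType) m k : (0 < k)%N -> gf xc m (crossed k true) <= 4 :> R.
Proof.
move=> k0.
apply: (@le_trans _ _ (gf xc m (crossup k) + gf xc m (catp (arcdown k) (crossed k false)))).
  apply: gf_or; first exact: xc_ge0.
  move=> g /(crossed_up_shape k0)[->//|[l [g1 [-> q1 q2]]]].
  by rewrite catpI ?orbT.
have := gf_crossup_le1 R m k0; have := gf_arcdown R m k0; have := gf_crossed_down R m k0.
have := @gf_catp _ _ m (arcdown k) (crossed k false) (xc_ge0 R).
have := @gf_ge0 R xc m (crossed k false) (xc_ge0 R).
have := @gf_ge0 R xc m (arcdown k) (xc_ge0 R).
by nra.
Qed.

(** In a single row a walk has no choice after its first step. *)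
Lemma row_step h : uniq (vis h) -> all (strip 1) (pos h :: vis h) -> h != [::] ->
  ~~ (strip 1 (pos (true :: h)) && strip 1 (pos (false :: h))).
Proof.
case: h => // b h _ /and3P[s0 s1 _] _.
have [m Em] := ht_mod3 h; have [m' Em'] := ht_mod3 (b :: h).
have := unit6_dir (b :: h); rewrite /unit6 !inE => ud.
have pE c : pos (c :: b :: h) = pos h + dir (b :: h) + turn c * dir (b :: h) by [].
move: s0 s1 Em Em'; rewrite !pE pos_cons.
case/or4P: ud => [|||/or3P[]] /eqP ->; rewrite /strip !htD; move: (ht (pos h)) => y.
all: by rewrite /ht /=; lia.
Qed.

Definition row_words n := \sum_(h <- words n | uniq (vis h) && all (strip 1) (pos h :: vis h)) 1%N.

Lemma row_words_le2 n : (row_words n <= 2)%N.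
Proof.
have step p : (0 < p)%N -> (row_words p.+1 <= row_words p)%N.
  move=> p0; rewrite /row_words big_mkcond sum_wordsS [X in (_ <= X)%N]big_mkcond.
  rewrite big_seq [X in (_ <= X)%N]big_seq; apply: leq_sum => h; rewrite mem_words => /eqP hp.
  have h0 : h != [::] by rewrite -size_eq0 hp -lt0n.
  rewrite ![vis (_ :: h)]/= !cons_uniq.
  have := @row_step h; case: (uniq (vis h)); last by rewrite !andbF.
  rewrite ![all (strip 1) (_ :: _)]/=; case: (strip 1 (pos h) && _) => /= H; last by rewrite !andbF.
  have := H isT isT h0; rewrite !andbT.
  by case: (_ \notin _); case: (strip _ _); case: (strip _ _).
elim: n => [|[|n] IH].
- by rewrite /row_words /= big_cons big_nil.
- rewrite /row_words big_mkcond sum_wordsS /= big_cons big_nil.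
  by rewrite /=.
- exact: leq_trans (step _ _) IH.
Qed.

Lemma gf_row (R : realType) m : gf xc m (instrip 1) <= 12 :> R.
Proof.
have x0 := xc_ge0 R; have x1 := xc_le R; have xp := xc_gt0 R.
have step n : \sum_(h <- words n.+1 | instrip 1 h) xc ^+ size h <= 4 * xc ^+ n.+1 :> R.
  apply: (@le_trans _ _ ((2 * row_words n)%:R * xc ^+ n.+1)); last first.
    rewrite ler_wpM2r ?exprn_ge0 // -[4]/(4%:R) ler_nat.
    by have := row_words_le2 n; lia.
  rewrite /row_words big_mkcond sum_wordsS natrM raddf_sum /= mulr_sumr mulr_suml.
  rewrite [leRHS]big_mkcond /= big_seq [leRHS]big_seq; apply: ler_sum => h; rewrite mem_words => /eqP hn.
  rewrite /instrip [vis (true :: _)]/= [vis (false :: _)]/= !cons_uniq hn.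
  rewrite ![all (strip 1) (_ :: _)]/=.
  by case: (_ \notin _); case: (uniq _); case: (strip _ _ && _) => //=;
    have := exprn_ge0 n.+1 x0; lra.
(* 10 is 4 / (1 - 3 / 5), from a geometric series of ratio at most 3 / 5. *)
suff: gf xc m (instrip 1) <= 10 - 10 * xc ^+ m + 2 :> R.
  by have := exprn_ge0 m x0; lra.
case: m => [|m]; first by rewrite /gf big_nil expr0; lra.
elim: m => [|m IH].
  by rewrite /gf /= big_cons big_nil /= expr0 expr1; lra.
rewrite /gf [lwords _]/= big_cat /=; apply: le_trans (lerD IH (step m)) _.
rewrite (exprS _ m.+1); have : 0 <= xc ^+ m.+1 :> R by exact: exprn_ge0.
by nra.
Qed.

(** The walks in [k.+2] rows that enter the topmost row are split at their last crossing of the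
    line below it ([strip_split]).  With the bounds for the crossing parts this gives
    a' <= a + 12 * 4 + a. *)
Lemma gf_instrip (R : realType) m k : gf xc m (instrip k.+1) <= 60 * 2 ^+ k - 48 :> R.
Proof.
elim: k => [|k IH]; first by rewrite expr0; have := gf_row R m; lra.
set a := gf xc m (instrip k.+1) in IH.
have H : gf xc m (instrip k.+2) <= a + (gf xc m (catp (instrip 1) (crossed k.+1 true)) +
    gf xc m (catp (instrip k.+1) (crossed k.+1 false))).
  apply: le_trans (gf_or m _ _) (lerD (lexx _) (gf_or m _ _)); try exact: xc_ge0.
    move=> h ih; instantiate (1 := fun h => catp (instrip 1) (crossed k.+1 true) h || catp (instrip k.+1) (crossed k.+1 false) h).
    have /andP[u _] := ih; rewrite {1}/instrip u /=.
    have [//|n /=] := boolP (all _ _).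
    have [l [g [s [[-> l0 c i] _]]]] := strip_split (ltn0Sn k) ih n.
    by case: s c i => c i; apply/orP; [left|right]; apply: catpI.
  by [].
apply: (le_trans H); rewrite exprS.
have := gf_row R m; have := gf_crossed_up R m (ltn0Sn k); have := gf_crossed_down R m (ltn0Sn k).
have := @gf_catp _ _ m (instrip 1) (crossed k.+1 true) (xc_ge0 R).
have := @gf_catp _ _ m (instrip k.+1) (crossed k.+1 false) (xc_ge0 R).
have := @gf_ge0 R xc m (crossed k.+1 false) (xc_ge0 R).
have := @gf_ge0 R xc m (crossed k.+1 true) (xc_ge0 R).
have := @gf_ge0 R xc m (instrip 1) (xc_ge0 R).
have := @gf_ge0 R xc m (instrip k.+1) (xc_ge0 R); rewrite -/a.
move: (gf _ _ (catp _ _)) (gf _ _ (catp _ _)) (gf _ _ _) (gf _ _ _) (gf _ _ _) => C1 C2 V U I1.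
move=> a0 i0 u0 v0 c1 c2 v1 u1 i1.
have : a * V <= a by rewrite -[leRHS]mulr1 ler_wpM2l.
have : I1 * U <= 48.
  by apply: (@le_trans _ _ (12 * 4)); [apply: ler_pM|lra].
lra.
Qed.

(** * Cutting a walk along equidistant lines *)

(** The index of the strip of [k] rows that contains a vertex. *)
Definition slab (k : nat) (z : eis) : int := (ht z %/ (3 * k%:Z))%Z.

Fixpoint changes (f : eis -> int) (h : seq bool) : nat :=
  if h is _ :: h' then ((f (pos h) != f (pos h')) + changes f h')%N else 0%N.

Lemma changes_cons f b h :
  changes f (b :: h) = ((f (pos (b :: h)) != f (pos h)) + changes f h)%N.
Proof. by []. Qed.

Definition points h := pos h :: vis h.

Lemma changes_cat f l g :
  changes f (l ++ g) = (changes (fun z => f (pos g + dir g * z)%R) l + changes f g)%N.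
Proof.
elim: l => // b l IH; rewrite cat_cons !changes_cons IH -cat_cons !pos_cat.
by rewrite addnA.
Qed.

Lemma points_cat l g : points (l ++ g) = [seq pos g + dir g * z | z <- points l] ++ vis g.
Proof. by rewrite /points pos_cat vis_cat. Qed.

Lemma points_pos z h : z \in points h -> exists g, z = pos g.
Proof. by rewrite inE => /orP[/eqP ->|/vis_pos [g -> _]]; [exists h|exists g]. Qed.

Lemma points0 h : 0 \in points h.
Proof. by elim: h => // b h IH; rewrite inE IH orbT. Qed.

Lemma eq_changes (f f' : eis -> int) (phi : int -> int) h : injective phi ->
  (forall g, f (pos g) = phi (f' (pos g))) -> changes f h = changes f' h.
Proof.
by move=> inj H; elim: h => // b h IH; rewrite !changes_cons IH !H (inj_eq inj).
Qed.

Lemma slab_strip k z : (0 < k)%N -> strip k z = (slab k z == 0).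
Proof.
move=> k0; have d0 : 0 < 3 * k%:Z :> int by lia.
rewrite /strip /slab; apply/idP/eqP => [|H].
  by rewrite -[X in _ < X]gtr0_norm // => /divz_small.
have := divz_eq (ht z) (3 * k%:Z); rewrite H mul0r add0r => ->.
by rewrite modz_ge0 ?gt_eqF // ltz_pmod.
Qed.

Lemma slab_up k z : (0 < k)%N -> ((3 * k%:Z + ht z) %/ (3 * k%:Z))%Z = slab k z + 1.
Proof.
move=> k0; have d0 : 3 * k%:Z != 0 :> int by lia.
by rewrite -[3 * k%:Z as X in X + _]mul1r (divzMDl _ _ d0) addrC.
Qed.

Lemma slab_down k g : (0 < k)%N ->
  ((-2 - ht (pos g)) %/ (3 * k%:Z))%Z = -1 - slab k (pos g).
Proof.
move=> k0; have [m Em] := ht_mod3 g; rewrite /slab.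
set q := (ht (pos g) %/ _)%Z.
have d0 : 3 * k%:Z != 0 :> int by lia.
have e := divz_eq (ht (pos g)) (3 * k%:Z); rewrite -/q in e.
have r0 := modz_ge0 (ht (pos g)) d0.
have r1 := @ltz_pmod (ht (pos g)) (3 * k%:Z) (ltac:(lia)).
set r := (_ %% _)%Z in e r0 r1.
have -> : -2 - ht (pos g) = (-1 - q) * (3 * k%:Z) + (3 * k%:Z - 2 - r) by rewrite e; ring.
rewrite (divzMDl _ _ d0) divz_small ?addr0 //.
have {e} [j rm] : exists j, r = 3 * j \/ r = 3 * j + 1.
  exists (m - q * k%:Z); have -> : r = ht (pos g) - q * (3 * k%:Z) by rewrite e; ring.
  by case: Em => ->; [left|right]; ring.
by clear Em; lia.
Qed.

Lemma first_piece (f : eis -> int) h : f 0 = 0 -> ~~ all (fun z => f z == 0) (points h) ->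
  exists l g, [/\ h = l ++ g, all (fun z => f z == 0) (vis g), f (pos g) != 0 &
    (0 < changes f g)%N].
Proof.
move=> f0 n; have [[|c l] [g [E a np _]]] := @first_exit (fun z => f z == 0) (true :: h) n.
  by move: n; rewrite -[points h]/(vis (true :: h)) E a.
exists l, g; case: E => _ E; split=> //; case: (g) a np => [|b g'] /=; first by rewrite f0.
by move=> /andP[/eqP -> _] ->.
Qed.

Definition reach k M j h :=
  [&& uniq (vis h), (changes (slab k) h <= M)%N & has (fun z => j%:Z <= slab k z) (points h)].
Definition sink k M j h :=
  [&& uniq (vis h), (changes (slab k) h <= M)%N & has (fun z => slab k z <= - j%:Z) (points h)].

Lemma slab0 k : slab k 0 = 0.
Proof. by rewrite /slab div0z. Qed.

(** A far vertex cannot be in the first piece, so it belongs to the remaining walk in its own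
    frame. *)
Lemma has_shift (p q : int -> bool) (f : eis -> int) k l g :
  all (fun z => f z == 0) (vis g) -> ~~ p 0 ->
  (forall g', p (f (pos g + dir g * pos g')) -> q (slab k (pos g'))) ->
  has (fun z => p (f z)) (points (l ++ g)) -> has (fun z => q (slab k z)) (points l).
Proof.
move=> a p0 H; rewrite points_cat has_cat => /orP[|].
  rewrite has_map => /hasP[z zl pz]; apply/hasP; exists z => //.
  by have [g' E] := points_pos zl; rewrite E in pz *; exact: H.
by move=> /hasP[z zg]; rewrite (eqP (allP a z zg)) (negbTE p0).
Qed.

(** What remains after the first piece, when the frame of the remaining walk is not turned
    around.  Downwards the remaining walk must get one strip farther, since it starts in the
    strip above. *)
Lemma rest_up (f : eis -> int) k M l g :
  all (fun z => f z == 0) (vis g) -> (0 < changes f g)%N ->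
  (forall g', f (pos g + dir g * pos g') = slab k (pos g') + 1) ->
  uniq (vis (l ++ g)) -> (changes f (l ++ g) <= M.+1)%N ->
  (forall j, has (fun z => j%:Z <= f z) (points (l ++ g)) -> reach k M j.-1 l) /\
  (forall j, has (fun z => f z <= - j%:Z) (points (l ++ g)) ->
     sink k M (if j is 0 then 0 else j.+1) l).
Proof.
move=> a c fE u cM; have [ul _] := uniq_vis_cat u.
have cl : (changes (slab k) l <= M)%N.
  rewrite changes_cat (eq_changes (f' := slab k) _ (addIr 1) fE) in cM; lia.
split=> -[|j] H; apply/and3P; split=> //.
- by apply/hasP; exists (0 : eis); rewrite ?points0 // slab0.
- apply: (@has_shift (fun i => j.+1%:Z <= i) (fun i => j%:Z <= i) f k l g a _ _ H); first by lia.
  by move=> g'; rewrite fE; lia.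
- by apply/hasP; exists (0 : eis); rewrite ?points0 // slab0.
- apply: (@has_shift (fun i => i <= - j.+1%:Z) (fun i => i <= - j.+2%:Z) f k l g a _ _ H); first by lia.
  by move=> g'; rewrite fE; lia.
Qed.

(** When the first piece leaves its strip through the bottom, the frame is turned around, so up and
    down change roles. *)
Lemma rest_down (f : eis -> int) k M l g :
  all (fun z => f z == 0) (vis g) -> (0 < changes f g)%N ->
  (forall g', f (pos g + dir g * pos g') = -1 - slab k (pos g')) ->
  uniq (vis (l ++ g)) -> (changes f (l ++ g) <= M.+1)%N ->
  (forall j, has (fun z => j%:Z <= f z) (points (l ++ g)) ->
     sink k M (if j is 0 then 0 else j.+1) l) /\
  (forall j, has (fun z => f z <= - j%:Z) (points (l ++ g)) -> reach k M j.-1 l).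
Proof.
move=> a c fE u cM; have [ul _] := uniq_vis_cat u.
have inj : injective (fun i : int => -1 - i) by move=> i i'; lia.
have cl : (changes (slab k) l <= M)%N.
  by rewrite changes_cat (eq_changes (f' := slab k) _ inj fE) in cM; lia.
split=> -[|j] H; apply/and3P; split=> //.
- by apply/hasP; exists (0 : eis); rewrite ?points0 // slab0.
- apply: (@has_shift (fun i => j.+1%:Z <= i) (fun i => i <= - j.+2%:Z) f k l g a _ _ H); first by lia.
  by move=> g'; rewrite fE; lia.
- by apply/hasP; exists (0 : eis); rewrite ?points0 // slab0.
- apply: (@has_shift (fun i => i <= - j.+1%:Z) (fun i => j%:Z <= i) f k l g a _ _ H); first by lia.
  by move=> g'; rewrite fE; lia.
Qed.

(** Strips are mapped to strips by the change of frame at an exit. *)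
Lemma slab_exit k g : (0 < k)%N -> uniq (vis g) -> all (fun z => slab k z == 0) (vis g) ->
  slab k (pos g) != 0 ->
  (crossup k g /\ forall g', slab k (pos g + dir g * pos g') = slab k (pos g') + 1) \/
  (arcdown k g /\ forall g', slab k (pos g + dir g * pos g') = -1 - slab k (pos g')).
Proof.
move=> k0 u a n.
have ex : exits (strip k) g.
  rewrite /exits u slab_strip // n andbT /=.
  by apply: sub_all a => z; rewrite slab_strip.
case: (exits_strip k0 ex) => -[d hp o1 o2]; [right|left].
- split; first by rewrite /arcdown ex o1.
  by move=> g'; rewrite {1}/slab d mulN1r htD htN hp slab_down.
- split; first by rewrite /crossup ex o2.
  by move=> g'; rewrite {1}/slab d mul1r htD hp slab_up.
Qed.

(** Induction on the number of cuts.  The first piece stays in its strip for ever, or it is a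
    crossing, of weight at most [b], or an arc, of weight at most 3; hence the factor
    5 = 1 + 1 + 3.  After an arc the frame is turned around, and a strip at distance [j] upwards
    lies at distance [j.+1] downwards.  Going down to distance [j] only takes [j.-1] crossings,
    since the first line is passed by an arc. *)
Lemma slab_bounds (R : realType) m k (b Q : R) : (0 < k)%N -> 0 <= b -> b <= 1 -> 0 <= Q ->
  gf xc m (crossup k) <= b -> gf xc m (instrip k) <= Q -> forall M j,
  gf xc m (reach k M j) <= 5 ^+ M * b ^+ j * Q /\ gf xc m (sink k M j) <= 5 ^+ M * b ^+ j.-1 * Q.
Proof.
move=> k0 b0 b1 Q0 hb hQ.
have x0 := xc_ge0 R.
have inside h : uniq (vis h) -> all (fun z => slab k z == 0) (points h) -> instrip k h.
  move=> u /andP[_ a]; rewrite /instrip u; apply: sub_all a => z; by rewrite slab_strip.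
have only0 (p : int -> bool) h : all (fun z => slab k z == 0) (points h) ->
    has (fun z => p (slab k z)) (points h) -> p 0.
  by move=> a /hasP[z zh]; rewrite (eqP (allP a z zh)).
have none (Q2 : pred (seq bool)) : (forall h, Q2 h -> False) -> gf xc m Q2 = 0 :> R.
  by move=> H; rewrite /gf big1 // => h /H.
have gs (Q2 : pred (seq bool)) : 0 <= gf xc m Q2 :> R by exact: gf_ge0.
have hd : gf xc m (arcdown k) <= 3 :> R by exact: gf_arcdown.
elim=> [|M IH] j.
  have ins h : uniq (vis h) -> (changes (slab k) h <= 0)%N -> all (fun z => slab k z == 0) (points h).
    move=> u c; apply: contraTT c => /(first_piece (slab0 k)) [l [g [-> _ _ c]]].
    by rewrite changes_cat -ltnNge addn_gt0 c orbT.
  case: j => [|j]; last first.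
    split; rewrite none ?mulr_ge0 ?exprn_ge0 // => h /and3P[u c H].
      by have := only0 (fun i => j.+1%:Z <= i) h (ins h u c) H.
    by have := only0 (fun i => i <= - j.+1%:Z) h (ins h u c) H.
  rewrite !expr0 !mul1r; split; apply: le_trans hQ; apply: gf_sub => // h /and3P[u c _];
  exact: inside (ins h u c).
set i := if j is 0 then 0%N else j.+1.
have bi : b ^+ i.-1 = b ^+ j by rewrite /i; case: (j).
have [IHr _] := IH j.-1; have [_ IHs] := IH i; rewrite bi in IHs.
have e5 : 1 <= 5 ^+ M :> R by rewrite exprn_ege1 //; lra.
have bj : 0 <= b ^+ j by exact: exprn_ge0.
have bj' : 0 <= b ^+ j.-1 by exact: exprn_ge0.
pose q0 : R := if j is 0 then Q else 0.
have q0P : q0 <= 5 ^+ M * b ^+ j * Q.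
  rewrite /q0; case: (j) bj => [_|j' bj0]; last by rewrite mulr_ge0 // mulr_ge0 // (le_trans ler01).
  by rewrite expr0 mulr1 ler_peMl.
have bb : b ^+ j <= b ^+ j.-1 by rewrite ler_wiXn2l // leq_pred.
have e50 : 0 <= 5 ^+ M :> R by lra.
set P := 5 ^+ M * Q; have P0 : 0 <= P by exact: mulr_ge0.
have bjb : b * b ^+ j.-1 <= b ^+ j.
  by case: (j) => [|j'] /=; [rewrite expr0 mulr1|rewrite -exprS].
have in0 (p : int -> bool) h : uniq (vis h) -> (j != 0%N -> ~~ p 0) ->
    all (fun z => slab k z == 0) (points h) -> has (fun z => p (slab k z)) (points h) ->
    (j == 0%N) && instrip k h.
  move=> u p0 a /(only0 p h a) p1; rewrite (inside h u a) andbT.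
  by apply: contraTT p1 => /p0.
have g0 : gf xc m (fun h => (j == 0%N) && instrip k h) <= q0.
  rewrite /q0; case: (j) => [|j']; first by apply: le_trans hQ; apply: gf_sub.
  by rewrite none.
have p1 (Q1 Q2 : pred (seq bool)) (A B : R) : gf xc m Q1 <= A -> gf xc m Q2 <= B -> gf xc m (catp Q1 Q2) <= A * B.
  by move=> h1 h2; apply: le_trans (gf_catp _ _ _ x0) _; exact: ler_pM.
have or3 (Q1 Q2 Q3 Q4 : pred (seq bool)) (A B C : R) : gf xc m Q2 <= A -> gf xc m Q3 <= B -> gf xc m Q4 <= C ->
    (forall h, Q1 h -> [|| Q2 h, Q3 h | Q4 h]) -> gf xc m Q1 <= A + (B + C).
  move=> h2 h3 h4 H; apply: le_trans (lerD h2 (lerD h3 h4)).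
  apply: le_trans (@gf_or _ _ m Q1 Q2 (fun h => Q3 h || Q4 h) x0 H) _.
  by rewrite lerD2l; apply: gf_or.
split.
- apply: (@le_trans _ _ (q0 + (5 ^+ M * b ^+ j.-1 * Q * b + 5 ^+ M * b ^+ j * Q * 3))).
    apply: (or3 _ _ _ _ _ _ _ g0 (p1 (reach k M j.-1) (crossup k) _ _ IHr hb)
      (p1 (sink k M i) (arcdown k) _ _ IHs hd)) => h /and3P[u c H].
    have [a|/(first_piece (slab0 k))[l [g [hE a n cg]]]] :=
      boolP (all (fun z => slab k z == 0) (points h)).
      rewrite (in0 (fun i => j%:Z <= i) h u _ a H) //.
      by case: (j).
    rewrite hE in u c H *; have [_ ug] := uniq_vis_cat u.
    case: (slab_exit k0 ug a n) => -[q fE].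
      have [H1 _] := rest_up a cg fE u c.
      by rewrite [X in _ || (X || _)]catpI ?orbT //; exact: H1.
    have [H1 _] := rest_down a cg fE u c.
    by rewrite [X in _ || (_ || X)]catpI ?orbT //; exact: H1.
  have h1 : P * (b * b ^+ j.-1) <= P * b ^+ j by exact: ler_wpM2l.
  have q1 : q0 <= P * b ^+ j by rewrite /P mulrAC.
  rewrite exprS (_ : 5 ^+ M * b ^+ j.-1 * Q * b = P * (b * b ^+ j.-1)); last by rewrite /P; ring.
  rewrite (_ : 5 ^+ M * b ^+ j * Q = P * b ^+ j); last by rewrite /P; ring.
  rewrite (_ : 5 * 5 ^+ M * b ^+ j * Q = 5 * (P * b ^+ j)); last by rewrite /P; ring.
  by move: (P * _) (P * _) h1 q1 => y z; lra.
- apply: (@le_trans _ _ (q0 + (5 ^+ M * b ^+ j * Q * b + 5 ^+ M * b ^+ j.-1 * Q * 3))).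
    apply: (or3 _ _ _ _ _ _ _ g0 (p1 (sink k M i) (crossup k) _ _ IHs hb)
      (p1 (reach k M j.-1) (arcdown k) _ _ IHr hd)) => h /and3P[u c H].
    have [a|/(first_piece (slab0 k))[l [g [hE a n cg]]]] :=
      boolP (all (fun z => slab k z == 0) (points h)).
      rewrite (in0 (fun i => i <= - j%:Z) h u _ a H) //.
      by case: (j).
    rewrite hE in u c H *; have [_ ug] := uniq_vis_cat u.
    case: (slab_exit k0 ug a n) => -[q fE].
      have [_ H1] := rest_up a cg fE u c.
      by rewrite [X in _ || (X || _)]catpI ?orbT //; exact: H1.
    have [_ H1] := rest_down a cg fE u c.
    by rewrite [X in _ || (_ || X)]catpI ?orbT //; exact: H1.
  have h0 : b ^+ j * b <= b ^+ j.-1 by rewrite (le_trans _ bb) // ler_piMr.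
  have h1 : P * (b ^+ j * b) <= P * b ^+ j.-1 by exact: ler_wpM2l.
  have q1 : q0 <= P * b ^+ j.-1.
    by rewrite (le_trans q0P) // mulrAC -/P ler_wpM2l.
  rewrite exprS (_ : 5 ^+ M * b ^+ j * Q * b = P * (b ^+ j * b)); last by rewrite /P; ring.
  rewrite (_ : 5 ^+ M * b ^+ j.-1 * Q = P * b ^+ j.-1); last by rewrite /P; ring.
  rewrite (_ : 5 * 5 ^+ M * b ^+ j.-1 * Q = 5 * (P * b ^+ j.-1)); last by rewrite /P; ring.
  by move: (P * _) (P * _) h1 q1 => y z; lra.
Qed.

(** * Walks that start in an arbitrary direction and row *)

Lemma unitvD a b : unitv (a + b) = unitv a * unitv b.
Proof.
have [m [i -> Hi]] := mod6P a; have [n [j -> Hj]] := mod6P b.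
rewrite (_ : 6 * m + i + (6 * n + j) = 6 * m + (6 * n + (i + j))); last by ring.
rewrite !unitvD6; move: Hi Hj; rewrite !inE.
by case/or4P=> [|||/or3P[]] /eqP ->; case/or4P=> [|||/or3P[]] /eqP ->.
Qed.

(** The height of a vertex when the walk starts with heading [unitv i] in row [r]. *)
Definition level (i r : nat) (z : eis) : int := ht (unitv i%:Z * z) + (3 * r + odd i)%N%:Z.

(** The index of the strip, for the lines with offset [r] that are perpendicular to the direction
    of the measured heights. *)
Definition label k i r (z : eis) : int := (level i r z %/ (3 * k%:Z))%Z.

Lemma levelD i r p q : level i r (p + q) = level i r p + ht (unitv i%:Z * q).
Proof. by rewrite /level mulrDr htD addrAC. Qed.

Lemma unitv_nat (i : nat) : (i < 6)%N -> i \in [:: 0; 1; 2; 3; 4; 5]%N.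
Proof. by rewrite !inE; lia. Qed.

Lemma level_mod3 i r g : (i < 6)%N ->
  exists m, level i r (pos g) = 3 * m \/ level i r (pos g) = 3 * m + 1.
Proof.
move=> /unitv_nat i6; have [m Em] := ht_mod3 g.
exists (level i r (pos g) %/ 3)%Z; rewrite /level; move: i6 Em; rewrite !inE.
case: (pos g) => x y; rewrite /ht eis_mulE.
by case/or4P=> [|||/or3P[]] /eqP -> /=; lia.
Qed.

Lemma label0 k i r : (r < k)%N -> label k i r 0 = 0.
Proof.
move=> rk; rewrite /label /level mulr0 add0r divz_small //.
by case: (odd i); lia.
Qed.

Lemma label_eq0 k i r z : (0 < k)%N ->
  (label k i r z == 0) = (0 <= level i r z) && (level i r z < 3 * k%:Z).
Proof.
move=> k0; rewrite /label; move: (level i r z) => t.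
have d0 : 0 < 3 * k%:Z :> int by lia.
apply/eqP/idP => [H|]; last by rewrite -[X in _ < X]gtr0_norm // => /divz_small.
have := divz_eq t (3 * k%:Z); rewrite H mul0r add0r => ->.
by rewrite modz_ge0 ?gt_eqF // ltz_pmod.
Qed.

Lemma label_exit k i r g : (i < 6)%N -> (r < k)%N ->
  all (fun z => label k i r z == 0) (vis g) -> label k i r (pos g) != 0 ->
  (unitv i%:Z * dir g = 1 /\ level i r (pos g) = 3 * k%:Z) \/
  (unitv i%:Z * dir g = -1 /\ level i r (pos g) = -2).
Proof.
move=> i6 rk; have k0 : (0 < k)%N by lia.
case: g => [|b g]; first by rewrite label0.
rewrite [vis _]/= [all _ _]/= => /andP[+ _]; rewrite !label_eq0 //.
have [m Em] := level_mod3 r g i6; have [m' Em'] := level_mod3 r (b :: g) i6.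
move: Em'; rewrite pos_cons levelD.
have : unit6 (unitv i%:Z * dir (b :: g)) by rewrite dir_wind -unitvD unit6_unitv.
move: (unitv _ * dir _) (level i r (pos g)) Em => e t Em.
rewrite /unit6 !inE; case/or4P=> [|||/or3P[]] /eqP ->; rewrite /ht /= => Em' h1 h2.
all: first [by left; split=> //; lia | by right; split => //; lia | by exfalso; lia].
Qed.

Definition first_up k i r g := [&& uniq (vis g), all (fun z => label k i r z == 0) (vis g),
  unitv i%:Z * dir g == 1 & level i r (pos g) == 3 * k%:Z].
Definition first_down k i r g := [&& uniq (vis g), all (fun z => label k i r z == 0) (vis g),
  unitv i%:Z * dir g == -1 & level i r (pos g) == -2].

(** Read backwards, the first piece of a walk enters its strip through a boundary line. *)
Lemma first_rv k i r g : (0 < k)%N -> first_up k i r g || first_down k i r g -> instrip k (rv g).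
Proof.
move=> k0 H; have [u a lv] : [/\ uniq (vis g), all (fun z => label k i r z == 0) (vis g) &
    forall z, level i r (rvmap g z) = 3 * k%:Z - 2 - ht z \/ level i r (rvmap g z) = ht z].
  case/orP: H => /and4P[u a /eqP d /eqP l]; split=> // z; [left|right];
  rewrite /rvmap !levelD l !mulrN mulrA d ?mulN1r ?mul1r !htN ?htM1 ?ht1; lia.
rewrite /instrip uniq_vis_rv u; apply/allP => z zv.
have : label k i r (rvmap g z) == 0.
  by apply: (allP a); rewrite -mem_rev -rvmap_vis; exact: map_f.
have [m Em] := vis_mod3 zv.
by rewrite label_eq0 // /strip; case: (lv z) => ->; lia.
Qed.

Lemma gf_first (R : realType) m k i r (Q : R) : (0 < k)%N -> gf xc m (instrip k) <= Q ->
  gf xc m (first_up k i r) <= Q /\ gf xc m (first_down k i r) <= Q.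
Proof.
move=> k0 hQ; split; apply: le_trans hQ; apply: (@gf_inj _ _ _ _ _ _ rv) => //.
- exact: xc_ge0.
- by move=> h H; rewrite size_rv; split=> //; apply: (first_rv (i := i) (r := r)); rewrite ?H.
- by move=> h g _ _ /(inv_inj rvK).
- exact: xc_ge0.
- by move=> h H; rewrite size_rv; split=> //; apply: (first_rv (i := i) (r := r)); rewrite ?H ?orbT.
- by move=> h g _ _ /(inv_inj rvK).
Qed.

Definition high k i r M J h := [&& uniq (vis h), (changes (label k i r) h <= M)%N &
  has (fun z => J%:Z <= label k i r z) (points h)].

(** The first piece starts somewhere inside of its strip, hence it is bounded only by [Q]; the rest
    is bounded by [slab_bounds]. *)
Lemma gf_high (R : realType) m k i r (b Q : R) M J : (i < 6)%N -> (r < k)%N ->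
  0 <= b -> b <= 1 -> 0 <= Q ->
  gf xc m (crossup k) <= b -> gf xc m (instrip k) <= Q ->
  gf xc m (high k i r M J.+1) <= 2 * Q ^+ 2 * 5 ^+ M * b ^+ J.
Proof.
move=> i6 rk b0 b1 Q0 hb hQ; have k0 : (0 < k)%N by lia.
have x0 := xc_ge0 R; have [Q1 Q2] := gf_first i r k0 hQ.
have [B1 _] := slab_bounds k0 b0 b1 Q0 hb hQ M J.
have [_ B2] := slab_bounds k0 b0 b1 Q0 hb hQ M J.+2.
apply: (@le_trans _ _ (gf xc m (catp (reach k M J) (first_up k i r)) +
   gf xc m (catp (sink k M J.+2) (first_down k i r)))).
  apply: gf_or => // h /and3P[u c H].
  have /(first_piece (label0 i rk))[l [g [hE a n cg]]] :
      ~~ all (fun z => label k i r z == 0) (points h).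
    by apply/negP => a; have /hasP[z zh] := H; rewrite (eqP (allP a z zh)).
  rewrite hE in u c H *; have [_ ug] := uniq_vis_cat u.
  have {}c : (changes (label k i r) (l ++ g) <= M.+1)%N by exact: leqW.
  case: (label_exit i6 rk a n) => -[d lv].
    have fE g' : label k i r (pos g + dir g * pos g') = slab k (pos g') + 1.
      by rewrite /label levelD mulrA d mul1r lv slab_up.
    have [H1 _] := rest_up a cg fE u c.
    by rewrite catpI //; [exact: (H1 _ H)|rewrite /first_up ug a d lv !eqxx].
  have fE g' : label k i r (pos g + dir g * pos g') = -1 - slab k (pos g').
    by rewrite /label levelD mulrA d mulN1r htN lv slab_down.
  have [H1 _] := rest_down a cg fE u c.
  by rewrite [X in _ || X]catpI ?orbT //; [exact: (H1 _ H)|rewrite /first_down ug a d lv !eqxx].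
have gs (P : pred (seq bool)) : 0 <= gf xc m P :> R by exact: gf_ge0.
have P1 := le_trans (gf_catp m (reach k M J) (first_up k i r) x0) (ler_pM (gs _) (gs _) B1 Q1).
have P2 := le_trans (gf_catp m (sink k M J.+2) (first_down k i r) x0) (ler_pM (gs _) (gs _) B2 Q2).
apply: le_trans (lerD P1 P2) _.
have : b ^+ J.+2.-1 <= b ^+ J by rewrite ler_wiXn2l.
have : 0 <= 5 ^+ M * Q ^+ 2 :> R by rewrite mulr_ge0 ?exprn_ge0.
move=> /ler_wpM2l /[apply] h.
rewrite (_ : _ * b ^+ J * Q * Q = 5 ^+ M * Q ^+ 2 * b ^+ J); last by ring.
rewrite (_ : _ * b ^+ J.+2.-1 * Q * Q = 5 ^+ M * Q ^+ 2 * b ^+ J.+2.-1); last by ring.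
rewrite (_ : 2 * Q ^+ 2 * 5 ^+ M * b ^+ J = 2 * (5 ^+ M * Q ^+ 2 * b ^+ J)); last by ring.
by move: (5 ^+ M * _ * _) (5 ^+ M * _ * _) h => y z; lra.
Qed.

(** * Pigeonhole on the offset of the lines *)

Lemma label_row k i r g : (i < 6)%N -> (0 < k)%N ->
  label k i r (pos g) = (((level i 0 (pos g) %/ 3)%Z + r%:Z) %/ k%:Z)%Z.
Proof.
move=> i6 k0; have [m Em] := level_mod3 0 g i6.
have -> : (level i 0 (pos g) %/ 3)%Z = m by lia.
rewrite /label (_ : level i r (pos g) = level i 0 (pos g) + 3 * r%:Z); last first.
  by rewrite /level; lia.
rewrite divzMA_ge0 //; congr (_ %/ _)%Z; case: Em => ->; lia.
Qed.

(** Two adjacent rows are separated by a line for at most one of the offsets. *)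
Lemma sum_jumps (k : nat) (a b : int) : (0 < k)%N -> `|a - b| <= 1 ->
  (\sum_(r < k) (((a + r%:Z) %/ k%:Z)%Z != ((b + r%:Z) %/ k%:Z)%Z) <= 1)%N.
Proof.
move=> k0; wlog ab : a b / a <= b.
  move=> H; have [/H//|/ltW ba] := leP a b; rewrite distrC => d.
  by under eq_bigr do rewrite eq_sym; exact: H.
have [->|ne] := eqVneq a b; first by rewrite big1 // => r _; rewrite eqxx.
move=> d; have bE : b = a + 1 by lia.
have kz : k%:Z != 0 :> int by lia.
have jump (t : int) : ((t %/ k%:Z)%Z != ((t + 1) %/ k%:Z)%Z)%:Z = ((t + 1) %/ k%:Z)%Z - (t %/ k%:Z)%Z.
  have e := divz_eq t k%:Z; have r0 := modz_ge0 t kz; have r1 := @ltz_pmod t k%:Z (ltac:(lia)).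
  move: r0 r1 e; set q := (t %/ _)%Z; set r := (t %% _)%Z => r0 r1 e.
  have [rl|rl] := ltP (r + 1) k%:Z.
    have -> : ((t + 1) %/ k%:Z)%Z = q.
      by rewrite e -addrA divzMDl // divz_small ?addr0 //; lia.
    by rewrite eqxx subrr.
  have -> : ((t + 1) %/ k%:Z)%Z = q + 1.
    have -> : t + 1 = (q + 1) * k%:Z by rewrite e; lia.
    by rewrite mulzK.
  have -> : q != q + 1 by rewrite -[X in X != _]addr0 (inj_eq (addrI q)).
  by rewrite addrAC subrr.
suff : ((\sum_(r < k) (((a + r%:Z) %/ k%:Z)%Z != ((b + r%:Z) %/ k%:Z)%Z))%N : int) = 1.
  by move=> H; lia.
rewrite -natz natr_sum.
transitivity (\sum_(r < k) (((a + r.+1%:Z) %/ k%:Z)%Z - ((a + r%:Z) %/ k%:Z)%Z)).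
  apply: eq_bigr => r _; rewrite natz bE (_ : a + 1 + r%:Z = a + r%:Z + 1); last by lia.
  by rewrite jump (_ : a + r%:Z + 1 = a + r.+1%:Z) //; lia.
rewrite -(big_mkord xpredT (fun r => ((a + r.+1%:Z) %/ k%:Z)%Z - ((a + r%:Z) %/ k%:Z)%Z)).
rewrite telescope_sumr // addr0 (_ : a + k%:Z = 1 * k%:Z + a); last by lia.
by rewrite divzMDl // addrK.
Qed.

Lemma sum_changes k i h : (i < 6)%N -> (0 < k)%N ->
  (\sum_(r < k) changes (label k i r) h <= size h)%N.
Proof.
move=> i6 k0; elim: h => [|b h IH]; first by rewrite big1.
under eq_bigr do rewrite changes_cons.
rewrite big_split /= -add1n leq_add //.
set a := (level i 0 (pos (b :: h)) %/ 3)%Z; set c := (level i 0 (pos h) %/ 3)%Z.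
rewrite (eq_bigr (fun r : 'I_k => nat_of_bool
  (((a + r%:Z) %/ k%:Z)%Z != ((c + r%:Z) %/ k%:Z)%Z))); last first.
  by move=> r _; rewrite (label_row _ (b :: h)) // label_row.
apply: sum_jumps k0 _.
have [m Em] := level_mod3 0 h i6; have [m' Em'] := level_mod3 0 (b :: h) i6.
have : `|level i 0 (pos (b :: h)) - level i 0 (pos h)| <= 2.
  rewrite pos_cons levelD addrC addKr.
  have : unit6 (unitv i%:Z * dir (b :: h)) by rewrite dir_wind -unitvD unit6_unitv.
  by rewrite /unit6 !inE; case/or4P=> [|||/or3P[]] /eqP ->.
by rewrite /a /c; move: (level _ _ _) (level _ _ _) Em Em' => s t; lia.
Qed.

Lemma exists_offset k i h : (i < 6)%N -> (0 < k)%N ->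
  exists2 r, (r < k)%N & (changes (label k i r) h <= size h %/ k)%N.
Proof.
move=> i6 k0; have := sum_changes h i6 k0.
have [/existsP[r H]|] := boolP [exists r : 'I_k, changes (label k i r) h <= size h %/ k]%N.
  by exists r.
rewrite negb_exists => /forallP H.
have : (\sum_(r < k) (size h %/ k).+1 <= \sum_(r < k) changes (label k i r) h)%N.
  by apply: leq_sum => r _; have := H r; rewrite -ltnNge.
rewrite sum_nat_const card_ord => h1 h2; have := leq_trans h1 h2.
by have := ltn_ceil (size h) k0; rewrite mulnC; lia.
Qed.

(** Each walk has few cuts for one of the [k] offsets, so [gf_high] is summed over the offsets.
    Heights are measured in the direction that [unitv i] rotates to the heading 1. *)
Lemma far_bound (R : realType) n k i J (b Q : R) : (i < 6)%N -> (0 < k)%N ->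
  0 <= b -> b <= 1 -> 0 <= Q ->
  gf xc n.+1 (crossup k) <= b -> gf xc n.+1 (instrip k) <= Q ->
  \sum_(h <- words n | uniq (vis h) &&
      has (fun z => 3 * (k * J.+1)%:Z <= ht (unitv i%:Z * z)) (points h)) xc ^+ n <=
  k%:R * (2 * Q ^+ 2 * 5 ^+ (n %/ k) * b ^+ J).
Proof.
move=> i6 k0 b0 b1 Q0 hb hQ; have x0 := xc_ge0 R.
apply: (@le_trans _ _ (\sum_(r < k) gf xc n.+1 (high k i r (n %/ k) J.+1))); last first.
  apply: le_trans (ler_sum _ (fun r _ => gf_high (n %/ k) J i6 (ltn_ord r) b0 b1 Q0 hb hQ)) _.
  by rewrite sumr_const card_ord -[leLHS]mulr_natl.
rewrite /gf; under [leRHS]eq_bigr do rewrite big_mkcond.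
rewrite exchange_big /= [lwords _]/= big_cat /= big_mkcond.
apply: ler_wpDl.
  by apply: sumr_ge0 => h _; apply: sumr_ge0 => r _; case: ifP => // _; exact: exprn_ge0.
rewrite big_seq [leRHS]big_seq; apply: ler_sum => h; rewrite mem_words => /eqP hn.
have pos_t r : 0 <= (if high k i r (n %/ k) J.+1 h then xc ^+ size h else 0) :> R.
  by case: ifP => // _; exact: exprn_ge0.
case: ifP => [/andP[u far]|_]; last by apply: sumr_ge0.
have /hasP[z zh zE] : has (fun z => 3 * (k * J.+1)%:Z <= ht (unitv i%:Z * z)) (points h) := far.
have [r rk c] := exists_offset h i6 k0; rewrite hn in c.
have hi : high k i r (n %/ k) J.+1 h.
  apply/and3P; split=> //; apply/hasP; exists z => //.
  rewrite /label lez_divRL; last by lia.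
  by rewrite /level; move: zE; rewrite PoszM; lia.
rewrite (bigD1 (Ordinal rk)) //= hi hn lerDl; apply: sumr_ge0 => j _.
by case: ifP => // _; exact: exprn_ge0.
Qed.

(** * From the hexagonal lattice to turns *)

(** Coordinates in which the edges are the units of the ring of Eisenstein integers. *)
Definition eis_of (v : hex_vertex) : eis :=
  let: (a, b, s) := v in (2 * a + b + (s : nat)%:Z, b - a).

Arguments eis_of : simpl never.

Definition hex_of (p : eis) : hex_vertex :=
  (((p.1 - p.2) %/ 3)%Z, ((p.1 + 2 * p.2) %/ 3)%Z, ((p.1 - p.2) %% 3)%Z == 1).

Lemma eis_ofK : cancel eis_of hex_of.
Proof.
case=> [[a b] s]; rewrite /hex_of /eis_of /=; congr (_, _, _); case: s => /=; lia.
Qed.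

Lemma hex_ofK p : ((p.1 - p.2) %% 3)%Z != 2 -> eis_of (hex_of p) = p.
Proof.
case: p => x y; rewrite /hex_of /eis_of /= => h; congr pair; last by lia.
by have [e|e] := boolP (((x - y) %% 3)%Z == 1) => /=; lia.
Qed.

Definition units_from (s : bool) : seq eis :=
  if s then [:: (-1, 0); (1, -1); (0, 1)] else [:: (1, 0); (-1, 1); (0, -1)].

Lemma hex_adj_units u v : hex_adj u v ->
  eis_of v - eis_of u \in units_from u.2
  /\ v.2 = ~~ u.2.
Proof.
rewrite /hex_adj; case: u => [[a b] []] /=; rewrite !inE => /or3P[] /eqP -> /=.
all: rewrite /eis_of ?eis_addE ?eis_oppE !xpair_eqE /=; split=> //.
all: lia.
Qed.

(** A step that does not go back makes a turn by 60 degrees to the left or to the right. *)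
Lemma hex_turn u v w : hex_adj u v -> hex_adj v w -> w != u ->
  exists b, eis_of w - eis_of v = turn b * (eis_of v - eis_of u).
Proof.
move=> /hex_adj_units[d1 t1] /hex_adj_units[d2 _] wu.
have nb : eis_of w - eis_of v != - (eis_of v - eis_of u).
  by rewrite opprB (inj_eq (addIr _)) (inj_eq (can_inj eis_ofK)).
move: d1 d2 nb; rewrite t1; case: (u.2) => /=; rewrite !inE.
all: case/or3P=> /eqP ->; case/or3P=> /eqP -> // _.
all: by first [by exists true | by exists false].
Qed.

Lemma rcons2_cat (T : Type) (g : seq T) u v : rcons (rcons g u) v = g ++ u :: [:: v].
Proof. by rewrite -!cats1 -catA. Qed.

(** The first edge is one of three, and every further edge is a turn by [hex_turn]. *)
Lemma hex_walk_turns (g : seq hex_vertex) v : sorted hex_adj (rcons g v) -> uniq (rcons g v) ->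
  g != [::] -> head v g = hex_origin ->
  exists i h, [/\ i \in [:: 0; 2; 4]%N, (size h).+1 = size g &
    [seq eis_of z | z <- rcons g v] = rev [seq unitv i%:Z * (z + 1) | z <- trail h]].
Proof.
elim/last_ind: g v => // g u IH v.
have [-> /= |g0] := eqVneq g [::].
  move=> /andP[/hex_adj_units[d _] _] _ _ E; rewrite E in d *.
  have E0 : eis_of hex_origin = 0 by [].
  move: d; rewrite E0 subr0 => d.
  have [i i3 vE] : exists2 i : nat, i \in [:: 0; 2; 4]%N & eis_of v = unitv i%:Z.
    by move: d; rewrite !inE => /or3P[] /eqP ->; [exists 0%N|exists 2|exists 4].
  exists i, [::]; split=> //; rewrite /trail /= /rev /= vE addNr mulr0 add0r mulr1 //.
move=> s us _ oE.
have [s1 a1] : sorted hex_adj (rcons g u) /\ hex_adj u v.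
  by move: s; rewrite rcons2_cat sorted_cat_cons => /andP[s1 /= /andP[]].
have u1 : uniq (rcons g u) by move: us; rewrite rcons_uniq => /andP[].
have oE1 : head u g = hex_origin by move: oE; case: (g) g0.
have [i [h [i3 sz E]]] := IH u s1 u1 g0 oE1.
case/lastP: g g0 {IH oE oE1} s us s1 u1 sz E => // g t _ s us s1 u1 sz E.
have a2 : hex_adj t u.
  by move: s1; rewrite rcons2_cat sorted_cat_cons => /andP[_ /= /andP[]].
have vt : v != t.
  move: us; rewrite rcons_uniq => /andP[+ _]; apply: contra => /eqP ->.
  by rewrite mem_rcons inE mem_rcons mem_head orbT.
have Eu : eis_of u = unitv i%:Z * (pos h + 1).
  have := congr1 (last 0) E; rewrite !map_rcons last_rcons => ->.
  by rewrite /trail /= rev_cons last_rcons.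
have Et : eis_of t = unitv i%:Z * (pos h - dir h + 1).
  have := congr1 (fun l => nth 0 (rev l) 1) E.
  by rewrite revK !map_rcons !rev_rcons /trail /= vis_prev.
have [b bE] := hex_turn a2 a1 vt.
exists i, (b :: h); split=> //; first by rewrite size_rcons -sz.
rewrite trail_cons [map _ (_ :: _)]/= rev_cons -E map_rcons; congr rcons.
rewrite -[LHS](subrK (eis_of u)) bE Eu Et; ring.
Qed.

(** The points with (x - y) mod 3 = 2 are the centres of the hexagons. *)
Lemma hex_adj_of p q : unit6 (q - p) -> ((p.1 - p.2) %% 3)%Z != 2 ->
  ((q.1 - q.2) %% 3)%Z != 2 -> hex_adj (hex_of p) (hex_of q).
Proof.
set u := q - p; have -> : q = p + u by rewrite addrC subrK.
move: u; case: p => x y u; rewrite /unit6 /hex_adj /hex_of !inE => /=.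
have [e|e] := boolP (((x - y) %% 3)%Z == 1) => /=.
all: case/or4P=> [|||/or3P[]] /eqP -> /=; rewrite !inE !xpair_eqE; lia.
Qed.

Lemma trail_mod3 h z : z \in trail h -> (((z + 1).1 - (z + 1).2) %% 3)%Z != 2.
Proof.
rewrite /trail inE mem_cat => /or3P[/eqP ->|/vis_pos [g -> _]|]; last by rewrite inE => /eqP ->.
  have [m] := ht_mod3 h; case: (pos h) => x y; rewrite /ht eis_addE /=; lia.
have [m] := ht_mod3 g; case: (pos g) => x y; rewrite /ht eis_addE /=; lia.
Qed.

Definition walk_of (i : nat) (h : seq bool) : seq hex_vertex :=
  rev [seq hex_of (unitv i%:Z * (z + 1)) | z <- trail h].

Lemma size_walk_of i h : size (walk_of i h) = (size h).+2.
Proof. by rewrite size_rev size_map /= size_cat size_vis addn1. Qed.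

Lemma walk_of_cons i b h :
  walk_of i (b :: h) = rcons (walk_of i h) (hex_of (unitv i%:Z * (pos (b :: h) + 1))).
Proof. by rewrite /walk_of trail_cons [map _ (_ :: _)]/= rev_cons. Qed.

Lemma eis_of_walk h : [seq eis_of v | v <- walk_of 0 h] = rev [seq z + 1 | z <- trail h].
Proof.
rewrite /walk_of map_rev -map_comp; congr rev; apply/eq_in_map => z zh /=.
by rewrite mul1r hex_ofK // (trail_mod3 zh).
Qed.

Lemma trail_inj : injective trail.
Proof.
elim=> [|b h IH] [|b' h'] //.
- by move/(congr1 size); rewrite /= !size_cat addn1.
- by move/(congr1 size); rewrite /= !size_cat addn1.
rewrite !trail_cons => E; have hE := IH _ (congr1 behead E); move: E => /(congr1 (head 0)); rewrite -hE !pos_cons /= => /addrI.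
rewrite dir_wind -!unitv_turn => E; congr (_ :: _).
have [m [i wE Hi]] := mod6P (wind h); move: E; rewrite wE -!addrA !unitvD6.
by move: b b' Hi => [] []; rewrite !inE //; case/or4P=> [|||/or3P[]] /eqP ->.
Qed.

Lemma walk_of_inj : injective (walk_of 0).
Proof.
move=> h h' E; apply: trail_inj.
have := congr1 (map eis_of) E; rewrite !eis_of_walk => /(inv_inj revK).
by apply: inj_map; exact: addIr.
Qed.

Lemma walk_of_saw h : uniq (trail h) ->
  [&& head hex_origin (walk_of 0 h) == hex_origin, sorted hex_adj (walk_of 0 h) &
    uniq (walk_of 0 h)].
Proof.
move=> u; apply/and3P; split.
- by rewrite /walk_of /trail cats1 -rcons_cons map_rcons rev_rcons /=.
- elim: h {u} => [|b h IH]; first by [].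
  rewrite walk_of_cons; case E: (walk_of 0 h) IH => [|v s] //= IH.
  rewrite rcons_path IH /= -[last v s]/(last v (v :: s)) -E.
  rewrite /walk_of /trail /= rev_cons last_rcons !mul1r; apply: hex_adj_of.
  + rewrite (_ : _ - _ = dir (b :: h)); first exact: unit6_dir.
    by rewrite /=; ring.
  + by apply: (@trail_mod3 h); exact: mem_head.
  + by apply: (@trail_mod3 (b :: h)); exact: mem_head.
- rewrite -(map_inj_uniq (can_inj eis_ofK)) eis_of_walk rev_uniq map_inj_uniq //.
  exact: addIr.
Qed.

(** * Distances *)

Lemma sqr_enorm_eis (R : realType) v : 3 * enorm (hex_pos R v) ^+ 2 =
  ((eis_of v).1 ^+ 2 + (eis_of v).1 * (eis_of v).2 + (eis_of v).2 ^+ 2)%:~R.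
Proof.
have := sqr_enorm_hex_posB R hex_origin v.
rewrite hex_pos_origin (_ : hex_pos R v - (0, 0) = hex_pos R v); last exact: subr0.
move=> ->; congr _%:~R; case: v => [[a b] s]; rewrite /eis_of /= !subr0.
case: s => /=; ring.
Qed.

(** The squared norm as the sum of the squares of the heights in three directions at angles of 60
    degrees. *)
Lemma sum_sqr_ht p : ht p ^+ 2 + ht (unitv 1 * p) ^+ 2 + ht (unitv 2 * p) ^+ 2 =
  6 * (p.1 ^+ 2 + p.1 * p.2 + p.2 ^+ 2).
Proof. by case: p => x y; rewrite /ht !eis_mulE /=; ring. Qed.

(** By [sum_sqr_ht] one of the three heights is at least sqrt 6 times the distance, up to its sign,
    and the opposite heading takes care of the sign. *)
Lemma far_direction (R : realType) (E : R) v : 0 < E -> E <= enorm (hex_pos R v) ->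
  exists2 t : nat, (t < 6)%N & 2 * E <= (ht (unitv t%:Z * eis_of v))%:~R.
Proof.
move=> E0 Ev; have E2 : E ^+ 2 <= enorm (hex_pos R v) ^+ 2 by rewrite ler_pXn2r ?nnegrE ?(le_trans (ltW E0)).
have := sqr_enorm_eis R v.
have /(congr1 (fun z : int => z%:~R : R)) := sum_sqr_ht (eis_of v).
rewrite [X in _ = X -> _]rmorphM /= => H1 H2; rewrite -H2 in H1.
have neg k : ht (unitv (k + 3) * eis_of v) = - ht (unitv k * eis_of v).
  by rewrite unitvD mulrAC (_ : unitv 3 = -1) // mulrN1 htN.
move: H1; rewrite !rmorphD !rmorphXn /= => H1.
have three (x : int) : 2 * E <= `|x%:~R| -> 2 * E <= x%:~R \/ 2 * E <= (- x)%:~R.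
  by rewrite rmorphN; case: (ger0P (x%:~R : R)) => _ ?; [left|right].
have [/three [h|h]|h0] := lerP (2 * E) `|(ht (eis_of v))%:~R|.
- by exists 0%N; rewrite ?mul1r.
- by exists 3 => //; rewrite -[3%:Z]add0r neg mul1r.
have [/three [h|h]|h1] := lerP (2 * E) `|(ht (unitv 1 * eis_of v))%:~R|.
- by exists 1%N.
- by exists 4 => //; rewrite -[4%:Z]/(1 + 3 : int) neg.
have [/three [h|h]|h2] := lerP (2 * E) `|(ht (unitv 2 * eis_of v))%:~R|.
- by exists 2.
- by exists 5 => //; rewrite -[5%:Z]/(2 + 3 : int) neg.
have sq (x : int) : `|x%:~R : R| < 2 * E -> (x%:~R : R) ^+ 2 < 4 * E ^+ 2.
  rewrite -[X in _ -> X < _]real_normK ?num_real // => h.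
  have -> : 4 * E ^+ 2 = (2 * E) ^+ 2 by ring.
  by rewrite ltr_pXn2r ?nnegrE //; lra.
have := sq _ h0; have := sq _ h1; have := sq _ h2.
have : 0 < E ^+ 2 by rewrite exprn_gt0.
by clear -H1 E2; lra.
Qed.

Lemma unitv_ltn6 (k : int) : exists2 t : nat, (t < 6)%N & unitv k = unitv t%:Z.
Proof.
have [m [i -> Hi]] := mod6P k; exists `|i|%N; first by move: Hi; rewrite !inE; lia.
by rewrite unitvD6; congr unitv; move: Hi; rewrite !inE; lia.
Qed.

Lemma far_turns (R : realType) (E : R) v i h : 0 < E -> E <= enorm (hex_pos R v) ->
  eis_of v \in [seq unitv i%:Z * (z + 1) | z <- trail h] ->
  exists2 t : nat, (t < 6)%N &
    has (fun z => 2 * E - 2 <= (ht (unitv t%:Z * z))%:~R) (points h).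
Proof.
move=> E0 Ev vE; have [t _ tE] := far_direction E0 Ev.
have [z zh zE] := mapP vE; rewrite zE mulrA -unitvD in tE.
have [t' t6 eq] := unitv_ltn6 (t%:Z + i%:Z); rewrite eq mulrDr mulr1 htD in tE.
exists t' => //; apply/hasP; exists z.
  move: zh; rewrite /trail -cat_cons mem_cat => /orP[//|]; rewrite inE => /eqP zM.
  move: tE; rewrite zM mulrN1 htN addNr /=; lra.
have [_ _ _ h2] := unit6_bnd (unit6_unitv t'%:Z).
have : (ht (unitv t'%:Z))%:~R <= (2 : int)%:~R :> R by rewrite ler_int.
move: tE; rewrite rmorphD /=; lra.
Qed.

Lemma max_enorm_ge (R : realType) n (g : n.+1.-tuple hex_vertex) (E : R) : 0 < E ->
  E <= max_enorm R g -> exists2 v, v \in g & E <= enorm (hex_pos R v).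
Proof.
move=> E0; have [/hasP[v vg vE] _|] := boolP (has (fun v => E <= enorm (hex_pos R v)) g).
  by exists v.
move=> /hasPn H; rewrite leNgt => /negP[]; rewrite /max_enorm.
by apply: bigmax_lt => // k _; rewrite ltNge H // mem_tnth.
Qed.

(** * Counting *)

Definition far_words (N : nat) (P : pred int) (t : nat) : seq (seq bool) :=
  [seq h <- words N | uniq (vis h) && has (fun z => P (ht (unitv t%:Z * z))) (points h)].

Lemma hex_saw_words N (g : N.+2.-tuple hex_vertex) : hex_saw g ->
  exists i h, [/\ i \in [:: 0; 2; 4]%N, size h = N, uniq (trail h),
    [seq eis_of v | v <- g] = rev [seq unitv i%:Z * (z + 1) | z <- trail h] &
    tval g = walk_of i h].
Proof.
move=> /and3P[/eqP o s u]; case/lastP E: (tval g) => [|s' v].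
  by have := size_tuple g; rewrite E.
have sz : size s' = N.+1 by have := size_tuple g; rewrite E size_rcons => -[].
rewrite E in s u.
have [||i [h [i3 zh wE]]] := hex_walk_turns s u; first by rewrite -size_eq0 sz.
  move: o; rewrite /thead (tnth_nth hex_origin) E; case: s' sz {E s u} => //= a s' _ ->.
exists i, h; split; rewrite ?E //; first by move: zh; rewrite sz => -[].
  apply: (@map_uniq _ _ (fun z => unitv i%:Z * (z + 1))).
  by rewrite -rev_uniq -wE (map_inj_uniq (can_inj eis_ofK)).
by rewrite -[LHS](mapK eis_ofK) wE map_rev -map_comp.
Qed.

Lemma uniq_trail_vis h : uniq (trail h) -> uniq (vis h).
Proof. by rewrite /trail /= cat_uniq => /andP[_ /andP[]]. Qed.

(** The factor 3 counts the first steps, and the six headings are the directions in which a walk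
    may be far by [far_turns]. *)
Lemma card_far (R : realType) N (E : R) (P : pred int) : 0 < E ->
  (forall x, 2 * E - 2 <= x%:~R -> P x) ->
  (#|` fset_set (@hex_saw N.+1 `&` [set g | (E <= max_enorm R g)%R])%classic| <=
   3 * \sum_(t < 6) size (far_words N P t))%N.
Proof.
move=> E0 EP; set A := (_ `&` _)%classic.
have finA : finite_set A by apply: sub_finite_set (finite_hex_saw N.+1) => g [].
pose L := [seq walk_of i h | i <- [:: 0; 2; 4]%N, h <- flatten [seq far_words N P t | t <- iota 0 6]].
have -> : (3 * \sum_(t < 6) size (far_words N P t))%N = size L.
  rewrite size_allpairs size_flatten /shape -map_comp sumnE big_map.
  by rewrite -(big_mkord xpredT (fun t => size (far_words N P t))).
rewrite -(size_map val); apply: uniq_leq_size.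
  by rewrite map_inj_uniq ?fset_uniq //; exact: val_inj.
move=> w /mapP[g]; rewrite in_fset_set // inE => -[gs /= gE] ->.
have [i [h [i3 zh u eE wE]]] := hex_saw_words gs.
rewrite wE; apply: allpairs_f => //.
have [v vg vE] := max_enorm_ge E0 gE.
have [t t6 far] : exists2 t : nat, (t < 6)%N &
    has (fun z => 2 * E - 2 <= (ht (unitv t%:Z * z))%:~R) (points h).
  apply: (far_turns (v := v) (i := i)) => //.
  by rewrite -mem_rev -eE; exact: map_f.
apply/flatten_mapP; exists t; first by rewrite mem_iota.
rewrite mem_filter mem_words zh eqxx andbT uniq_trail_vis //=.
by apply: sub_has far => z; exact: EP.
Qed.

Lemma card_trails N :
  (size [seq h <- words N | uniq (trail h)] <= #|` fset_set (@hex_saw N.+1)|)%N.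
Proof.
rewrite -(size_map (walk_of 0)) -[X in (_ <= X)%N](size_map val); apply: uniq_leq_size.
  by rewrite map_inj_uniq ?filter_uniq ?uniq_words //; exact: walk_of_inj.
move=> w /mapP[h]; rewrite mem_filter mem_words => /andP[u /eqP hN ->].
have sz : size (walk_of 0 h) == N.+2 by rewrite size_walk_of hN.
have := walk_of_saw u; case E: (walk_of 0 h) sz => [|v s] // sz H.
apply/mapP; exists (Tuple sz) => //; rewrite in_fset_set; last exact: finite_hex_saw.
by rewrite inE /hex_saw /= /thead (tnth_nth hex_origin).
Qed.

(** Deleting the first and the last turn leaves room for the edge that leads to the origin. *)
Lemma saws_trails (R : realType) N : saws R N.+2 <=
  4 * (size [seq h <- words N | uniq (trail h)])%:R * xc ^+ N.+2.
Proof.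
rewrite /saws -big_filter big_const_seq count_predT iter_addr_0 -[leLHS]mulr_natl.
rewrite ler_wpM2r ?exprn_ge0 ?xc_ge0 // -natrM ler_nat.
pose B := [:: true; false].
pose L := [seq c :: g | c <- B, g <- [seq rcons h b | b <- B, h <- [seq h <- words N | uniq (trail h)]]].
have -> : (4 * size [seq h <- words N | uniq (trail h)])%N = size L.
  by rewrite !size_allpairs /= mulnA.
apply: uniq_leq_size; first by rewrite filter_uniq ?uniq_words.
move=> w; rewrite mem_filter mem_words => /andP[+ /eqP].
case: w => // c g; case/lastP: g => [|h b]; first by [].
rewrite -[size (c :: _)]/(size (rcons h b)).+1 size_rcons => u /eqP; rewrite !eqSS => /eqP hN.
have Bb x : x \in B by case: x.
apply: allpairs_f => //; apply: allpairs_f => //.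
rewrite mem_filter mem_words hN eqxx andbT.
move: u; rewrite [vis _]/= -/(points (rcons h b)) -cats1 points_cat.
apply: contraLR; rewrite -(map_inj_uniq (@eis_affine_inj [:: b])).
rewrite /trail -cat_cons map_cat -/(points h).
by rewrite [X in uniq (_ ++ X)](_ : _ = vis [:: b]) //; case: (b).
Qed.

(** The constant is 144 = 2 * (3 * 6) * 4 from [far_bound], [card_far] and [saws_trails]. *)
Lemma prob_far (R : realType) N (E : R) k j J (Q : R) : 0 < E -> (0 < k)%N ->
  gf xc N.+1 (crossup k) <= (9 / 10) ^+ j :> R ->
  0 <= Q -> gf xc N.+1 (instrip k) <= Q ->
  3 * (k * J.+1)%:R <= 2 * E - 2 ->
  hex_saw_prob R [set g : N.+2.-tuple hex_vertex | E <= max_enorm R g]%classic <=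
  144 * k%:R * Q ^+ 2 * 5 ^+ (N %/ k) * (9 / 10) ^+ (j * J).
Proof.
move=> E0 k0 hb Q0 hQ EJ; set b : R := (9 / 10) ^+ j.
have b0 : 0 <= b by rewrite exprn_ge0 //; lra.
have b1 : b <= 1 by rewrite exprn_ile1 //; lra.
pose P (x : int) := 3 * (k * J.+1)%:Z <= x.
have EP (x : int) : 2 * E - 2 <= x%:~R -> P x.
  move=> h; rewrite /P -(ler_int R) (_ : _%:~R = 3 * (k * J.+1)%:R); first exact: le_trans EJ h.
  by rewrite intrM.
have := card_far N E0 EP; set A := #|` _|%N => cA.
pose F := k%:R * (2 * Q ^+ 2 * 5 ^+ (N %/ k) * b ^+ J).
have far (t : 'I_6) : (size (far_words N P t))%:R * xc ^+ N <= F.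
  have := far_bound J (ltn_ord t) k0 b0 b1 Q0 hb hQ.
  by rewrite -big_filter big_const_seq count_predT iter_addr_0 -[leLHS]mulr_natl.
have cD := card_trails N; set D := #|` _|%N in cD.
rewrite /hex_saw_prob -/A -/D.
have x0 : 0 < xc ^+ N.+2 :> R by rewrite exprn_gt0 ?xc_gt0.
have hD : 1 <= 4 * D%:R * xc ^+ N.+2 :> R.
  apply: le_trans (saws_ge1 R _) (le_trans (saws_trails R N) _).
  by rewrite ler_wpM2r ?(ltW x0) // ler_wpM2l // ler_nat.
have D0 : 0 < D%:R :> R.
  rewrite lt_neqAle ler0n andbT eq_sym; apply: contraTneq hD => ->.
  by rewrite mulr0 mul0r -ltNge.
rewrite ler_pdivrMr //.
have hA : A%:R * xc ^+ N <= 18 * F.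
  apply: (@le_trans _ _ (3 * \sum_(t < 6) ((size (far_words N P t))%:R * xc ^+ N))).
    rewrite -mulr_suml mulrA ler_wpM2r ?exprn_ge0 ?xc_ge0 //.
    by rewrite -natr_sum -natrM ler_nat.
  have : \sum_(t < 6) ((size (far_words N P t))%:R * xc ^+ N) <= \sum_(t < 6) F.
    by apply: ler_sum.
  rewrite sumr_const card_ord -[F *+ 6]mulr_natl; lra.
have F0 : 0 <= F by rewrite !mulr_ge0 // ?exprn_ge0.
have xN : 0 < xc ^+ N :> R by rewrite exprn_gt0 ?xc_gt0.
rewrite -(ler_pM2r xN); apply: le_trans hA _.
have -> : 144 * k%:R * Q ^+ 2 * 5 ^+ (N %/ k) * (9 / 10) ^+ (j * J) = 72 * F.
  by rewrite /F /b -exprM; ring.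
rewrite -[_ * D%:R * _]mulrA -[leRHS]mulrA (_ : 18 * F = 72 * (F * 4^-1)); last by field.
rewrite ler_wpM2l // ler_wpM2l //.
have x2 : xc ^+ N.+2 <= xc ^+ N :> R by rewrite ler_wiXn2l ?xc_ge0 ?xc_le1 // leqW.
have : 4 * D%:R * xc ^+ N.+2 <= 4 * D%:R * xc ^+ N :> R by rewrite ler_wpM2l // mulr_ge0.
move: hD; rewrite -!mulrA; move: (D%:R * _) (D%:R * _) => y z; lra.
Qed.

(** * Choice of the parameters *)

(** No vertex of a walk is farther from the origin than its length. *)
Lemma prob_far0 (R : realType) n (E : R) : n.+1%:R < E ->
  hex_saw_prob R [set g : n.+2.-tuple hex_vertex | E <= max_enorm R g]%classic = 0.
Proof.
move=> nE; have E0 : 0 < E by apply: le_lt_trans nE; rewrite ler0n.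
pose P (x : int) := 2 * n%:Z < x.
have EP (x : int) : 2 * E - 2 <= x%:~R -> P x.
  move=> h; rewrite /P -(ltr_int R) (_ : _%:~R = 2 * n%:R); last by rewrite intrM.
  by move: nE; rewrite -natr1; lra.
suff none t : far_words n P t = [::].
  have := card_far n E0 EP; rewrite big1; last by move=> t _; rewrite none.
  by rewrite leqn0 /hex_saw_prob => /eqP ->; rewrite mul0r.
apply/eqP; rewrite -[_ == _]negbK -has_filter; apply/hasPn => h.
rewrite mem_words => /eqP hn; rewrite negb_and; apply/orP; right; apply/hasPn => z zh.
have [g -> gn] : exists2 g, z = pos g & (size g <= n)%N.
  by move: zh; rewrite inE -hn => /orP[/eqP ->|/vis_pos]; first by exists h.
rewrite /P -leNgt; have [] := pos_bound g; case: (pos g) => x y.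
have [m [i -> Hi]] := mod6P t%:Z; rewrite unitvD6 /ht /nl /nr eis_mulE.
by move: Hi; rewrite !inE; case/or4P=> [|||/or3P[]] /eqP -> /=; lia.
Qed.

Lemma two_thirds (R : realType) (n u : R) : 0 < n -> 0 < u -> u ^+ 3 <= n ->
  n `^ (2 / 3) * u <= n.
Proof.
move=> n0 u0 un; have un3 : u <= n `^ (3^-1).
  have -> : u = (u ^+ 3) `^ (3^-1).
    by rewrite -powR_mulrn ?(ltW u0) // -powRrM divff // powRr1 ?(ltW u0).
  by rewrite ge0_ler_powR ?nnegrE ?invr_ge0 ?exprn_ge0 ?(ltW u0) ?(ltW n0).
apply: le_trans (ler_wpM2l (powR_ge0 _ _) un3) _.
rewrite -powRD; last by apply/implyP => _; rewrite gt_eqF.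
by rewrite (_ : 2 / 3 + 3^-1 = 1) ?powRr1 ?(ltW n0) //; field.
Qed.

(** Here u = 1000 ^ j, w = j, 3 u is the distance of the lines in rows and 9 u in heights, A bounds
    the number of cuts, and y is the number of lines within the distance, of which up to two are
    lost by rounding. *)
Lemma steps_bound (R : realFieldType) (n u w E A y : R) : 1 <= u -> u ^+ 3 <= n ->
  1 <= w -> w <= u -> 90 * 1000 * n <= E * (w + 1) -> A * (3 * u) = n ->
  y * (9 * u) = 2 * E - 2 ->
  [/\ u <= 3 * A, 1 <= y & 20 * 1000 * A <= w * (y - 2)].
Proof.
move=> u1 un w1 wu EE AE yE.
have u0 : 0 < u by lra.
have uuA : u * u <= 3 * A.
  rewrite -(ler_pM2r u0); move: un; rewrite -AE (_ : u ^+ 3 = u * u * u) //; first by lra.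
  by ring.
have uu : u <= u * u by rewrite ler_peMr //; lra.
have uA : u <= 3 * A by lra.
have n0 : 0 <= n by rewrite -AE mulr_ge0 //; lra.
have E0 : 0 <= E.
  by rewrite -(pmulr_lge0 E (_ : 0 < w + 1)); lra.
have wE : 45 * 1000 * n <= E * w.
  have : E * 1 <= E * w by rewrite ler_wpM2l.
  by move: EE; rewrite mulrDr; lra.
have wy : 30 * 1000 * A - w <= w * y.
  rewrite -(ler_pM2r (_ : 0 < 9 * u)); last by lra.
  rewrite -[w * y * _]mulrA yE.
  have w2 : w * 2 <= w * (9 * u) by rewrite ler_wpM2l //; lra.
  rewrite (_ : _ * (9 * u) = 90 * 1000 * (A * (3 * u)) - w * (9 * u)); last by ring.
  rewrite AE (_ : w * (2 * E - 2) = 2 * (E * w) - w * 2); last by ring.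
  by move: (w * (9 * u)) (E * w) w2 wE => a b; lra.
split=> //; last by lra.
rewrite -(ler_pM2l (_ : 0 < w)); last by lra.
lra.
Qed.

(** Each factor is at most an exponential by 1 + t <= exp t. *)
Lemma exp_bounds (R : realType) k N p (u A : R) : k%:R = 3 * u -> 1 <= u -> u <= 3 * A ->
  (N %/ k)%:R <= A -> 20 * 1000 * A <= p%:R ->
  144 * k%:R * (60 * 2 ^+ k) ^+ 2 * 5 ^+ (N %/ k) * (9 / 10) ^+ p <= expR (- A) :> R.
Proof.
move=> ku u1 uA NA pA.
have A0 : 0 <= A by lra.
have e1 (x : R) : x <= expR x by have := expR_ge1Dx x; lra.
have eX (x y : R) m : 0 <= x -> x <= expR y -> x ^+ m <= expR (m%:R * y).
  by move=> x0 xy; rewrite expRM_natl lerXn2r ?nnegrE ?expR_ge0.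
have eM (a b x y : R) : 0 <= a -> 0 <= b -> a <= expR x -> b <= expR y -> a * b <= expR (x + y).
  by move=> a0 b0 ax by_; rewrite expRD ler_pM.
have e2 : 2 <= expR 1 :> R by have := expR_ge1Dx (1 : R); lra.
have e5 : 5 <= expR 4 :> R by have := expR_ge1Dx (4 : R); lra.
have e9 : 9 / 10 <= expR (- (1 / 10)) :> R by have := expR_ge1Dx (- (1 / 10) : R); lra.
have X2 : 60 * 2 ^+ k <= expR (60 + k%:R * 1) :> R by rewrite eM ?exprn_ge0 ?eX.
have ge0 (a : R) m : 0 <= a -> 0 <= a ^+ m by exact: exprn_ge0.
have Q0 : 0 <= 60 * 2 ^+ k :> R by rewrite mulr_ge0 ?ge0.
have n0 : 0 <= 9 / 10 :> R by lra.
have X5 := eX _ _ (N %/ k)%N (ler0n R 5) e5.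
have X9 := eX _ _ p n0 e9.
apply: le_trans (eM _ _ _ _ _ _ (eM _ _ _ _ _ _ (eM _ _ _ _ _ _ (eM _ _ _ _ _ _
  (e1 144) (e1 k%:R)) (eX _ _ 2 Q0 X2)) X5) X9) _; rewrite ?mulr_ge0 ?ge0 //.
rewrite ler_expR; lra.
Qed.

Lemma ln_succ_bound (R : realType) n : (0 < n)%N ->
  ln n.+1%:R <= 3 * 1000 * (trunc_log 1000 n %/ 3)%N.+1%:R :> R.
Proof.
move=> n0; set j := (_ %/ 3)%N.
have h : (n.+1 <= 1000 ^ (3 * j.+1))%N.
  apply: leq_trans (trunc_log_ltn n (isT : (1 < 1000)%N)) _.
  by rewrite leq_exp2l // mulnC ltn_ceil.
have h' : n.+1%:R <= 1000 ^+ (3 * j.+1) :> R by rewrite -natrX ler_nat.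
have p0 : 0 < 1000 :> R by rewrite ltr0n.
apply: (@le_trans _ _ (ln (1000 ^+ (3 * j.+1)))).
  by rewrite ler_ln ?posrE ?ltr0n ?exprn_gt0.
rewrite lnXn // -[leLHS]mulr_natl natrM.
have l1 : ln 1000 <= 1000 :> R.
  by rewrite ltW // ln_sublinear.
rewrite [leRHS]mulrAC ler_wpM2l // mulr_ge0 //.
Qed.

Local Open Scope classical_set_scope.
Local Open Scope ring_scope.

Theorem theorem1 (R : realType) :
  exists c : R, 0 < c /\
    forall n : nat, (1 <= n)%N ->
      hex_saw_prob R
        [set g : n.+1.-tuple hex_vertex |
           10 ^+ 11 * (n%:R / ln n.+1%:R) <= max_enorm R g]
      <= expR (- (c * n%:R `^ (2 / 3))).
Proof.
(* 3^-1 comes from n / (3 u), which is at least n^(2/3) / 3 as u^3 <= n. *)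
exists 3^-1; split; first by rewrite invr_gt0.
case=> // N _; set E := 10 ^+ 11 * _.
have L0 : 0 < ln N.+2%:R :> R by rewrite ln_gt0 // ltr1n.
have n0 : 0 < N.+1%:R :> R by rewrite ltr0n.
have E0 : 0 < E by rewrite mulr_gt0 ?exprn_gt0 // divr_gt0.
have EL : E * ln N.+2%:R = 10 ^+ 11 * N.+1%:R by rewrite /E -mulrA divfK ?gt_eqF.
clearbody E.
have [/prob_far0 ->|En] := ltP N.+1%:R E; first exact: expR_ge0.
pose c : R := 10 ^+ 8; have c10 : 300 * 1000 <= c.
  have t0 : 1 <= 10 :> R by rewrite ler1n.
  have := exprn_ege1 2 t0; have -> : c = 1000 * 1000 * 10 ^+ 2 by rewrite /c; ring.
  by move: (10 ^+ 2) => x; lra.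
have p0 : 0 < 1000 :> R by rewrite ltr0n.
have T : 10 ^+ 11 = 1000 * c by rewrite /c; ring.
clearbody c.
have L1 : 10 ^+ 11 <= ln N.+2%:R :> R.
  rewrite -(ler_pM2r n0) -EL mulrC ler_wpM2l ?(ltW L0) //.
have := ln_succ_bound R (ltn0Sn N); set j := (_ %/ 3)%N => Lj.
have j1 : 1 <= j%:R :> R.
  have := le_trans L1 Lj; rewrite T -[j.+1%:R]natr1 (mulrC 3) -mulrA (ler_pM2l p0).
  have : 1 <= 1000 :> R by rewrite ler1n.
  by clear -c10; move: (1000 : R) (j%:R) c c10 => m a b; lra.
pose u : R := (1000 ^ j)%:R; pose k := (3 * 1000 ^ j)%N.
have k0 : (0 < k)%N by rewrite muln_gt0 expn_gt0.
have ku : k%:R = 3 * u by rewrite natrM.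
have u1 : 1 <= u by rewrite ler1n expn_gt0.
have un : u ^+ 3 <= N.+1%:R.
  rewrite -natrX ler_nat -expnM.
  apply: leq_trans (trunc_logP (isT : (1 < 1000)%N) (ltn0Sn N)).
  by rewrite leq_exp2l // /j leq_trunc_div.
have ju : j%:R <= u by rewrite ler_nat ltnW // ltn_expl.
have EE : 90 * 1000 * N.+1%:R <= E * (j%:R + 1).
  have : 1000 * (c * N.+1%:R) <= 1000 * (3 * (E * (j%:R + 1))).
    rewrite mulrA -T -EL natr1; apply: le_trans (ler_wpM2l (ltW E0) Lj) _.
    by rewrite le_eqVlt; apply/orP; left; apply/eqP; move: (E) (j.+1%:R) => a b; ring.
  rewrite (ler_pM2l p0); have := ler_wpM2r (ltW n0) c10; have := mulr_gt0 p0 n0.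
  by rewrite -!mulrA; clear; move: (1000 * _) (c * _) (E * _) => a b d; lra.
clear T L1 Lj EL c10 c.
pose A := N.+1%:R / (3 * u); pose y := (2 * E - 2) / (9 * u).
have u0 : 0 < u := lt_le_trans ltr01 u1.
have AE : A * (3 * u) = N.+1%:R by rewrite divfK // gt_eqF // mulr_gt0.
have yE : y * (9 * u) = 2 * E - 2 by rewrite divfK // gt_eqF // mulr_gt0.
have [uA y1 yA] := steps_bound u1 un j1 ju EE AE yE.
clear EE; have y0 : 0 <= y := le_trans ler01 y1.
have [J JE] : exists J, Num.truncn y = J.+1.
  by exists (Num.truncn y).-1; rewrite prednK // truncn_gt0.
have /andP[] := truncn_itv y0; rewrite JE => Jy yJ.
have X := @prob_far R N E k j J (60 * 2 ^+ k) E0 k0 (gf_crossup_decay R _ j).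
apply: le_trans (X _ _ _) _.
- by rewrite mulr_ge0 ?exprn_ge0.
- clear -k0; case: (k) k0 => [|k'] // _; apply: le_trans (gf_instrip R _ k') _.
  rewrite exprS; have : 0 <= 2 ^+ k' :> R by rewrite exprn_ge0.
  by lra.
- rewrite natrM ku -yE (_ : 3 * (3 * u * _) = J.+1%:R * (9 * u)); last by move: (u) (J.+1%:R) => a b; clear; ring.
  by rewrite ler_wpM2r // mulr_ge0 // ltW.
have A1 : (N %/ k)%:R <= A.
  rewrite -(ler_pM2r (mulr_gt0 (ltr0n R 3) u0)) AE.
  by rewrite -ku -natrM ler_nat; exact: leq_trans (leq_trunc_div _ _) (leqnSn N).
have A2 : 20 * 1000 * A <= (j * J)%:R.
  apply: le_trans yA _; rewrite natrM ler_wpM2l //.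
  by clear -yJ; move: yJ; rewrite -!natr1; lra.
apply: le_trans (exp_bounds ku u1 uA A1 A2) _.
rewrite ler_expR lerN2.
have := two_thirds n0 u0 un; rewrite -{2}AE mulrA ler_pM2r //; clear; lra.
Qed.
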